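(* Let $K$ be a separable Hilbert space and let $\mathscr P=\mathscr P^{\mathrm{bil}}$ be the bilinear reachability Gramian of $(A,N,B,B_{\mathrm{in}})$. Let $r>\tau>0$ and let $g\in L^1((-r,0),\mathbb R)$ with $\int_{-r}^0|g(s)|\,ds\le1$. Let the operator $\mathsf K$ be given either by $(\mathsf K\varphi)(t)=\varphi(t-\tau)$ or by $(\mathsf K\varphi)(t)=\int_{-r}^0g(s)\varphi(t+s)\,ds$. Then the closure of the range of $\mathscr P$ is an invariant space of the flow of $$\varphi'(t)=A\varphi(t)+N(\mathsf K\varphi)(t)+Bu(t),\quad t>0,\qquad \varphi(0)=\varphi_0,\quad\varphi(\sigma)=f(\sigma)\ \text{ for }\sigma\in(-r,0);$$ that is, for any $(\varphi_0,f)\in\overline{\operatorname{ran}(\mathscr P)}\times L^2((-r,0),\overline{\operatorname{ran}(\mathscr P)})$ and any control $u\in L^2((0,\infty),\mathbb R^n)$, the solution satisfies $\varphi(t)\in\overline{\operatorname{ran}(\mathscr P)}$ for all $t>0$.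
   Context: $A$ generates a $C_0$-semigroup $(T(t))_{t\ge0}$ on $K$ with $\|T(t)\|\le Me^{-\omega t}$ for some $M,\omega>0$; $N\in\mathcal L(K)$ with $M\|N\|/\sqrt{2\omega}<1$; $B\in\mathcal L(\mathbb R^n,K)$, $Bu=\sum_{i=1}^n\psi_iu_i$ with $\psi_i\in K$; $B_{\mathrm{in}}\in\mathcal L(\mathbb R^k,K)$, $B_{\mathrm{in}}w=\sum_{i=1}^kw_i\phi_i$ with $(\phi_i)$ an orthonormal system in $K$. Reachability Gramian. $P_0(t_1):=T(t_1)^*$, and for $i\ge1$, $P_i(t_1,\dots,t_{i+1}):=T(t_1)^*N^*\cdots T(t_i)^*N^*\,T(t_{i+1})^*$. Define $\mathscr P_0$ by $\langle x,\mathscr P_0y\rangle=\int_0^\infty\langle T(s)^*x,BB^*T(s)^*y\rangle\,ds+\langle x,B_{\mathrm{in}}B_{\mathrm{in}}^*y\rangle$ and, for $i\ge1$, $\mathscr P_i$ by $$\langle x,\mathscr P_iy\rangle=\int_{(0,\infty)^{i+1}}\langle P_i(s)x,BB^*P_i(s)y\rangle\,ds+\int_{(0,\infty)^i}\langle P_{i-1}(s)x,B_{\mathrm{in}}B_{\mathrm{in}}^*P_{i-1}(s)y\rangle\,ds.$$ Then $\mathscr P^{\mathrm{bil}}:=\sum_{i\ge0}\mathscr P_i$, a trace class operator on $K$. Solutions of the delay equation are understood in the mild sense: $\varphi(t)$ is the first component of $\mathcal T(t)(\varphi_0,f)+\int_0^t\mathcal T(t-s)(Bu(s),0)\,ds$,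 where $(\mathcal T(t))$ is the $C_0$-semigroup on $\mathcal K=K\times L^2((-r,0),K)$ generated by $(x,h)\mapsto(Ax+\Phi h,\ h')$ with domain $\{(x,h)\in D(A)\times H^1((-r,0),K):h(0)=x\}$, where $\Phi h=Nh(-\tau)$ or $\Phi h=\int_{-r}^0Nh(s)g(s)\,ds$ respectively. *)

(* Defs.v *)
From HB Require Import structures.
From mathcomp Require Import all_boot all_order all_algebra generic_quotient.
From mathcomp Require Import all_classical all_reals all_analysis.
From mathcomp Require Import measurable_realfun.

Set Implicit Arguments.
Unset Strict Implicit.
Unset Printing Implicit Defensive.

Import Order.TTheory GRing.Theory Num.Theory.
Import numFieldNormedType.Exports.

Local Open Scope classical_set_scope.
Local Open Scope ring_scope.

HB.mixin Record isHilbert (R : realType) V of CompleteNormedModule R V := {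
  inner : V -> V -> R ;
  innerC : forall x y, inner x y = inner y x ;
  inner_linear : forall z a x y,
    inner (a *: x + y) z = a * inner x z + inner y z ;
  inner_norm : forall x, inner x x = `|x| ^+ 2
}.

#[short(type="hilbertType")]
HB.structure Definition Hilbert (R : realType) :=
  {V of CompleteNormedModule R V & isHilbert R V}.

Definition separable (V : topologicalType) :=
  exists2 S : set V, countable S & dense S.

Definition orthonormal_system (R : realType) (K : hilbertType R) k
    (phi : 'I_k -> K) :=
  forall i j, inner (phi i) (phi j) = (i == j)%:R.

Definition opnorm (R : realType) (V W : normedModType R) (f : V -> W) : R :=
  sup [set `|f x| | x in [set x | `|x| <= 1]].

(* For a bounded linear [f] the adjoint exists and is unique by the Riesz
   representation theorem; [get] selects it. *)
Definition adj (R : realType) (K : hilbertType R) (f : K -> K) : K -> K :=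
  get [set g : K -> K | forall x y, inner (f x) y = inner x (g y)].

(* [inp psi] is the operator u |-> \sum_i psi_i u_i from R^n to K; [inp_adj psi]
   is its adjoint with respect to the Euclidean inner product of R^n. *)
Definition inp (R : realType) (K : hilbertType R) n (psi : 'I_n -> K)
  (u : 'rV[R]_n) : K := \sum_(i < n) u 0 i *: psi i.

Definition inp_adj (R : realType) (K : hilbertType R) n (psi : 'I_n -> K)
  (x : K) : 'rV[R]_n := \row_(i < n) inner (psi i) x.

Lemma inner_sumZl (R : realType) (K : hilbertType R) n (psi : 'I_n -> K)
    (u : 'I_n -> R) (x : K) :
  inner (\sum_(i < n) u i *: psi i) x = \sum_(i < n) u i * inner (psi i) x.
Proof.
have i0 z : inner (0 : K) z = 0.
  have := inner_linear z 1 0 0; rewrite scaler0 addr0 mul1r.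
  by move=> /(congr1 (fun t => t - inner 0 z)); rewrite subrr addrK.
elim/big_rec2: _ => [|i a b _ IH]; first exact: i0.
by rewrite inner_linear IH.
Qed.

Lemma inp_adjP (R : realType) (K : hilbertType R) n (psi : 'I_n -> K) u x :
  inner (inp psi u) x = \sum_(i < n) u 0 i * inp_adj psi x 0 i.
Proof.
rewrite /inp (@inner_sumZl _ _ _ psi (fun i => u 0 i)).
by apply: eq_bigr => i _; rewrite mxE.
Qed.

(* Only the values at t >= 0 are constrained. *)
Definition C0_semigroup (R : realType) (V : normedModType R)
    (T : R -> {linear V -> V}) :=
  [/\ forall t, 0 <= t -> continuous (T t),
      forall x, T 0 x = x,
      forall s t, 0 <= s -> 0 <= t -> forall x, T (s + t) x = T s (T t x)
    & forall x, T t x @[t --> 0^'+] --> x].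

(* Unbounded operators are represented by their graphs. *)
Definition generator (R : realType) (V : normedModType R)
    (T : R -> {linear V -> V}) : set (V * V) :=
  [set p | h^-1 *: (T h p.1 - p.1) @[h --> 0^'+] --> p.2].

Definition generates (R : realType) (V : normedModType R) (A : set (V * V))
    (T : R -> {linear V -> V}) := C0_semigroup T /\ A = generator T.

Section bochner.
Context {R : realType} {d : measure_display} {T : measurableType d}.
Context {V : normedModType R}.
Implicit Types (mu : {measure set T -> \bar R}) (D : set T) (f : T -> V).

(* The list [:: (A_1, v_1); ...] represents the simple function
   \sum_i 1_(A_i) v_i. *)
Definition simple_eval (s : seq (set T * V)) (x : T) : V :=
  \sum_(p <- s) (\1_(p.1) x : R) *: p.2.

Definition simple_int mu (s : seq (set T * V)) : V :=
  \sum_(p <- s) fine (mu p.1) *: p.2.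

(* Convergence is required everywhere on [D] rather than almost everywhere:
   the sigma-algebra need not be complete, and every almost everywhere class
   contains such a representative. *)
Definition strongly_measurable D f :=
  exists s : nat -> seq (set T * V),
    (forall k p, p \in s k -> measurable p.1) /\
    (forall x, D x -> simple_eval (s k) x @[k --> \oo] --> f x).

Definition is_bochner mu D f (v : V) :=
  exists s : nat -> seq (set T * V),
    [/\ forall k p, p \in s k ->
          [/\ measurable p.1, p.1 `<=` D & (mu p.1 < +oo)%E],
        forall x, D x -> simple_eval (s k) x @[k --> \oo] --> f x,
        (\int[mu]_(x in D) `|f x - simple_eval (s k) x|%:E)%E
          @[k --> \oo] --> 0%E
      & simple_int mu (s k) @[k --> \oo] --> v].

(* Equal to 0 when [f] is not Bochner integrable. *)
Definition bochner mu D f : V := xget 0 (is_bochner mu D f).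

End bochner.

Section strongly_measurable_lemmas.
Context {R : realType} {d : measure_display} {T : measurableType d}.
Context {V : normedModType R}.
Implicit Types (D : set T) (f g : T -> V).

Lemma simple_eval_cat (s t : seq (set T * V)) x :
  simple_eval (s ++ t) x = simple_eval s x + simple_eval t x.
Proof. by rewrite /simple_eval big_cat. Qed.

Lemma simple_eval_scale (a : R) (s : seq (set T * V)) x :
  simple_eval [seq (p.1, a *: p.2) | p <- s] x = a *: simple_eval s x.
Proof.
rewrite /simple_eval big_map scaler_sumr; apply: eq_bigr => p _ /=.
by rewrite !scalerA mulrC.
Qed.

Lemma strongly_measurable0 D : strongly_measurable D (fun _ => 0 : V).
Proof.
exists (fun _ => [::]); split => // x _.
by rewrite /simple_eval; under eq_fun do rewrite big_nil; exact: cvg_cst.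
Qed.

Lemma strongly_measurableD D f g : strongly_measurable D f ->
  strongly_measurable D g -> strongly_measurable D (fun x => f x + g x).
Proof.
move=> [s [ms sf]] [t [mt tg]]; exists (fun k => s k ++ t k); split.
  by move=> k p; rewrite mem_cat => /orP[/ms|/mt].
move=> x Dx; under eq_fun do rewrite simple_eval_cat.
by apply: cvgD; [exact: sf|exact: tg].
Qed.

Lemma strongly_measurableZ D (a : R) f : strongly_measurable D f ->
  strongly_measurable D (fun x => a *: f x).
Proof.
move=> [s [ms sf]].
exists (fun k => [seq (p.1, a *: p.2) | p <- s k]); split.
  by move=> k p /mapP[q /ms mq ->].
move=> x Dx; under eq_fun do rewrite simple_eval_scale.
by apply: cvgZr; exact: sf.
Qed.

Lemma simple_eval_preimage (s : seq (set T * V)) (B : set V) :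
  (forall p, p \in s -> measurable p.1) -> measurable (simple_eval s @^-1` B).
Proof.
move=> ms; suff H c : measurable [set x | B (c + simple_eval s x)].
  by have := H 0; congr measurable; apply/seteqP; split => x /=; rewrite add0r.
elim: s ms c => [|p s IH] ms c.
  rewrite /simple_eval; have [Bc|nBc] := pselect (B c).
    have -> : [set x : T | B (c + \sum_(q <- [::]) (\1_(q.1) x : R) *: q.2)] = setT.
      by apply/seteqP; split => // x _ /=; rewrite big_nil addr0.
    exact: measurableT.
  have -> : [set x : T | B (c + \sum_(q <- [::]) (\1_(q.1) x : R) *: q.2)] = set0.
    by apply/seteqP; split => // x /=; rewrite big_nil addr0.
  exact: measurable0.
have mp : measurable p.1 by apply: ms; rewrite mem_head.
have {}IH c' : measurable [set x | B (c' + simple_eval s x)].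
  by apply: IH => q qs; apply: ms; rewrite in_cons qs orbT.
have -> : [set x | B (c + simple_eval (p :: s) x)] =
    (p.1 `&` [set x | B ((c + p.2) + simple_eval s x)]) `|`
    (~` p.1 `&` [set x | B (c + simple_eval s x)]).
  apply/seteqP; split => x /=; rewrite /simple_eval big_cons.
    have [px|px] := pselect (p.1 x).
      by rewrite indicE mem_set// scale1r addrA; left.
    by rewrite indicE memNset// scale0r add0r; right.
  case=> -[px].
    by rewrite indicE mem_set// scale1r addrA.
  by rewrite indicE memNset// scale0r add0r.
by apply: measurableU; apply: measurableI => //; exact: measurableC.
Qed.

Lemma strongly_measurable_norm D f : measurable D -> strongly_measurable D f ->
  measurable_fun setT ((fun x => `|f x|) \_ D).
Proof.
move=> mD [s [ms sf]]; apply/(measurable_restrictT _ mD).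
apply: (@measurable_fun_cvg _ _ _ _ (fun k x => `|simple_eval (s k) x|)).
  move=> k _ Y mY; apply: measurableI => //.
  apply: (@simple_eval_preimage (s k) ((fun v : V => `|v|) @^-1` Y)).
  exact: ms.
by move=> x Dx; apply: cvg_norm; exact: sf.
Qed.

End strongly_measurable_lemmas.

Section L2norm_lemmas.
Context {R : realType} {d : measure_display} {T : measurableType d}.
Context {mu : {measure set T -> \bar R}} {V : normedModType R}.
Context (D : set T) (mD : measurable D).
Implicit Types f g : T -> V.

Let N f : \bar R := 'N[mu]_2%:E[EFin \o ((fun x => `|f x|) \_ D)].

Let mnorm f : strongly_measurable D f ->
  measurable_fun setT ((fun x => `|f x|) \_ D).
Proof. exact: strongly_measurable_norm. Qed.

Let mpow (F : T -> R) : measurable_fun setT F ->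
  measurable_fun setT (fun x => (`|F x|%:E `^ 2)%E).
Proof.
move=> mF; apply: (measurableT_comp (measurable_poweR _)) => //.
by apply/measurable_EFinP; exact: measurableT_comp.
Qed.

Let le_Lnorm (F G : T -> R) : measurable_fun setT F -> measurable_fun setT G ->
  (forall x, `|F x| <= `|G x|) ->
  ('N[mu]_2%:E[EFin \o F] <= 'N[mu]_2%:E[EFin \o G])%E.
Proof.
move=> mF mG FG; rewrite unlock.
apply: gt0_ler_poweR; rewrite ?invr_ge0 ?ler0n// ?in_itv/= ?leey ?andbT.
- by apply: integral_ge0 => x _; rewrite lee_fin powR_ge0.
- by apply: integral_ge0 => x _; rewrite lee_fin powR_ge0.
apply: ge0_le_integral => //.
- exact: mpow mF.
- exact: mpow mG.
by move=> x _; rewrite lee_fin ge0_ler_powR ?nnegrE.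
Qed.

Lemma Lnorm2_0 : N (fun _ => 0) = 0%E.
Proof.
rewrite /N (_ : EFin \o _ = cst 0%E); first by rewrite Lnorm0.
by apply/funext => x /=; rewrite patchE; case: ifP => //; rewrite normr0.
Qed.

Lemma Lnorm2_D f g : strongly_measurable D f -> strongly_measurable D g ->
  (N (fun x => f x + g x)%R <= N f + N g)%E.
Proof.
move=> mf mg.
have mF := mnorm mf; have mG := mnorm mg.
have mFG := mnorm (strongly_measurableD mf mg).
have le21 : (1 <= 2%:E :> \bar R)%E by rewrite lee_fin ler1n.
apply: le_trans (eminkowski _ mF mG le21).
apply: le_Lnorm => //; first exact: measurable_funD.
move=> x /=; rewrite !patchE; case: ifP => _; last by rewrite addr0.
by rewrite normr_id (le_trans (ler_normD _ _))// ler_norm.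
Qed.

Lemma Lnorm2_Z (a : R) f : strongly_measurable D f -> (N f < +oo)%E ->
  N (fun x => a *: f x) = (`|a|%:E * N f)%E.
Proof.
move=> mf ff; have le21 : (1 <= 2%:E :> \bar R)%E by rewrite lee_fin ler1n.
pose F : T -> R := (fun x => `|f x|) \_ D.
have FL : F \in Lfun mu 2%:E.
  by apply/andP; split; rewrite inE/=; [exact: mnorm|exact: ff].
have := @LnormZ _ _ _ mu _ le21 (Lfun_Sub le21 FL) `|a|.
rewrite normr_id => <-; congr Lnorm; apply/funext => x /=.
rewrite /F /= !patchE; case: ifP => _; last by rewrite /= scaler0.
by rewrite normrZ.
Qed.

Lemma Lnorm2_ae f g : strongly_measurable D f -> strongly_measurable D g ->
  f = g %[ae mu in D] -> N f = N g.
Proof.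
move=> mf mg fg; rewrite /N unlock.
suff -> : (\int[mu]_x `|(EFin \o ((fun x => `|f x|%R) \_ D)) x| `^ 2 =
  \int[mu]_x `|(EFin \o ((fun x => `|g x|%R) \_ D)) x| `^ 2)%E by [].
apply: ge0_ae_eq_integral => //.
- exact: mpow (mnorm mf).
- exact: mpow (mnorm mg).
- by move=> x _; exact: poweR_ge0.
- by move=> x _; exact: poweR_ge0.
apply: filterS fg => x fgx _ /=; rewrite !patchE.
by case: ifPn => // /set_mem /fgx ->.
Qed.

Lemma Lnorm2_eq0 f : strongly_measurable D f -> N f = 0%E ->
  f = (fun _ => 0) %[ae mu in D].
Proof.
move=> mf /Lnorm_eq0_eq0 H.
have {}H := H ((measurable_EFinP _ _).2 (mnorm mf)) (ltr0n _ 2).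
apply: filterS H => x /(_ I)/= + Dx.
by rewrite patchE mem_set// => -[] /normr0_eq0.
Qed.

End L2norm_lemmas.

Section L2.
Context {R : realType}.
Notation mu := (@lebesgue_measure R).
Implicit Types (i : interval R) (V : normedModType R).

Definition L2norm_fun i V (f : R -> V) : \bar R :=
  'N[mu]_2%:E[EFin \o ((fun x => `|f x|) \_ [set` i])].

Record L2fun i V := MkL2fun {
  L2val :> R -> V ;
  L2fun_meas : strongly_measurable ([set` i] : set (measurableTypeR R)) L2val ;
  L2fun_fin : (L2norm_fun i L2val < +oo)%E
}.

HB.instance Definition _ i V := gen_eqMixin (L2fun i V).
HB.instance Definition _ i V := gen_choiceMixin (L2fun i V).

Definition L2eqv i V (f g : L2fun i V) : bool :=
  `[< L2val f = L2val g %[ae mu in [set` i] ] >].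

End L2.

Section L2_lemmas.
Context {R : realType} (i : interval R) (V : normedModType R).

Notation mu := (@lebesgue_measure R).
Notation D := [set` i].
Notation sm := (strongly_measurable (D : set (measurableTypeR R))).

Lemma L2norm_fun0 : L2norm_fun i (fun _ => 0 : V) = 0%E.
Proof. exact: (@Lnorm2_0 _ _ _ mu V D). Qed.

Lemma L2norm_funD (f g : R -> V) : sm f -> sm g ->
  (L2norm_fun i (fun x => f x + g x)%R <= L2norm_fun i f + L2norm_fun i g)%E.
Proof. by move=> mf mg; exact: (@Lnorm2_D _ _ _ mu V D (measurable_itv i) _ _ mf mg). Qed.

Lemma L2norm_funZ (a : R) (f : R -> V) : sm f -> (L2norm_fun i f < +oo)%E ->
  L2norm_fun i (fun x => a *: f x) = (`|a|%:E * L2norm_fun i f)%E.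
Proof. by move=> mf ff; exact: (@Lnorm2_Z _ _ _ mu V D (measurable_itv i) a f mf ff). Qed.

Lemma L2norm_fun_ae (f g : R -> V) : sm f -> sm g ->
  f = g %[ae mu in D] -> L2norm_fun i f = L2norm_fun i g.
Proof. by move=> mf mg fg; exact: (@Lnorm2_ae _ _ _ mu V D (measurable_itv i) _ _ mf mg fg). Qed.

Lemma L2norm_fun_eq0 (f : R -> V) : sm f -> L2norm_fun i f = 0%E ->
  f = (fun _ => 0) %[ae mu in D].
Proof. by move=> mf f0; exact: (@Lnorm2_eq0 _ _ _ mu V D (measurable_itv i) _ mf f0). Qed.

Lemma L2eqv_refl : reflexive (@L2eqv R i V).
Proof. by move=> f; apply/asboolP; exact: ae_eq_refl. Qed.

Lemma L2eqv_sym : symmetric (@L2eqv R i V).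
Proof. by move=> f g; apply/asboolP/asboolP; exact: ae_eq_sym. Qed.

Lemma L2eqv_trans : transitive (@L2eqv R i V).
Proof.
by move=> f g h /asboolP gf /asboolP fh; apply/asboolP/(ae_eq_trans gf fh).
Qed.

End L2_lemmas.

Canonical L2eqv_equiv (R : realType) (i : interval R) (V : normedModType R) :=
  EquivRel (@L2eqv R i V) (@L2eqv_refl R i V) (@L2eqv_sym R i V)
    (@L2eqv_trans R i V).

Definition L2 (R : realType) (i : interval R) (V : normedModType R) : Type :=
  {eq_quot (@L2eqv R i V)}%qT.

(* Not found by the library's hints on [ae_filter_ringOfSetsType]. *)
#[global] Instance lebesgue_ae_filter (R : realType) :
  Filter (nbhs (almost_everywhere (@lebesgue_measure R))).
Proof. exact: (ae_filter_ringOfSetsType (@lebesgue_measure R)). Qed.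

Section L2_space.
Context {R : realType} (i : interval R) (V : normedModType R).
Notation mu := (@lebesgue_measure R).
Notation D := [set` i].
Local Open Scope quotient_scope.

HB.instance Definition _ := Choice.on (L2 i V).
HB.instance Definition _ := EqQuotient.on (L2 i V).

Definition L2repr (f : L2 i V) : R -> V := repr f.

Definition L2pi (f : L2fun i V) : L2 i V := \pi_(L2 i V) f.

Lemma L2pi_eq (f g : L2fun i V) :
  L2pi f = L2pi g <-> L2val f = L2val g %[ae mu in D].
Proof.
split=> [fg|fg]; first by apply/asboolP; move/eqP: fg; rewrite /L2pi eqmodE.
by apply/eqP; rewrite /L2pi eqmodE; apply/asboolP.
Qed.

Lemma L2reprK (f : L2fun i V) : L2repr (L2pi f) = L2val f %[ae mu in D].
Proof. by apply/L2pi_eq; rewrite /L2pi reprK. Qed.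

Lemma L2_eq (f g : L2 i V) :
  f = g <-> L2repr f = L2repr g %[ae mu in D].
Proof.
split=> [->|fg]; first exact: ae_eq_refl.
by rewrite -(reprK f) -(reprK g); apply/L2pi_eq.
Qed.

Definition L2fun0 : L2fun i V.
Proof.
exists (fun _ => 0); first exact: strongly_measurable0.
by rewrite L2norm_fun0 ltry.
Defined.

Definition L2funD (f g : L2fun i V) : L2fun i V.
Proof.
exists (fun x => f x + g x).
  exact: strongly_measurableD (L2fun_meas f) (L2fun_meas g).
apply: le_lt_trans (L2norm_funD (L2fun_meas f) (L2fun_meas g)) _.
by rewrite lte_add_pinfty//; exact: L2fun_fin.
Defined.

Definition L2funZ (a : R) (f : L2fun i V) : L2fun i V.
Proof.
exists (fun x => a *: f x).
  exact: strongly_measurableZ (L2fun_meas f).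
rewrite (L2norm_funZ _ (L2fun_meas f) (L2fun_fin f)).
by rewrite lte_mul_pinfty// ?lee_fin//; exact: L2fun_fin.
Defined.

Definition L2zero : L2 i V := L2pi L2fun0.
Definition L2add (f g : L2 i V) : L2 i V := L2pi (L2funD (repr f) (repr g)).
Definition L2scale (a : R) (f : L2 i V) : L2 i V := L2pi (L2funZ a (repr f)).
Definition L2opp (f : L2 i V) : L2 i V := L2scale (-1) f.

Lemma L2zeroE : L2repr L2zero = (fun _ => 0) %[ae mu in D].
Proof. exact: L2reprK. Qed.

Lemma L2addE (f g : L2 i V) :
  L2repr (L2add f g) = (fun x => L2repr f x + L2repr g x) %[ae mu in D].
Proof. exact: L2reprK. Qed.

Lemma L2scaleE a (f : L2 i V) :
  L2repr (L2scale a f) = (fun x => a *: L2repr f x) %[ae mu in D].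
Proof. exact: L2reprK. Qed.

Fact L2addA : associative L2add.
Proof.
move=> f g h; apply/L2_eq; near=> x => Dx.
rewrite (near (L2addE f (L2add g h)) x)// (near (L2addE g h) x)//.
by rewrite (near (L2addE (L2add f g) h) x)// (near (L2addE f g) x)// addrA.
Unshelve. all: by end_near. Qed.

Fact L2addC : commutative L2add.
Proof.
move=> f g; apply/L2_eq; near=> x => Dx.
by rewrite (near (L2addE f g) x)// (near (L2addE g f) x)// addrC.
Unshelve. all: by end_near. Qed.

Fact L2add0 : left_id L2zero L2add.
Proof.
move=> f; apply/L2_eq; near=> x => Dx.
by rewrite (near (L2addE L2zero f) x)// (near L2zeroE x)// add0r.
Unshelve. all: by end_near. Qed.

Fact L2addN : left_inverse L2zero L2opp L2add.
Proof.
move=> f; apply/L2_eq; near=> x => Dx.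
rewrite (near (L2addE (L2opp f) f) x)// (near L2zeroE x)//.
by rewrite (near (L2scaleE (-1) f) x)// scaleN1r addNr.
Unshelve. all: by end_near. Qed.

HB.instance Definition _ :=
  GRing.isZmodule.Build (L2 i V) L2addA L2addC L2add0 L2addN.

Fact L2scaleA a b (f : L2 i V) : L2scale a (L2scale b f) = L2scale (a * b) f.
Proof.
apply/L2_eq; near=> x => Dx.
rewrite (near (L2scaleE a (L2scale b f)) x)// (near (L2scaleE b f) x)//.
by rewrite (near (L2scaleE (a * b) f) x)// scalerA.
Unshelve. all: by end_near. Qed.

Fact L2scale1 : left_id 1 L2scale.
Proof.
move=> f; apply/L2_eq; near=> x => Dx.
by rewrite (near (L2scaleE 1 f) x)// scale1r.
Unshelve. all: by end_near. Qed.

Fact L2scaleDr : right_distributive L2scale +%R.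
Proof.
move=> a f g; apply/L2_eq; near=> x => Dx.
rewrite (near (L2scaleE a (f + g)) x)// (near (L2addE f g) x)//.
rewrite (near (L2addE (L2scale a f) (L2scale a g)) x)//.
by rewrite (near (L2scaleE a f) x)// (near (L2scaleE a g) x)// scalerDr.
Unshelve. all: by end_near. Qed.

Fact L2scaleDl (f : L2 i V) : {morph L2scale^~ f : a b / a + b}.
Proof.
move=> a b; apply/L2_eq; near=> x => Dx.
rewrite (near (L2scaleE (a + b) f) x)//.
rewrite (near (L2addE (L2scale a f) (L2scale b f)) x)//.
by rewrite (near (L2scaleE a f) x)// (near (L2scaleE b f) x)// scalerDl.
Unshelve. all: by end_near. Qed.

HB.instance Definition _ := GRing.Zmodule_isLmodule.Build R (L2 i V)
  L2scaleA L2scale1 L2scaleDr L2scaleDl.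

Definition L2norm (f : L2 i V) : R := fine (L2norm_fun i (L2repr f)).

Let L2norm_fin (f : L2 i V) : L2norm_fun i (L2repr f) \is a fin_num.
Proof. by rewrite ge0_fin_numE ?L2fun_fin// Lnorm_ge0. Qed.

Let mrepr (f : L2 i V) :
  strongly_measurable (D : set (measurableTypeR R)) (L2repr f).
Proof. exact: L2fun_meas. Qed.

Fact L2norm_triangle (f g : L2 i V) : L2norm (f + g) <= L2norm f + L2norm g.
Proof.
rewrite /L2norm -fineD ?L2norm_fin//.
have fin : (L2norm_fun i (L2repr f) + L2norm_fun i (L2repr g))%E \is a fin_num.
  by rewrite fin_numD !L2norm_fin.
apply: fine_le => //.
rewrite (L2norm_fun_ae _ _ (L2addE f g))//; last first.
  exact: strongly_measurableD.
exact: L2norm_funD.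
Qed.

Fact L2normZ (a : R) (f : L2 i V) : L2norm (a *: f) = `|a| * L2norm f.
Proof.
rewrite /L2norm (L2norm_fun_ae _ _ (L2scaleE a f))//; last first.
  exact: strongly_measurableZ.
by rewrite L2norm_funZ ?L2fun_fin// fineM ?L2norm_fin.
Qed.

Fact L2norm0_eq0 (f : L2 i V) : L2norm f = 0 -> f = 0.
Proof.
move=> f0; have /(L2norm_fun_eq0 (mrepr f)) H : L2norm_fun i (L2repr f) = 0%E.
  by rewrite -(fineK (L2norm_fin f)) -/(L2norm f) f0.
by apply/L2_eq; apply: ae_eq_trans H _; apply: ae_eq_sym; exact: L2zeroE.
Qed.

HB.instance Definition _ := Lmodule_isNormed.Build R (L2 i V)
  L2norm_triangle L2normZ L2norm0_eq0.

End L2_space.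

Notation delay_space r K := (K * L2 `]- r, 0[ K)%type.

Section delay.
Context {R : realType}.
Notation mu := (@lebesgue_measure R).

Definition test_function (a b : R) (eta : R -> R) :=
  (forall n x, derivable (derive1n n eta) x 1) /\
  exists c d : R, [/\ a < c, d < b & forall x, x \notin `[c, d] -> eta x = 0].

(* [v] is the distributional derivative of [h], i.e., h \in H^1 and h' = v. *)
Definition weak_derivative (V : normedModType R) (a b : R)
    (h v : L2 `]a, b[ V) :=
  forall eta, test_function a b eta ->
    bochner mu `]a, b[ (fun s => derive1 eta s *: L2repr h s) =
    - bochner mu `]a, b[ (fun s => eta s *: L2repr v s).

Definition continuous_version (V : normedModType R) (a b : R)
    (h : L2 `]a, b[ V) (hc : R -> V) :=
  {within `[a, b], continuous hc} /\
  {ae mu, forall s, s \in `]a, b[ -> L2repr h s = hc s}.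

Context {K : hilbertType R}.

Definition point_delay (N : K -> K) (tau : R) (h : R -> K) : K := N (h (- tau)).

Definition distributed_delay (N : K -> K) (r : R) (g : R -> R) (h : R -> K) :
  K := bochner mu `]- r, 0[ (fun s => g s *: N (h s)).

(* The graph of (x, h) |-> (A x + Phi h, h') with domain
   {(x, h) \in D(A) x H^1 : h(0) = x}; point values of [h \in H^1], both in
   h(0) = x and in Phi h, are those of its continuous version [hc]. *)
Definition delay_operator (A : set (K * K)) (r : R) (Phi : (R -> K) -> K) :
    set (delay_space r K * delay_space r K) :=
  [set p | exists Ax hc,
    [/\ A (p.1.1, Ax), weak_derivative p.1.2 p.2.2,
        continuous_version p.1.2 hc, hc 0 = p.1.1 & p.2.1 = Ax + Phi hc]].

Definition mild_solution (r : R)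
    (TT : R -> {linear delay_space r K -> delay_space r K})
    (phi0 : K) (f : L2 `]- r, 0[ K) (b : R -> K) (t : R) : K :=
  (TT t (phi0, f) + bochner mu `]0, t[ (fun s => TT (t - s) (b s, 0))).1.

Definition L2_control n (u : R -> 'rV[R]_n) :=
  (forall i, measurable_fun (`]0, +oo[ : set (measurableTypeR R))
     (fun s => u s 0 i)) /\
  (\int[mu]_(s in `]0%R, +oo[) (\sum_(i < n) (u s 0 i) ^+ 2)%:E < +oo)%E.

End delay.

Section product_sigma_finite.
Local Open Scope ereal_scope.
Context d1 d2 (T1 : measurableType d1) (T2 : measurableType d2) (R : realType).
Variable m1 : {sigma_finite_measure set T1 -> \bar R}.
Variable m2 : {sigma_finite_measure set T2 -> \bar R}.

Lemma product_measure_sigma_finite : sigma_finite setT (m1 \x m2).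
Proof.
have /sigma_finiteP[F [TF ndF Foo]] := sigma_finiteT m1.
have /sigma_finiteP[G [TG ndG Goo]] := sigma_finiteT m2.
exists (fun n => F n `*` G n).
  rewrite -setXTT TF TG predeqE => -[x y]; split.
    move=> [/= [n _ Fnx] [k _ Gky]]; exists (maxn n k) => //; split.
    - by move: x Fnx; exact/subsetPset/ndF/leq_maxl.
    - by move: y Gky; exact/subsetPset/ndG/leq_maxr.
  by move=> [n _ []/= ? ?]; split; exists n.
move=> k; have [? ?] := Foo k; have [? ?] := Goo k.
split; first exact: measurableX.
by rewrite product_measure1E// lte_mul_pinfty// ge0_fin_numE.
Qed.

(* The library has no canonical sigma-finite structure on this product: its
   instance for subprobabilities takes precedence. *)
Definition product_sfmeasure :
    {sigma_finite_measure set (T1 * T2)%type -> \bar R} :=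
  HB.pack_for {sigma_finite_measure set (T1 * T2)%type -> \bar R}
    (m1 \x m2)
    (Measure_isSigmaFinite.Build _ _ _ (m1 \x m2) product_measure_sigma_finite).
End product_sigma_finite.

Record measure_space (R : realType) := MeasureSpace {
  msp_display : measure_display ;
  msp_type :> measurableType msp_display ;
  msp_measure : {sigma_finite_measure set msp_type -> \bar R}
}.

(* R^(n+1) = R x (R x ...) with its Lebesgue measure. *)
Fixpoint lebesgue_space (R : realType) n : measure_space R :=
  if n is m.+1 then
    @MeasureSpace R _ (measurableTypeR R * lebesgue_space R m)%type
      (product_sfmeasure (@lebesgue_measure R) (msp_measure (lebesgue_space R m)))
  else @MeasureSpace R _ (measurableTypeR R) (@lebesgue_measure R).

(* ]0, +oo[^(n+1) *)
Fixpoint orthant (R : realType) n : set (lebesgue_space R n) :=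
  if n is m.+1 return set (lebesgue_space R n) then `]0, +oo[ `*` @orthant R m
  else `]0, +oo[.

Section gramian.
Context {R : realType} {K : hilbertType R}.
Variables (T : R -> K -> K) (N : K -> K).

(* P_n(t_1, ..., t_(n+1)), where s is the nested tuple (t_1, (t_2, ...)). *)
Fixpoint Pop n : lebesgue_space R n -> K -> K :=
  if n is m.+1 return lebesgue_space R n -> K -> K
  then fun s x => adj (T s.1) (adj N (Pop s.2 x))
  else fun s x => adj (T s) x.

Variables (n k : nat) (psi : 'I_n -> K) (phi : 'I_k -> K).

Let BBt (y : K) := inp psi (inp_adj psi y).
Let BinBint (y : K) := inp phi (inp_adj phi y).

(* <x, P_i y> *)
Definition gramian_form (i : nat) (x y : K) : \bar R :=
  let integral_part j (C : K -> K) :=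
    (\int[msp_measure (lebesgue_space R j)]_(s in @orthant R j)
       (inner (Pop s x) (C (Pop s y)))%:E)%E in
  (integral_part i BBt +
   if i is j.+1 then integral_part j BinBint
   else (inner x (BinBint y))%:E)%E.

(* P = \sum_i P_i. The series converges in trace norm; its sum is already
   determined by strong convergence. *)
Definition bilinear_gramian (P : K -> K) :=
  exists P_ : nat -> K -> K,
    (forall i x y, (inner x (P_ i y))%:E = gramian_form i x y) /\
    (forall x, \sum_(i < m) P_ i x @[m --> \oo] --> P x).

End gramian.

(* Main.v *)
From HB Require Import structures.
Require Import Defs.
From mathcomp Require Import all_boot all_order all_algebra.
From mathcomp Require Import all_classical all_reals all_analysis.
From mathcomp Require Import measurable_realfun lra ring.

(* Let [W] be the closure of the range of the Gramian. A vector [x] is orthogonal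
   to [W] iff [inner x (P x) = 0], iff all the nonnegative integrands defining
   the Gramian form at [(x, x)] vanish; right continuity of the orbits turns
   almost everywhere into everywhere, so [W] is the closed span of the vectors
   T(t_1) N T(t_2) ... N T(t_k) v with v among the psi_i and phi_j. Hence [W] is
   invariant under T and N and contains the range of B.

   The delay semigroup is reached through its generator. For small h > 0 the
   equation z - h A z = w is solved approximately inside [W] when w is a pair
   (y, sum c_i v_i) with y, v_i in [W] and c_i continuous: the second component
   is exp(s/h) x + sum d_i v_i, where d_i - h d_i' = c_i and d_i(0) = 0, and x
   comes from the resolvent of T perturbed by a bounded multiple of N. Such pairs
   are dense among those with values in [W], and a C_0-semigroup leaves the
   closure of a set invariant as soon as its resolvents almost do: in an
   equivalent norm for which exp(-om t) S(t) is contractive the generator is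
   dissipative, so the distance to the set, times exp(-om t), is nonincreasing
   along orbits starting in the domain. *)

Set Implicit Arguments.
Unset Strict Implicit.
Unset Printing Implicit Defensive.

Import Order.TTheory GRing.Theory Num.Theory.
Import numFieldNormedType.Exports.

Local Open Scope classical_set_scope.
Local Open Scope ring_scope.

(** * Hilbert spaces *)

(** The delay semigroup is given only by the graph of its generator and the semigroup laws, so even
    its growth bound has to be derived; this is why completeness of L2 and uniform boundedness
    appear. The Gramian is likewise known only through the forms of its terms: linearity of [P], and
    with it the fact that W is a subspace, comes from the finiteness of the diagonal forms. Vector
    integrals are handled weakly: identities are tested with [inner z], which makes them scalar, and
    membership in W is tested with the vectors orthogonal to W. The range condition is asked only up
    to an error e, so truncated Laplace integrals and finite sums suffice and no improper vector
    integral is formed. On such sums the delay term is explicit: at exp(s/h) x it equals kappa N x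
    with |kappa| <= 1, because exp(s/h) <= 1 for s <= 0 and the integral of |g| is at most 1. This
    bound is uniform in h, so the perturbation enters the resolvent equation with a factor h, whence
    the threshold 1/(4 C M), where C bounds N and M bounds T. *)

Section hilbert.
Context {R : realType} {K : hilbertType R}.
Implicit Types (x y z : K) (a : R).

Lemma innerDl x y z : inner (x + y) z = inner x z + inner y z.
Proof. by rewrite -{1}(scale1r x) inner_linear mul1r. Qed.

Lemma inner0l x : inner 0 x = 0.
Proof. by have := innerDl 0 0 x; rewrite addr0; lra. Qed.

Lemma innerZl a x y : inner (a *: x) y = a * inner x y.
Proof. by rewrite -(addr0 (a *: x)) inner_linear inner0l addr0. Qed.

Lemma innerNl x y : inner (- x) y = - inner x y.
Proof. by rewrite -scaleN1r innerZl mulN1r. Qed.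

Lemma innerBl x y z : inner (x - y) z = inner x z - inner y z.
Proof. by rewrite innerDl innerNl. Qed.

Lemma innerDr x y z : inner x (y + z) = inner x y + inner x z.
Proof. by rewrite innerC innerDl !(innerC x). Qed.

Lemma inner0r x : inner x 0 = 0.
Proof. by rewrite innerC inner0l. Qed.

Lemma innerZr a x y : inner x (a *: y) = a * inner x y.
Proof. by rewrite innerC innerZl innerC. Qed.

Lemma innerBr x y z : inner x (y - z) = inner x y - inner x z.
Proof. by rewrite innerC innerBl !(innerC x). Qed.

Lemma inner_sumr I (s : seq I) (F : I -> K) x :
  inner x (\sum_(i <- s) F i) = \sum_(i <- s) inner x (F i).
Proof.
elim: s => [|i s IH]; first by rewrite !big_nil inner0r.
by rewrite !big_cons innerDr IH.
Qed.

Lemma inner_le x y : `|inner x y| <= `|x| * `|y|.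
Proof.
have [->|x0] := eqVneq x 0; first by rewrite inner0l !normr0 mul0r.
have nx : 0 < `|x| ^+ 2 by rewrite exprn_gt0// normr_gt0.
pose b := inner x y / `|x| ^+ 2.
have : 0 <= inner (y - b *: x) (y - b *: x) by rewrite inner_norm sqr_ge0.
rewrite innerBl !innerBr !innerZl !innerZr !inner_norm (innerC y x) => h.
have bE : b * `|x| ^+ 2 = inner x y by rewrite /b divfK// gt_eqF.
have {}h : b * inner x y <= `|y| ^+ 2.
  have : b * (b * `|x| ^+ 2) = b * inner x y by rewrite bE.
  lra.
rewrite -(@ler_pXn2r _ 2)// ?nnegrE ?mulr_ge0// real_normK ?num_real// exprMn.
have := ler_wpM2l (ltW nx) h.
by rewrite mulrA (mulrC _ b) bE -expr2.
Qed.

(** Testing with [y := x] suffices. This is how estimates of scalar integrals become norm estimates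
    of vector integrals. *)
Lemma inner_norm_le x c : 0 <= c -> (forall y, inner x y <= c * `|y|) -> `|x| <= c.
Proof.
move=> c0 /(_ x); rewrite inner_norm expr2.
have [->|x0] := eqVneq x 0; first by rewrite normr0.
by rewrite ler_pM2r// normr_gt0.
Qed.

Lemma inner_inj x y : (forall z, inner x z = inner y z) -> x = y.
Proof.
move=> h; apply/eqP; rewrite -subr_eq0 -normr_eq0 -sqrf_eq0 -inner_norm.
by rewrite innerBl h subrr.
Qed.

Lemma innerNr x y : inner x (- y) = - inner x y.
Proof. by rewrite innerC innerNl innerC. Qed.

Lemma parallelogram x y :
  `|x + y| ^+ 2 + `|x - y| ^+ 2 = 2 * (`|x| ^+ 2 + `|y| ^+ 2).
Proof.
rewrite -!inner_norm !(innerDl, innerNl, innerDr, innerNr) (innerC y x); lra.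
Qed.

Lemma cvg_innerr {T : Type} {F : set_system T} {FF : Filter F} x (f : T -> K) l :
  f t @[t --> F] --> l -> inner x (f t) @[t --> F] --> inner x l.
Proof.
move=> fl; apply/cvgrPdist_le => e e0.
have e1 : 0 < e / (`|x| + 1) by rewrite divr_gt0// ltr_wpDl.
move/cvgrPdist_le : fl => /(_ _ e1); apply: filterS => t le.
rewrite -innerBr (le_trans (inner_le _ _))//.
rewrite ler_pdivlMr ?ltr_wpDl// mulrDr mulr1 in le.
have := normr_ge0 (l - f t); nra.
Qed.

Lemma hilbert_cauchy_cvg (f : nat -> K) :
  (forall e : R, 0 < e -> \forall n \near \oo, forall m, (n <= m)%N -> `|f n - f m| <= e) ->
  exists l : K, f n @[n --> \oo] --> l.
Proof.
move=> h; suff : cvgn f by move=> /cvg_ex.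
apply: cauchy_cvg; apply/cauchy_exP => e e0.
have [N _ hN] := h (e / 2) ltac:(by rewrite divr_gt0).
exists (f N); exists N => // m /= Nm; rewrite -ball_normE /ball_/=.
by apply: le_lt_trans (hN N (leqnn N) m Nm) _; lra.
Qed.

(** * Orthogonal projection onto a closed subspace *)

Section projection.
Variable W : set K.
Hypotheses (W0 : W 0) (WD : forall x y, W x -> W y -> W (x + y))
  (WZ : forall a x, W x -> W (a *: x)) (clW : closed W).

Lemma subspaceB x y : W x -> W y -> W (x - y).
Proof. by move=> Wx Wy; apply: WD => //; rewrite -scaleN1r; apply: WZ. Qed.

(** A sequence minimizing the squared distance to [W] is Cauchy by the parallelogram law, and the
    first variation at its limit is orthogonality. *)
Lemma exists_projection x :
  exists p, W p /\ forall w, W w -> inner (x - p) w = 0.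
Proof.
pose S := [set `|x - w| ^+ 2 | w in W].
have S0 : S !=set0 by exists (`|x - 0| ^+ 2); exists 0.
have Sb : has_inf S by split=> //; exists 0 => _ [w _ <-]; rewrite sqr_ge0.
pose m := inf S.
have mle w : W w -> m <= `|x - w| ^+ 2.
  by move=> Ww; apply: ge_inf; [case: Sb | exists w].
have H n : exists w, W w /\ `|x - w| ^+ 2 < m + n.+1%:R^-1.
  have [_ [w Ww <-] h] := inf_adherent (ltac:(by rewrite invr_gt0) : 0 < n.+1%:R^-1 :> R) Sb.
  by exists w.
pose f n := projT1 (cid (H n)).
have Wf n : W (f n) by have [] := projT2 (cid (H n)).
have fle n : `|x - f n| ^+ 2 < m + n.+1%:R^-1 by have [] := projT2 (cid (H n)).
(* The midpoint lies in [W], so the parallelogram law bounds the left side by 2(m + 1/(n+1)) + 2(m +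
   1/(k+1)) - 4m, and 1/(k+1) <= 1/(n+1). *)
have cau n k : (n <= k)%N -> `|f n - f k| ^+ 2 <= 4 * n.+1%:R^-1.
  move=> nk.
  have := parallelogram (x - f n) (x - f k).
  have -> : x - f n - (x - f k) = - (f n - f k) by rewrite !opprB addrC addrA subrK.
  have -> : x - f n + (x - f k) = 2 *: (x - 2^-1 *: (f n + f k)).
    rewrite scalerBr scalerA divff ?pnatr_eq0// scale1r scaler_nat mulr2n opprD.
    by rewrite addrACA.
  rewrite normrN normrZ exprMn ger0_norm//.
  have hm : W (2^-1 *: (f n + f k)) by apply: WZ; apply: WD.
  have := mle _ hm; have := fle n; have := fle k.
  have : k.+1%:R^-1 <= n.+1%:R^-1 :> R by rewrite lef_pV2 ?posrE// ler_nat.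
  move: (`|x - f n| ^+ 2) (`|x - f k| ^+ 2) (`|f n - f k| ^+ 2) (`|_ - _ *: _| ^+ 2).
  move: (k.+1%:R^-1 : R) (n.+1%:R^-1 : R) => e1 e2 a b c d h1 h2 h3 h4.
  by rewrite expr2 => h5; lra.
have [p fp] : exists l : K, f n @[n --> \oo] --> l.
  apply: hilbert_cauchy_cvg => e e0.
  have e2 : 0 < e ^+ 2 / 4 by rewrite divr_gt0// exprn_gt0.
  have := near_infty_natSinv_lt (PosNum e2); apply: filterS => n /= nle k nk.
  rewrite -(@ler_pXn2r _ 2) ?nnegrE//; last exact: ltW.
  move: (cau _ _ nk) nle; move: (n.+1%:R^-1 : R) => z h1 h2; lra.
have Wp : W p.
  by apply: (closed_cvg _ clW _ _ fp); apply: nearW => n; exact: Wf.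
have pm : `|x - p| ^+ 2 <= m.
  have h1 : `|x - f n| ^+ 2 @[n --> \oo] --> `|x - p| ^+ 2.
    by under eq_fun do rewrite expr2; rewrite expr2; apply: cvgM;
      apply: cvg_norm; apply: cvgB => //; exact: cvg_cst.
  have h2 : m + n.+1%:R^-1 @[n --> \oo] --> m + 0.
    by apply: cvgD; [exact: cvg_cst | exact: cvg_harmonic].
  rewrite addr0 in h2.
  apply: (ler_cvg_to h1 h2); apply: nearW => n; exact: ltW.
exists p; split => // w Ww.
have key (a : R) : 0 <= a ^+ 2 * `|w| ^+ 2 - 2 * a * inner (x - p) w.
  have := mle _ (WD Wp (WZ a Ww)).
  rewrite opprD addrA; move: (x - p) pm => e pm.
  rewrite -(inner_norm (e - _)) innerBl !innerBr.
  by rewrite !innerZl !innerZr !inner_norm (innerC w) => h; lra.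
set c := inner _ _ in key *.
have [w0|w0] := eqVneq w 0; first by rewrite /c w0 inner0r.
have nw : 0 < `|w| ^+ 2 by rewrite exprn_gt0// normr_gt0.
(* The minimizer of the quadratic in [key]; the minimum -c^2/|w|^2 must be nonnegative, which forces
   [c] to vanish. *)
have := key (c / `|w| ^+ 2).
have -> : (c / `|w| ^+ 2) ^+ 2 * `|w| ^+ 2 - 2 * (c / `|w| ^+ 2) * c = - (c ^+ 2 / `|w| ^+ 2).
  by field; rewrite gt_eqF// normr_gt0.
rewrite oppr_ge0 pmulr_lle0 ?invr_gt0// => h.
by apply/eqP; rewrite -sqrf_eq0 eq_le h sqr_ge0.
Qed.

(** The component of [x] orthogonal to [W] is itself an admissible [z]; it is then orthogonal to [x]
    and to the projection, hence to itself. *)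
Lemma closed_subspace_bipolar x :
  (forall z, (forall w, W w -> inner z w = 0) -> inner z x = 0) -> W x.
Proof.
move=> h; have [p [Wp px]] := exists_projection x.
have := h _ px; suff : inner (x - p) p = 0.
  move=> h0 h1; have : inner (x - p) (x - p) = 0 by rewrite innerBr h0 h1 subrr.
  by rewrite inner_norm => /eqP; rewrite sqrf_eq0 normr_eq0 subr_eq0 => /eqP ->.
exact: px.
Qed.

Definition orthproj x : K := projT1 (cid (exists_projection x)).

Lemma orthprojP x : W (orthproj x) /\ forall w, W w -> inner (x - orthproj x) w = 0.
Proof. exact: projT2 (cid (exists_projection x)). Qed.

Lemma orthproj_uniq x p : W p -> (forall w, W w -> inner (x - p) w = 0) -> orthproj x = p.
Proof.
move=> Wp hp; have [Wq hq] := orthprojP x.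
apply/eqP; rewrite -subr_eq0 -normr_eq0 -sqrf_eq0 -inner_norm.
have Wpq := subspaceB Wq Wp.
have := hp _ Wpq; have := hq _ Wpq; rewrite !innerBl; lra.
Qed.

Lemma orthproj_linear a x y : orthproj (a *: x + y) = a *: orthproj x + orthproj y.
Proof.
have [Wx hx] := orthprojP x; have [Wy hy] := orthprojP y.
apply: orthproj_uniq; first by apply: WD => //; apply: WZ.
move=> w Ww; have := hx _ Ww; have := hy _ Ww.
rewrite !(innerBl, innerDl, innerZl) => /eqP; rewrite subr_eq0 => /eqP ->.
by move=> /eqP; rewrite subr_eq0 => /eqP ->; lra.
Qed.

Lemma orthproj_id x : W x -> orthproj x = x.
Proof. by move=> Wx; apply: orthproj_uniq => // w _; rewrite subrr inner0l. Qed.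

Lemma orthproj_le x : `|orthproj x| <= `|x|.
Proof.
have [Wx hx] := orthprojP x; have := hx _ Wx; rewrite innerBl inner_norm => h.
have := inner_le x (orthproj x); rewrite ler_norml => /andP[_].
have [->|p0] := eqVneq (orthproj x) 0; first by rewrite normr0.
have : 0 < `|orthproj x| by rewrite normr_gt0.
move: h; rewrite expr2 => h p1 h2; rewrite -(ler_pM2r p1); lra.
Qed.

End projection.

Lemma riesz (f : {linear K -> R^o}) : continuous f ->
  exists v, forall x, f x = inner x v.
Proof.
move=> cf; pose W := [set x | f x = 0].
have [allW|] := pselect (forall x, W x).
  by exists 0 => x; rewrite inner0r; exact: allW.
move=> /existsNP[x0 fx0].
have W0 : W 0 by rewrite /W/= linear0.
have WD x y : W x -> W y -> W (x + y) by rewrite /W/= linearD => -> ->; rewrite addr0.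
have WZ a x : W x -> W (a *: x) by rewrite /W/= linearZ/= => ->; rewrite /GRing.scale/= mulr0.
have clW : closed W.
  rewrite (_ : W = f @^-1` [set 0]); last by [].
  by apply: closed_comp => [x _|]; [exact: cf | exact: closed_eq].
have [p [Wp hp]] := exists_projection W0 WD WZ clW x0.
pose e := x0 - p.
have fe : f e = f x0 by rewrite /e linearB Wp subr0.
have e0 : e != 0.
  by apply/eqP => e0; apply: fx0; rewrite /W/= -fe e0 linear0.
have ne : `|e| ^+ 2 != 0 by rewrite sqrf_eq0 normr_eq0.
exists ((f e / `|e| ^+ 2) *: e) => x.
(* This combination is in the kernel, hence orthogonal to [e]; solving for [f x] gives the
   representing vector. *)
have : W (f e *: x - f x *: e).
  have fE : f (f e *: x - f x *: e) = f e * f x - f x * f e by rewrite linearB !linearZ.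
  by rewrite /W/= fE mulrC subrr.
move=> /hp; rewrite -/e innerBr !innerZr inner_norm => /eqP.
rewrite subr_eq0 => /eqP h.
by rewrite (innerC x) -/e mulrAC h mulfK.
Qed.

End hilbert.

Section bounded_linear.
Context {R : realType}.

Lemma linear_bounded (U V : normedModType R) (f : {linear U -> V}) :
  continuous f -> exists2 C, 0 < C & forall x, `|f x| <= C * `|x|.
Proof.
move=> /linear_bounded_continuous/linear_boundedP.
by move=> /pinfty_ex_gt0 [C C0 h]; exists C.
Qed.

Lemma bounded_continuous (U V : normedModType R) (f : {linear U -> V}) C :
  (forall x, `|f x| <= C * `|x|) -> continuous f.
Proof.
move=> h; apply/linear_bounded_continuous/linear_boundedP.
near=> r => x; apply: le_trans (h x) _; by rewrite ler_wpM2r.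
Unshelve. all: by end_near. Qed.

End bounded_linear.

Section adjoint.
Context {R : realType} {K : hilbertType R}.

Lemma riesz_bounded (f : K -> R) C :
  (forall a x y, f (a *: x + y) = a * f x + f y) ->
  (forall x, `|f x| <= C * `|x|) -> exists v, forall x, f x = inner x v.
Proof.
move=> lf bf.
pose F : {linear K -> R^o} :=
  HB.pack (f : K -> R^o) (GRing.isLinear.Build _ _ _ _ (f : K -> R^o) lf).
exact: (@riesz _ _ F (@bounded_continuous _ _ _ F C bf)).
Qed.

Lemma adjP (f : {linear K -> K}) : continuous f ->
  forall x y, inner (f x) y = inner x (adj f y).
Proof.
move=> cf; suff : [set g : K -> K | forall x y, inner (f x) y = inner x (g y)] (adj f).
  by [].
rewrite /adj; apply: getPex.
have [C C0 hC] := linear_bounded cf.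
have H y : exists v, forall x, inner (f x) y = inner x v.
  apply: (@riesz_bounded _ (C * `|y|)).
    by move=> a x z; rewrite linearP innerDl innerZl.
  move=> x; rewrite (le_trans (inner_le _ _))// mulrAC ler_wpM2r//.
by exists (fun y => projT1 (cid (H y))) => x y; exact: projT2 (cid (H y)) x.
Qed.

End adjoint.

(** * Bochner integrals *)

Section strong_measurability.
Context {R : realType} {d : measure_display} {T : measurableType d}.
Context {V : normedModType R}.
Implicit Types (D : set T) (f : T -> V).

(** Only right continuity is assumed, so each cell of the grid carries the value of [F] at its right
    endpoint, which lies strictly to the right of [c x]. *)
Lemma strongly_measurable_comp D (c : T -> R) (F : R -> V) :
  measurable D -> measurable_fun D c ->
  (forall x, D x -> F y @[y --> (c x)^'+] --> F (c x)) ->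
  strongly_measurable D (fun x => F (c x)).
Proof.
move=> mD mc cF.
(* Mesh 1/(k+1) starting at -(k+1): the 2(k+1)^2 cells cover [-(k+1), k+1[, so every value of [c] is
   eventually caught. *)
pose a k i : R := i%:R / k.+1%:R - k.+1%:R.
pose A k i := D `&` c @^-1` `[a k i, a k i.+1[.
exists (fun k => [seq (A k i, F (a k i.+1)) | i <- iota 0 (2 * k.+1 * k.+1)]).
split=> [k p /mapP[i _ ->]/=|x Dx]; first exact: mc.
have ev k : `|c x| < k.+1%:R -> exists2 y, simple_eval [seq (A k i, F (a k i.+1)) |
    i <- iota 0 (2 * k.+1 * k.+1)] x = F y & c x < y <= c x + k.+1%:R^-1.
  move=> ck; have k0 : 0 < k.+1%:R :> R by [].
  move: (ck); rewrite ltr_norml => /andP[ck1 ck2].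
  pose z := (c x + k.+1%:R) * k.+1%:R.
  have z0 : 0 <= z by rewrite mulr_ge0//; lra.
  pose i0 := Num.truncn z.
  have /andP[i0z zi0] := truncn_itv z0; rewrite -/i0 in i0z zi0.
  have h1 : a k i0 <= c x.
    by rewrite /a lerBlDr ler_pdivrMr.
  have h2 : c x < a k i0.+1.
    by rewrite /a ltrBrDr ltr_pdivlMr.
  have h3 : a k i0.+1 <= c x + k.+1%:R^-1.
    have -> : a k i0.+1 = a k i0 + k.+1%:R^-1.
      by rewrite /a -natr1 mulrDl mul1r addrAC.
    by rewrite lerD2r.
  have i0l : (i0 < 2 * k.+1 * k.+1)%N.
    rewrite -(@ltr_nat R); apply: (le_lt_trans i0z).
    by rewrite /z !natrM ltr_pM2r//; lra.
  exists (a k i0.+1); last by rewrite h2.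
  rewrite /simple_eval big_map (bigD1_seq i0) ?mem_iota ?iota_uniq//.
  rewrite indicE mem_set ?scale1r; last by split => //=; rewrite in_itv/= h1 h2.
  rewrite big1 => [|i ii0]; first by rewrite [LHS]addr0.
  rewrite indicE memNset ?scale0r//.
  move=> [_ /=]; rewrite in_itv/= => /andP[b1 b2]; move/eqP: ii0; apply.
  apply/eqP; rewrite eqn_leq; apply/andP; split.
    rewrite -ltnS -(@ltr_nat R); have := le_lt_trans b1 h2.
    by rewrite /a ltrD2r ltr_pM2r ?invr_gt0.
  rewrite -ltnS -(@ltr_nat R); have := le_lt_trans h1 b2.
  by rewrite /a ltrD2r ltr_pM2r ?invr_gt0.
apply/cvgrPdist_lt => e e0.
have /cvgrPdist_lt/(_ e e0)[r /= r0 hr] := cF x Dx.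
near=> k.
have [|y -> /andP[y1 y2]] := ev k.
  have h1 : `|c x| < k%:R by near: k; exact: nbhs_infty_gtr.
  by apply: lt_le_trans h1 _; rewrite ler_nat.
apply: hr => //; rewrite /ball_/= ltr_norml; apply/andP; split; last by lra.
have : k.+1%:R^-1 < r by near: k; exact: (near_infty_natSinv_lt (PosNum r0)).
by move: (k.+1%:R^-1 : R) y2 => w y2 ?; lra.
Unshelve. all: by end_near. Qed.

Lemma strongly_measurable_cst D (v : V) : strongly_measurable D (fun _ => v).
Proof.
exists (fun _ => [:: (setT, v)]); split=> [k p|x _].
  by rewrite inE => /eqP ->; exact: measurableT.
under eq_fun do rewrite /simple_eval big_seq1/= indicT scale1r; exact: cvg_cst.
Qed.

Lemma simple_evalM (s : seq (set T * R^o)) (t : seq (set T * V)) x :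
  simple_eval [seq (p.1 `&` q.1, p.2 *: q.2) | p <- s, q <- t] x =
  (simple_eval s x : R) *: simple_eval t x.
Proof.
rewrite /simple_eval big_allpairs_dep/= scaler_suml; apply: eq_bigr => p _.
rewrite scaler_sumr; apply: eq_bigr => q _.
rewrite indicI/= !scalerA; congr (_ *: _).
by rewrite /GRing.scale/=; ring.
Qed.

End strong_measurability.

Section bochner_integral.
Context {R : realType} {d : measure_display} {T : measurableType d}.
Context {V : normedModType R}.
Implicit Types (D : set T) (f : T -> V).

Lemma strongly_measurable_scale D (c : T -> R) f : measurable D ->
  measurable_fun D c -> strongly_measurable D f ->
  strongly_measurable D (fun x => c x *: f x).
Proof.
move=> mD mc [t [mt tf]].
have [|s [ms sc]] := @strongly_measurable_comp R d T R^o D c id mD mc.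
  by move=> x _; exact: cvg_at_right_filter.
exists (fun k => [seq (p.1 `&` q.1, p.2 *: q.2) | p <- s k, q <- t k]); split.
  move=> k p /allpairsP[[p1 q1] /= [/ms mp /mt mq ->]] /=.
  exact: measurableI.
move=> x Dx; under eq_fun do rewrite simple_evalM.
by apply: cvgZ; [exact: sc | exact: tf].
Qed.

Lemma measurable_simple_eval D (s : seq (set T * V)) (g : V -> R) :
  (forall p, p \in s -> measurable p.1) ->
  measurable_fun D (fun x => g (simple_eval s x)).
Proof.
move=> ms mD Y mY; apply: measurableI => //.
exact: (@simple_eval_preimage _ _ _ _ s (g @^-1` Y)).
Qed.

Lemma strongly_measurable_measurable D f (g : V -> R) : continuous g ->
  strongly_measurable D f -> measurable_fun D (g \o f).
Proof.
move=> cg [s [ms sf]]; apply: (@measurable_fun_cvg _ _ _ _ (fun k x => g (simple_eval (s k) x))).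
  by move=> k; apply: measurable_simple_eval; exact: ms.
by move=> x Dx; apply: (continuous_cvg _ _ (sf x Dx)); exact: cg.
Qed.

Lemma strongly_measurable_normB D f (s : seq (set T * V)) :
  (forall p, p \in s -> measurable p.1) -> strongly_measurable D f ->
  measurable_fun D (fun x => `|f x - simple_eval s x|).
Proof.
move=> ms mf.
have h : strongly_measurable D (fun x => f x + (-1) *: simple_eval s x).
  apply: strongly_measurableD => //; apply: strongly_measurableZ.
  by exists (fun=> s); split=> [k|x Dx]; [exact: ms | exact: cvg_cst].
have := @strongly_measurable_measurable D _ (fun v : V => `|v|) (@norm_continuous _ _) h.
by apply: eq_measurable_fun => x _ /=; rewrite scaleN1r.
Qed.

(* Truncating the approximations makes them dominated. *)
Lemma dominated_approximation D f : measurable D -> strongly_measurable D f ->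
  exists s : nat -> seq (set T * V),
    [/\ forall k p, p \in s k -> measurable p.1 /\ p.1 `<=` D,
        forall x, D x -> simple_eval (s k) x @[k --> \oo] --> f x &
        forall k x, D x -> `|simple_eval (s k) x| <= 2 * `|f x| ].
Proof.
move=> mD mf; have [s [ms sf]] := mf.
pose E k := D `&` [set x | `|simple_eval (s k) x| <= 2 * `|f x| ].
have mE k : measurable (E k).
  apply: measurable_fun_le => //.
    by apply: (@measurable_simple_eval D (s k) (fun v => `|v|)); exact: ms.
  by apply: measurable_funM => //; apply: (strongly_measurable_measurable (@norm_continuous _ _) mf).
exists (fun k => [seq (p.1 `&` E k, p.2) | p <- s k]).
have sE k x : simple_eval [seq (p.1 `&` E k, p.2) | p <- s k] x = \1_(E k) x *: simple_eval (s k) x.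
  rewrite /simple_eval big_map scaler_sumr; apply: eq_bigr => p _ /=.
  by rewrite indicI/= scalerA mulrC.
split.
- move=> k p /mapP[q /ms mq ->] /=; split; first exact: measurableI.
  by move=> x [_ []].
(* Where [f x] vanishes, the truncation admits only the value 0; elsewhere the approximants are
   eventually within |f x| of [f x] and pass the bound 2|f x|. *)
- move=> x Dx; have [f0|f0] := eqVneq (f x) 0.
    suff H k : simple_eval [seq (p.1 `&` E k, p.2) | p <- s k] x = 0.
      by under eq_fun do rewrite H; rewrite f0; exact: cvg_cst.
    rewrite sE indicE; have [xE|] := boolP (x \in E k); last by rewrite scale0r.
    have [_ /=] := set_mem xE; rewrite f0 normr0 mulr0 normr_le0 => /eqP ->.
    by rewrite scaler0.
  apply: cvg_trans (sf x Dx); apply: near_eq_cvg.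
  have fp : 0 < `|f x| by rewrite normr_gt0.
  have /cvgrPdist_lt/(_ _ fp) := sf x Dx; apply: filterS => k hk.
  rewrite sE indicE mem_set ?scale1r//; split => //=.
  have := ler_normB (f x) (f x - simple_eval (s k) x); rewrite opprB addrC subrK.
  by move=> /le_trans; apply; rewrite mulr_natl mulr2n lerD2l ltW.
- move=> k x Dx; rewrite sE indicE; have [xE|] := boolP (x \in E k).
    by rewrite scale1r; have [_] := set_mem xE.
  by rewrite scale0r normr0 mulr_ge0.
Qed.

Context {mu : {measure set T -> \bar R}}.

Lemma integrable_simple_eval D (s : seq (set T * V)) (l : V -> R) C :
  measurable D ->
  (forall p, p \in s -> [/\ measurable p.1, p.1 `<=` D & (mu p.1 < +oo)%E]) ->
  (forall a x y, l (a *: x + y) = a * l x + l y) ->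
  (forall x, `|l x| <= C * `|x|) ->
  mu.-integrable D (EFin \o (fun x => l (simple_eval s x))) /\
  \int[mu]_(x in D) l (simple_eval s x) = l (simple_int mu s).
Proof.
move=> mD ms ll bl.
have l0 : l 0 = 0.
  by have := ll 1 0 0; rewrite scale1r addr0 mul1r; lra.
elim: s ms => [|p s IH] ms.
  rewrite /simple_eval /simple_int.
  under eq_fun do rewrite big_nil l0.
  split; last by rewrite big_nil l0 Rintegral_cst// mul0r.
  exact: integrable0.
have [mp pD pfin] := ms p (mem_head _ _).
have [|i1 i2] := IH; first by move=> q qs; apply: ms; rewrite in_cons qs orbT.
have E x : l (simple_eval (p :: s) x) = l p.2 * \1_(p.1) x + l (simple_eval s x).
  by rewrite /simple_eval big_cons ll mulrC.
have i0 : mu.-integrable D (EFin \o \1_(p.1)).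
  apply/integrableP; split.
    by apply/measurable_EFinP; exact: measurable_funTS.
  under eq_integral do rewrite /= ger0_norm//.
  by rewrite integral_indic// (setIidl pD).
have i3 : mu.-integrable D (EFin \o (fun x => l p.2 * \1_(p.1) x)).
  exact: (integrableZl mD (l p.2) i0).
split.
  rewrite (_ : _ \o _ = (EFin \o (fun x => l p.2 * \1_(p.1) x)) \+ (EFin \o (fun x => l (simple_eval s x)))).
    exact: integrableD.
  by apply/funext => x /=; rewrite E EFinD.
under eq_Rintegral do rewrite E.
rewrite RintegralD// i2 /simple_int big_cons ll; congr (_ + _).
rewrite RintegralZl//.
rewrite mulrC; congr (_ * _); rewrite /Rintegral integral_indic//.
by rewrite (setIidl pD).
Qed.

(** Both sides are limits of [l (simple_int mu (s k))], the second because the L1 distance of [f] to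
    [simple_eval (s k)] tends to 0. [l] is a bare function, so that [inner x] and, on a product,
    [inner z w.1] can be used directly. *)
Lemma is_bochner_functional D f v (l : V -> R) C : measurable D ->
  is_bochner mu D f v ->
  (forall a x y, l (a *: x + y) = a * l x + l y) ->
  (forall x, `|l x| <= C * `|x|) ->
  mu.-integrable D (EFin \o (l \o f)) /\ l v = \int[mu]_(x in D) l (f x).
Proof.
move=> mD [s [ms sf fs sv]] ll bl.
have mf : strongly_measurable D f.
  by exists s; split => // k p /ms[].
have lB x y : l (x - y) = l x - l y.
  by rewrite -[- y]scaleN1r addrC ll mulN1r addrC.
have cl : continuous l.
  move=> x; apply/cvgrPdist_le => e e0.
  have C1 : 0 < `|C| + 1 by rewrite ltr_wpDl.
  near=> y; rewrite -lB; apply: le_trans (bl _) _.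
  have : `|x - y| <= e / (`|C| + 1).
    by near: y; apply: cvgr_dist_le; [exact: cvg_id | rewrite divr_gt0].
  rewrite ler_pdivlMr// => h; have := ler_norm C; have := normr_ge0 (x - y).
  by move=> h1 h2; nra.
have msB k : measurable_fun D (fun x => `|f x - simple_eval (s k) x|).
  by apply: strongly_measurable_normB => // p /ms[].
have mlf : measurable_fun D (l \o f) by exact: strongly_measurable_measurable.
(* Convergence to 0 in the extended reals makes the L1 distance finite only eventually, so the
   estimate is stated under that condition. *)
have H k : (\int[mu]_(x in D) `|f x - simple_eval (s k) x|%:E < +oo)%E ->
   mu.-integrable D (EFin \o (fun x => l (f x - simple_eval (s k) x))) /\
   `|\int[mu]_(x in D) l (f x - simple_eval (s k) x)| <=
   `|C| * fine (\int[mu]_(x in D) `|f x - simple_eval (s k) x|%:E)%E.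
  move=> fin.
  have i1 : mu.-integrable D (EFin \o (fun x => `|f x - simple_eval (s k) x|)).
    apply/integrableP; split; first exact/measurable_EFinP.
    by under eq_integral do rewrite /= normr_id.
  have i2 : mu.-integrable D (EFin \o (fun x => `|C| * `|f x - simple_eval (s k) x|)).
    exact: (integrableZl mD `|C| i1).
  have i3 : mu.-integrable D (EFin \o (fun x => l (f x - simple_eval (s k) x))).
    apply: le_integrable i2 => //.
      apply/measurable_EFinP; under eq_fun do rewrite lB.
      by apply: measurable_funB => //; apply: measurable_simple_eval => p /ms[].
    move=> x Dx /=; rewrite lee_fin normrM !normr_id; apply: le_trans (bl _) _.
    by rewrite ler_wpM2r// ler_norm.
  split=> //; apply: le_trans (le_normr_Rintegral mD i3) _.
  rewrite -/(Rintegral mu D (fun x => `|f x - simple_eval (s k) x|)).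
  rewrite -RintegralZl//; apply: le_Rintegral => //.
    exact: (integrable_norm i3).
  move=> x Dx; apply: le_trans (bl _) _.
  by rewrite ler_wpM2r// ler_norm.
have fin : \forall k \near \oo, (\int[mu]_(x in D) `|f x - simple_eval (s k) x|%:E < +oo)%E.
  move/fine_cvgP : fs => -[+ _]; apply: filterS => k.
  by rewrite ge0_fin_numE// integral_ge0.
have is_ k := @integrable_simple_eval D (s k) l C mD (ms k) ll bl.
have ilf : mu.-integrable D (EFin \o (l \o f)).
  have [N _ hN] := fin; have [i1 _] := H N (hN N (leqnn N)).
  rewrite (_ : _ \o _ = (EFin \o (fun x => l (f x - simple_eval (s N) x))) \+ (EFin \o (fun x => l (simple_eval (s N) x)))).
    by apply: integrableD => //; case: (is_ N).
  by apply/funext => x /=; rewrite lB -EFinD subrK.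
split=> //.
have c1 : l (simple_int mu (s k)) @[k --> \oo] --> l v.
  by apply: (continuous_cvg _ _ sv); exact: cl.
have c2 : l (simple_int mu (s k)) @[k --> \oo] --> \int[mu]_(x in D) l (f x).
  apply/cvgrPdist_le => e e0.
  have C1 : 0 < `|C| + 1 by rewrite ltr_wpDl.
  move/fine_cvgP : (fs) => -[_ /cvgr0_norm_le/(_ _ (divr_gt0 e0 C1))].
  apply: filter_app; move: fin; apply: filter_app; near=> k => fink hk.
  have [i1 i2] := H k fink; have [i3 <-] := is_ k.
  rewrite -RintegralB//.
  under eq_Rintegral do rewrite -lB.
  apply: (le_trans i2); move: hk; rewrite /= ger0_norm ?fine_ge0 ?integral_ge0//.
  rewrite ler_pdivlMr// mulrDr mulr1 mulrC; set w := fine _ => hw.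
  have : 0 <= w by rewrite fine_ge0 ?integral_ge0.
  lra.
exact: (cvg_unique _ c1 c2).
Unshelve. all: by end_near. Qed.

End bochner_integral.

Section bochner_hilbert.
Context {R : realType} {d : measure_display} {T : measurableType d}.
Context {K : hilbertType R} {mu : {measure set T -> \bar R}}.
Variables (D : set T) (mD : measurable D) (finD : (mu D < +oo)%E).

Lemma is_bochner_inner (f : T -> K) v x : is_bochner mu D f v ->
  mu.-integrable D (EFin \o (fun s => inner x (f s))) /\
  inner x v = \int[mu]_(s in D) inner x (f s).
Proof.
move=> fv; apply: (@is_bochner_functional _ _ _ _ mu D f v (inner x) `|x| mD fv).
  by move=> a y z; rewrite innerDr innerZr.
by move=> y; exact: inner_le.
Qed.

(** The candidate is the Riesz vector of the functional sending [x] to the integral of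
    [inner x (f s)]. Dominated convergence makes the truncated simple functions converge in L1, and
    duality then makes their integrals converge in norm to the candidate. *)
Lemma bochner_exists (f : T -> K) : strongly_measurable D f ->
  mu.-integrable D (EFin \o (fun s => `|f s|)) -> exists v, is_bochner mu D f v.
Proof.
move=> mf intf.
have i_inner x : mu.-integrable D (EFin \o (fun s => inner x (f s))).
  apply: le_integrable (integrableZl mD `|x| intf) => //.
    apply/measurable_EFinP; apply: (strongly_measurable_measurable _ mf) => y.
    exact: cvg_innerr.
  move=> s Ds /=; rewrite lee_fin normrM !normr_id; exact: inner_le.
have [v vE] : exists v, forall x, \int[mu]_(s in D) inner x (f s) = inner x v.
  apply: (@riesz_bounded _ _ _ (\int[mu]_(s in D) `|f s|)).
    move=> a x y; under eq_Rintegral do rewrite innerDl innerZl.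
    rewrite RintegralD// ?RintegralZl//; exact: (integrableZl mD a (i_inner x)).
  move=> x; apply: le_trans (le_normr_Rintegral mD (i_inner x)) _.
  rewrite mulrC -RintegralZl//; apply: le_Rintegral => //.
  - exact: (integrable_norm (i_inner x)).
  - exact: (integrableZl mD `|x| intf).
  - by move=> s _; exact: inner_le.
exists v.
have [s [ms sf sd]] := dominated_approximation mD mf.
have ms' k p : p \in s k -> [/\ measurable p.1, p.1 `<=` D & (mu p.1 < +oo)%E].
  move=> /ms[mp pD]; split => //; apply: le_lt_trans finD.
  by apply: le_measure => //; rewrite inE.
have mB k : measurable_fun D (fun x => `|f x - simple_eval (s k) x|).
  by apply: strongly_measurable_normB => // p /ms[].
(* 3 = 1 + 2, with the 2 of [dominated_approximation]. *)
have i3 : mu.-integrable D (EFin \o (fun x => 3 * `|f x|)).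
  exact: (integrableZl mD 3 intf).
have le3 k x : D x -> `|f x - simple_eval (s k) x| <= 3 * `|f x|.
  move=> Dx; have := ler_normB (f x) (simple_eval (s k) x); have := sd k x Dx; lra.
have iB k : mu.-integrable D (EFin \o (fun x => `|f x - simple_eval (s k) x|)).
  apply: le_integrable i3 => //; first exact/measurable_EFinP.
  move=> x Dx /=; rewrite lee_fin normr_id normrM normr_id ger0_norm//.
  exact: le3.
have fs : (\int[mu]_(x in D) `|f x - simple_eval (s k) x|%:E)%E @[k --> \oo] --> 0%E.
  have := @dominated_convergence _ _ _ mu D mD
    (fun k x => `|f x - simple_eval (s k) x|%:E) (cst 0%E) (fun x => (3 * `|f x|)%:E).
  case=> //.
  - by move=> k; exact/measurable_EFinP.
  - apply: aeW => x Dx; apply: cvg_EFin; first exact: nearW.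
    rewrite -(@normr0 _ K) -(subrr (f x)).
    by apply: cvg_norm; apply: cvgB; [exact: cvg_cst | exact: sf].
  - by apply: aeW => x k Dx; rewrite /= lee_fin normr_id; exact: le3.
  by move=> _ _; rewrite integral0.
exists s; split => //.
apply/cvgrPdist_le => e e0.
move/fine_cvgP : fs => -[_ /cvgr0_norm_le/(_ _ e0)]; apply: filterS => k /=.
rewrite -/(Rintegral mu D (fun x => `|f x - simple_eval (s k) x|)).
rewrite ger0_norm ?Rintegral_ge0// => le_e.
apply: inner_norm_le; first exact: ltW.
move=> y; rewrite innerC innerBr -vE.
have [i4 <-] := @integrable_simple_eval _ _ _ _ mu D (s k) (inner y) `|y| mD (ms' k)
  (fun a x z => ltac:(by rewrite innerDr innerZr)) (inner_le y).
rewrite -RintegralB//; apply: le_trans (ler_norm _) _.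
under eq_Rintegral do rewrite -innerBr.
have i5 : mu.-integrable D (EFin \o (fun x => inner y (f x - simple_eval (s k) x))).
  have := integrableB mD (i_inner y) i4.
  by apply: eq_integrable => // x _ /=; rewrite innerBr EFinB.
apply: le_trans (le_normr_Rintegral mD i5) _.
apply: (@le_trans _ _ (`|y| * \int[mu]_(x in D) `|f x - simple_eval (s k) x|)).
  rewrite -RintegralZl//; apply: le_Rintegral => //.
  - exact: (integrable_norm i5).
  - exact: (integrableZl mD `|y| (iB k)).
  - by move=> x _; exact: inner_le.
by rewrite mulrC ler_wpM2r.
Qed.

Lemma bochner_inner (f : T -> K) x : strongly_measurable D f ->
  mu.-integrable D (EFin \o (fun s => `|f s|)) ->
  mu.-integrable D (EFin \o (fun s => inner x (f s))) /\
  inner x (bochner mu D f) = \int[mu]_(s in D) inner x (f s).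
Proof.
move=> mf intf; apply: is_bochner_inner.
by have := bochner_exists mf intf; rewrite /bochner => /(xgetPex 0).
Qed.

End bochner_hilbert.

(** * Invariance of closed sets under semigroups *)

Section invariance.
Context {R : realType}.

Lemma closure_normP (V : normedModType R) (S : set V) z :
  closure S z <-> forall e : R, 0 < e -> exists2 w, S w & `|z - w| <= e.
Proof.
split=> [clz e e0|h B].
  have [w [Sw zw]] := clz _ (nbhsx_ballx z e e0); exists w => //.
  by move: zw; rewrite -ball_normE => /ltW.
move=> /nbhs_ballP[e /= e0 eB].
have [w Sw zw] := h (e / 2) ltac:(by rewrite divr_gt0).
exists w; split => //; apply: eB; rewrite -ball_normE /ball_/=.
by apply: le_lt_trans zw _; lra.
Qed.

(** Let [m] be the infimum of the times s with E t <= E s + e' (t - s). Right continuity shows that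
    [m] is attained; if it were positive, the backward step would produce a smaller such time. *)
Lemma dini_nonincreasing (E : R -> R) (t : R) : 0 <= t ->
  (forall s, 0 <= s -> E (s + h) @[h --> 0^'+] --> E s) ->
  (forall s e, 0 < s -> 0 < e -> exists h, [/\ 0 < h, h <= s & E s <= E (s - h) + e * h]) ->
  E t <= E 0.
Proof.
move=> t0 cE dE.
apply/ler_addgt0Pr => e e0.
(* Chosen so that the total allowance e' t is at most e. *)
pose e' := e / (t + 1).
have t1 : 0 < t + 1 by rewrite ltr_wpDl.
have e'0 : 0 < e' by rewrite divr_gt0.
pose S := [set s | 0 <= s <= t /\ E t <= E s + e' * (t - s)].
have St : S t by rewrite /S/= t0 lexx subrr mulr0 addr0.
have Sb : has_inf S by split; [exists t | exists 0 => s [/andP[]]].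
pose m := inf S.
have m0 : 0 <= m by apply: lb_le_inf; [exists t | move=> s [/andP[]]].
have mt : m <= t by apply: ge_inf => //; case: Sb.
have Sm : E t <= E m + e' * (t - m).
  apply/ler_addgt0Pr => d d0.
  have /cvgrPdist_lt/(_ d d0) [r /= r0 hr] := cE m m0.
  have [s [/andP[s0 st] Es] sm] := inf_adherent r0 Sb.
  have ms : m <= s by apply: ge_inf; [case: Sb | split=> //; apply/andP].
  have [msE|ms'] := eqVneq m s.
    by rewrite -msE in Es; lra.
  have lms : 0 < s - m by rewrite subr_gt0 lt_neqAle ms' ms.
  have := hr (s - m); rewrite /ball_/= sub0r normrN gtr0_norm// => /(_ _ lms).
  rewrite -/m in sm; rewrite ltrBlDl sm => /(_ isT).
  rewrite (_ : m + (s - m) = s); last by lra.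
  rewrite ltr_norml => /andP[h1 h2].
  have : e' * (t - s) <= e' * (t - m) by rewrite ler_wpM2l ?ltW//; lra.
  lra.
have [m_eq|mpos] : m = 0 \/ 0 < m.
  by move: m0; rewrite le_eqVlt => /orP[/eqP|]; [left|right].
  rewrite m_eq subr0 in Sm; apply: (le_trans Sm); rewrite lerD2l.
  by rewrite /e' mulrAC ler_pdivrMr// ler_wpM2l// ?ltW//; lra.
have [h [h0 hm Eh]] := dE m e' mpos e'0.
suff : m <= m - h by lra.
apply: ge_inf; first by case: Sb.
split; first by apply/andP; split; lra.
lra.
Qed.

Context {V : normedModType R} (S : R -> {linear V -> V}) (C om : R).
Hypotheses (S0 : forall x, S 0 x = x)
  (SD : forall s t, 0 <= s -> 0 <= t -> forall x, S (s + t) x = S s (S t x))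
  (Sc : forall x, S t x @[t --> 0^'+] --> x)
  (C0 : 0 < C) (om0 : 0 <= om)
  (Sb : forall t x, 0 <= t -> `|S t x| <= C * expR (om * t) * `|x|).

(* An equivalent norm for which [expR (- om * t) * S t] is contractive. *)
Definition renorm (z : V) : R :=
  sup [set expR (- om * t) * `|S t z| | t in [set t | 0 <= t]].

Lemma renorm_has_sup z :
  has_sup [set expR (- om * t) * `|S t z| | t in [set t | 0 <= t]].
Proof.
split; first by exists (expR (- om * 0) * `|S 0 z|); exists 0 => //=.
exists (C * `|z|) => _ [t /= t0 <-].
have := ler_wpM2l (expR_ge0 (- om * t)) (Sb z t0); move=> /le_trans; apply.
have -> : expR (- om * t) * (C * expR (om * t) * `|z|) =
  (expR (- om * t) * expR (om * t)) * (C * `|z|) by ring.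
by rewrite -expRD mulNr addNr expR0 mul1r.
Qed.

Lemma renorm_ge z t : 0 <= t -> expR (- om * t) * `|S t z| <= renorm z.
Proof. by move=> t0; apply: ub_le_sup; [case: (renorm_has_sup z) | exists t]. Qed.

Lemma renorm_le z c :
  (forall t, 0 <= t -> expR (- om * t) * `|S t z| <= c) -> renorm z <= c.
Proof.
move=> h; apply: ge_sup; first by case: (renorm_has_sup z).
by move=> _ [t /= t0 <-]; exact: h.
Qed.

Lemma le_renorm z : `|z| <= renorm z.
Proof. by have := renorm_ge z (lexx 0); rewrite mulr0 expR0 mul1r S0. Qed.

Lemma renorm_bound z : renorm z <= C * `|z|.
Proof.
apply: renorm_le => t t0.
have := ler_wpM2l (expR_ge0 (- om * t)) (Sb z t0); move=> /le_trans; apply.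
have -> : expR (- om * t) * (C * expR (om * t) * `|z|) =
  (expR (- om * t) * expR (om * t)) * (C * `|z|) by ring.
by rewrite -expRD mulNr addNr expR0 mul1r.
Qed.

Lemma renormD x y : renorm (x + y) <= renorm x + renorm y.
Proof.
apply: renorm_le => t t0; apply: le_trans (lerD (renorm_ge x t0) (renorm_ge y t0)).
by rewrite -mulrDr ler_wpM2l ?expR_ge0// linearD ler_normD.
Qed.

Lemma renormZ a x : 0 <= a -> renorm (a *: x) <= a * renorm x.
Proof.
move=> a0; apply: renorm_le => t t0.
by rewrite linearZ normrZ ger0_norm// mulrCA ler_wpM2l// renorm_ge.
Qed.

Lemma renormN x : renorm (- x) = renorm x.
Proof.
by rewrite /renorm; congr (sup _); apply/seteqP; split => _ [t t0 <-];
  exists t; rewrite ?linearN ?normrN.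
Qed.

Lemma renorm_ge0 x : 0 <= renorm x.
Proof. by apply: le_trans (le_renorm x). Qed.

Lemma renormS s z : 0 <= s -> renorm (S s z) <= expR (om * s) * renorm z.
Proof.
move=> s0; apply: renorm_le => t t0.
have := ler_wpM2l (expR_ge0 (om * s)) (renorm_ge z (addr_ge0 t0 s0)).
rewrite SD// mulrA -expRD; congr (expR _ * _ <= _); lra.
Qed.

Lemma generatorB x y v w : generator S (x, v) -> generator S (y, w) ->
  generator S (x - y, v - w).
Proof.
move=> xv yw; rewrite /generator/=.
suff -> : (fun h => h^-1 *: (S h (x - y) - (x - y))) =
    (fun h => h^-1 *: (S h x - x) - h^-1 *: (S h y - y)) by exact: cvgB xv yw.
apply/funext => h; rewrite -scalerBr (linearB (S h)); congr (_ *: _).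
by rewrite !opprB (addrC y (- x)) addrACA (addrC (- S h y)).
Qed.

Lemma generatorZ a x v : generator S (x, v) -> generator S (a *: x, a *: v).
Proof.
move=> xv; rewrite /generator/=.
suff -> : (fun h => h^-1 *: (S h (a *: x) - a *: x)) =
    (fun h => a *: (h^-1 *: (S h x - x))) by apply: cvgZr; exact: xv.
apply/funext => h; have -> : S h (a *: x) = a *: S h x by rewrite linearZ_LR.
by rewrite -scalerBr !scalerA mulrC.
Qed.

Lemma generatorS t x v : 0 <= t -> continuous (S t) -> generator S (x, v) ->
  generator S (S t x, S t v).
Proof.
move=> t0 ct xv; rewrite /generator/=.
have : S t (h^-1 *: (S h x - x)) @[h --> 0^'+] --> S t v.
  by apply: (continuous_cvg _ _ xv); exact: ct.
apply: cvg_trans; apply: near_eq_cvg.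
near=> h; have h0 : 0 <= h by near: h; exact: nbhs_right_ge.
by rewrite linearZ linearB -!SD// (addrC h).
Unshelve. all: by end_near. Qed.

(** The difference quotient writes (1 + h/s) z as (z - h v) + (h/s) S(s) z - h q(s), where q(s)
    tends to 0. In the new norm S(s) grows at most by exp(om s), so letting s tend to 0 leaves the
    factor 1 - h om. *)
Lemma renorm_dissipative z v h : generator S (z, v) -> 0 < h ->
  (1 - h * om) * renorm z <= renorm (z - h *: v).
Proof.
move=> zv h0.
pose q s := s^-1 *: (S s z - z) - v.
have key s : 0 < s ->
    (1 - h * om * expR (om * s)) * renorm z <= renorm (z - h *: v) + h * C * `|q s|.
  move=> s0.
  have zE : z = (1 + h / s)^-1 *: ((z - h *: v) + ((h / s) *: S s z + (h *: - q s))).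
    have d0 : 1 + h / s != 0 by rewrite gt_eqF// addr_gt0// divr_gt0.
    apply: (scalerI d0); rewrite scalerA divff// scale1r /q opprB scalerBr scalerA.
    rewrite scalerBr scalerDl scale1r -addrA; congr (_ + _).
    by rewrite opprB addrCA addKr addrCA subrr addr0.
  have d1 : 0 < 1 + h / s by rewrite addr_gt0// divr_gt0.
  have := renormZ ((z - h *: v) + ((h / s) *: S s z + (h *: - q s))) (ltW (ltac:(by rewrite invr_gt0) : 0 < (1 + h / s)^-1)).
  rewrite -zE mulrC ler_pdivlMr// => h1.
  have h2 := renormD (z - h *: v) ((h / s) *: S s z + (h *: - q s)).
  have h3 := renormD ((h / s) *: S s z) (h *: - q s).
  have hs0 : 0 <= h / s by rewrite divr_ge0// ltW.
  have h4 := renormZ (S s z) hs0.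
  have h5 := renormZ (- q s) (ltW h0).
  have h6 := ler_wpM2l (ltW h0) (renorm_bound (q s)).
  have h7 := ler_wpM2l hs0 (renormS z (ltW s0)).
  rewrite renormN in h5.
  (* From 1 - x <= exp(-x), multiplied by exp(x), at x = om s. *)
  have h8 : h / s * (expR (om * s) - 1) <= h * om * expR (om * s).
    rewrite -!mulrA ler_pM2l// ler_pdivrMl//.
    have := expR_ge1Dx (- (om * s)); rewrite expRN => h8.
    have := ler_wpM2r (expR_ge0 (om * s)) h8.
    rewrite mulVf ?gt_eqF ?expR_gt0//; lra.
  have h9 := ler_wpM2r (renorm_ge0 z) h8.
  rewrite mulrA in h6.
  have h10 : renorm z * (1 + h / s) <= renorm (z - h *: v) + (h / s * (expR (om * s) * renorm z) + h * C * `|q s|) by lra.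
  lra.
have L : (1 - h * om * expR (om * s)) * renorm z @[s --> 0^'+] --> (1 - h * om) * renorm z.
  have e1 : expR (om * s) @[s --> 0^'+] --> expR (om * 0).
    apply: cvg_at_right_filter; apply: continuous_comp; last exact: continuous_expR.
    exact: mulrl_continuous.
  rewrite -[in X in _ --> X](mulr1 (h * om)) -[X in _ - _ * X]expR0 -[X in expR X](mulr0 om).
  apply: cvgMl; apply: cvgB; first exact: cvg_cst.
  by apply: cvgMr.
have Q : renorm (z - h *: v) + h * C * `|q s| @[s --> 0^'+] -->
    renorm (z - h *: v) + h * C * `|v - v|.
  apply: cvgD; first exact: cvg_cst.
  by apply: cvgMr; apply: cvg_norm; apply: cvgB; [exact: zv | exact: cvg_cst].
rewrite subrr normr0 mulr0 addr0 in Q.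
apply: (ler_cvg_to L Q); near=> s; apply: key; near: s; exact: nbhs_right_gt.
Unshelve. all: by end_near. Qed.

Variables (W : set V) (h0 : R).
Hypotheses (Wne : W !=set0) (h0_gt0 : 0 < h0).
Hypothesis range : forall h e w, 0 < h -> h < h0 -> 0 < e -> W w ->
  exists z v, [/\ W z, generator S (z, v) & `|z - h *: v - w| <= e].

Definition redist z := inf [set renorm (z - w) | w in W].

Lemma redist_has_inf z : has_inf [set renorm (z - w) | w in W].
Proof.
split; first by have [w Ww] := Wne; exists (renorm (z - w)); exists w.
by exists 0 => _ [w Ww <-]; exact: renorm_ge0.
Qed.

Lemma redist_le z w : W w -> redist z <= renorm (z - w).
Proof. by move=> Ww; apply: ge_inf; [case: (redist_has_inf z) | exists w]. Qed.

Lemma le_redist z c : (forall w, W w -> c <= renorm (z - w)) -> c <= redist z.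
Proof.
move=> h; apply: lb_le_inf; first by case: (redist_has_inf z).
by move=> _ [w Ww <-]; exact: h.
Qed.

Lemma redist_ge0 z : 0 <= redist z.
Proof. by apply: le_redist => w _; exact: renorm_ge0. Qed.

Lemma redist_lip z y : redist z <= redist y + renorm (z - y).
Proof.
rewrite -lerBlDr; apply: le_redist => w Ww; rewrite lerBlDr.
apply: le_trans (redist_le z Ww) _; apply: le_trans (renormD _ _).
by rewrite [leRHS](_ : _ = renorm (z - w))// [y - w + _]addrC addrA subrK.
Qed.

(** For each [w] in [W], [range] gives y in [W] with y - h u close to [w]; dissipativity at z - y
    then bounds the distance from z to y by that from z - h v to [w]. The tolerance e/C becomes e in
    the new norm. *)
Lemma redist_dissipative z v h : generator S (z, v) -> 0 < h -> h < h0 ->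
  h * om <= 1 -> (1 - h * om) * redist z <= redist (z - h *: v).
Proof.
move=> zv hp hh hom; apply: le_redist => w Ww; apply/ler_addgt0Pr => e e0.
have [y [u [Wy yu le]]] := range hp hh (divr_gt0 e0 C0) Ww.
have h1 : (1 - h * om) * redist z <= (1 - h * om) * renorm (z - y).
  by rewrite ler_wpM2l ?subr_ge0// redist_le.
apply: (le_trans h1); apply: le_trans (renorm_dissipative (generatorB zv yu) hp) _.
have -> : z - y - h *: (v - u) = (z - h *: v - w) + - (y - h *: u - w).
  rewrite scalerBr !opprB [RHS]addrA subrK.
  by rewrite (addrC (h *: u) (- _)) addrACA (addrC (- y)).
apply: le_trans (renormD _ _) _; rewrite lerD2l renormN.
apply: le_trans (renorm_bound _) _.
by rewrite mulrC -ler_pdivlMr.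
Qed.

Hypothesis Scont : forall t, 0 <= t -> continuous (S t).

(** Starting in the domain keeps the orbit in the domain ([generatorS]), so S(s - h) z equals S(s) z
    - h S(s) v up to o(h), and the dissipative estimate acts as a backward Euler step for
    [dini_nonincreasing]. *)
Lemma redist_orbit z v t : generator S (z, v) -> 0 <= t ->
  redist (S t z) <= expR (om * t) * redist z.
Proof.
move=> zv t0.
pose E s := expR (- om * s) * redist (S s z).
suff : E t <= E 0.
  rewrite /E mulr0 expR0 mul1r S0 mulNr expRN => h.
  by rewrite -ler_pdivrMl ?expR_gt0.
have cexp (a : R) : continuous (fun s : R => expR (a * s)).
  move=> s; apply: continuous_comp; last exact: continuous_expR.
  exact: mulrl_continuous.
apply: dini_nonincreasing => // [s s0|s e s0 e0].
  rewrite /E; apply: cvgM.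
    apply: cvg_at_right_filter.
    have c : continuous (fun h : R => expR (- om * (s + h))).
      move=> h; apply: (@continuous_comp _ _ _ (fun h => s + h) (fun h => expR (- om * h))).
        by apply: cvgD; [exact: cvg_cst | exact: cvg_id].
      exact: cexp.
    by have := c 0; rewrite /continuous_at addr0.
  apply/cvgrPdist_le => e e0.
  have : S s (S h z - z) @[h --> 0^'+] --> S s (z - z).
    apply: continuous_cvg; first exact: Scont.
    by apply: cvgB => //; exact: cvg_cst.
  rewrite subrr linear0 => /cvgr0_norm_le /(_ _ (divr_gt0 e0 C0)).
  apply: filter_app; near=> h => hle.
  have h0' : 0 <= h by near: h; exact: nbhs_right_ge.
  have le1 : renorm (S (s + h) z - S s z) <= e.
    apply: le_trans (renorm_bound _) _.
    by rewrite SD// -linearB mulrC -ler_pdivlMr.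
  have a1 := redist_lip (S (s + h) z) (S s z).
  have a2 := redist_lip (S s z) (S (s + h) z).
  rewrite -opprB renormN in a2.
  rewrite ler_norml; apply/andP; split; lra.
have hv : `|h^-1 *: (S h z - z) - v| @[h --> 0^'+] --> `|v - v|.
  by apply: cvg_norm; apply: cvgB; [exact: zv|exact: cvg_cst].
have hS : `|S h v - v| @[h --> 0^'+] --> `|v - v|.
  by apply: cvg_norm; apply: cvgB => //; exact: cvg_cst.
have hE : h * om ^+ 2 * E s @[h --> 0^'+] --> 0 * om ^+ 2 * E s.
  by apply: cvgMl; apply: cvgMl; exact: cvg_at_right_filter.
have hX : expR (om * h) @[h --> 0^'+] --> expR (om * 0).
  by apply: cvg_at_right_filter; exact: cexp.
have hC : C * (`|h^-1 *: (S h z - z) - v| + `|S h v - v|) @[h --> 0^'+] --> C * (`|v - v| + `|v - v|).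
  by apply: cvgMr; exact: cvgD hv hS.
have : h * om ^+ 2 * E s + expR (om * h) * (C * (`|h^-1 *: (S h z - z) - v| + `|S h v - v|))
    @[h --> 0^'+] --> 0 * om ^+ 2 * E s + expR (om * 0) * (C * (`|v - v| + `|v - v|)).
  by apply: cvgD hE _; exact: cvgM hX hC.
rewrite subrr normr0 addr0 !mulr0 addr0 !mul0r => /cvgr0_norm_le /(_ _ e0) H.
have om1 : 0 < om + 1 by rewrite ltr_wpDl.
have om2 : 0 < (om + 1)^-1 by rewrite invr_gt0.
near (0 : R)^'+ => h; exists h.
have hp : 0 < h by near: h; exact: nbhs_right_gt.
have hs : h <= s by near: h; exact: nbhs_right_le.
have hh0 : h < h0 by near: h; exact: nbhs_right_lt.
have hom : h * om <= 1.
  have hle : h <= (om + 1)^-1 by near: h; exact: nbhs_right_le.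
  have := ler_wpM2r (ltW om1) hle; rewrite mulVf ?gt_eqF//; nra.
split => //.
have := redist_dissipative (generatorS (ltW s0) (Scont (ltW s0)) zv) hp hh0 hom.
have sh0 : 0 <= s - h by rewrite subr_ge0.
have dE : S s z - h *: S s v - S (s - h) z = S (s - h) (h *: ((h^-1 *: (S h z - z) - v) - (S h v - v))).
  have -> : h^-1 *: (S h z - z) - v - (S h v - v) = h^-1 *: (S h z - z) - S h v.
    by rewrite opprB addrA subrK.
  rewrite scalerBr scalerA divff ?gt_eqF// scale1r.
  have L : S (s - h) (h *: S h v) = h *: S (s - h) (S h v) by rewrite linearZ_LR.
  rewrite (linearB (S (s - h))) (linearB (S (s - h))) L.
  by rewrite -!(SD sh0 (ltW hp)) subrK addrAC.
move=> a1; have a2 := redist_lip (S s z - h *: S s v) (S (s - h) z).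
rewrite dE in a2.
have a3 := renormS (h *: ((h^-1 *: (S h z - z) - v) - (S h v - v))) sh0.
have a4 := renormZ ((h^-1 *: (S h z - z) - v) - (S h v - v)) (ltW hp).
have a5 := renorm_bound ((h^-1 *: (S h z - z) - v) - (S h v - v)).
have a6 := ler_normB (h^-1 *: (S h z - z) - v) (S h v - v).
set rho := C * (`|h^-1 *: (S h z - z) - v| + `|S h v - v|).
have a7 : renorm (h *: ((h^-1 *: (S h z - z) - v) - (S h v - v))) <= h * rho.
  apply: le_trans a4 _; rewrite ler_pM2l//; apply: le_trans a5 _.
  by rewrite ler_pM2l.
have a8 : (1 - h * om) * redist (S s z) <= redist (S (s - h) z) + expR (om * (s - h)) * (h * rho).
  apply: (le_trans a1); apply: (le_trans a2); rewrite lerD2l; apply: (le_trans a3).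
  by rewrite ler_pM2l// expR_gt0.
(* The error allowed per unit of time: h om^2 E(s) comes from (1 - h om)(1 + h om) = 1 - h^2 om^2,
   the rest from the o(h) of the backward step. *)
have a9 : h * om ^+ 2 * E s + expR (om * h) * rho <= e.
  have : `|h * om ^+ 2 * E s + expR (om * h) * rho| <= e.
    by rewrite /rho; near: h; exact: H.
  by move=> /(le_trans (ler_norm _)).
have e1 : expR (- om * s) = expR (- om * (s - h)) * expR (- om * h).
  by rewrite -expRD; congr expR; lra.
have e2 : expR (om * h) * expR (- om * h) = 1 by rewrite -expRD mulNr subrr expR0.
have e3 : expR (- om * (s - h)) * expR (om * (s - h)) = 1 by rewrite -expRD mulNr addNr expR0.
have Es0 : 0 <= E s by rewrite mulr_ge0 ?expR_ge0 ?redist_ge0.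
have b1 : (1 - h * om) * (1 + h * om) * E s <= expR (om * h) * ((1 - h * om) * E s).
  rewrite (mulrC (1 - _)) -mulrA; apply: ler_wpM2r.
    by rewrite mulr_ge0// subr_ge0.
  by rewrite (mulrC h); exact: expR_ge1Dx.
have b2 : expR (om * h) * ((1 - h * om) * E s) <= E (s - h) + expR (om * h) * (h * rho).
  have ep : 0 <= expR (om * h) * expR (- om * s) by rewrite mulr_ge0 ?expR_ge0.
  have := ler_wpM2l ep a8; rewrite /E.
  have -> : expR (om * h) * expR (- om * s) = expR (- om * (s - h)).
    by rewrite e1 mulrCA e2 mulr1.
  rewrite [X in _ <= X -> _](_ : _ = expR (- om * (s - h)) * redist (S (s - h) z) + 1 * (h * rho)); last
      by rewrite -e3; ring.
    move=> b.
  have -> : expR (om * h) * ((1 - h * om) * (expR (- om * s) * redist (S s z))) =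
    expR (- om * (s - h)) * ((1 - h * om) * redist (S s z)).
    by rewrite e1; transitivity ((expR (om * h) * expR (- om * h)) * expR (- om * (s - h)) * ((1 - h * om) * redist (S s z))); [ring | rewrite e2; ring].
  apply: (le_trans b); rewrite mul1r lerD2l ler_peMl//.
    rewrite mulr_ge0// ?mulr_ge0 ?addr_ge0// ltW//.
  by rewrite -expR0 ler_expR mulr_ge0// ltW.
have b3 := ler_wpM2r (ltW hp) a9.
lra.
Unshelve. all: by end_near. Qed.

(** The distance to [W] is Lipschitz in the new norm and S(t) is bounded, so the estimate for orbits
    from the domain extends by density, and distance 0 stays 0. The approximants of [z] in [W] and
    in the domain may be different. *)
Theorem closed_invariance z t :
  closure W z -> closure [set y | exists v, generator S (y, v)] z -> 0 <= t ->
  closure W (S t z).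
Proof.
move=> /closure_normP Wz /closure_normP Dz t0.
have ex0 := expR_gt0 (om * t).
have d0 : redist (S t z) <= 0.
  apply/ler_addgt0Pr => e e0; rewrite add0r.
  (* Three errors of size C e' in the new norm: two to compare y with [W] through [z], one for
     S(t)(z - y). *)
  pose e' := e / (expR (om * t) * C * 3).
  have c0 : 0 < expR (om * t) * C * 3 by rewrite !mulr_gt0.
  have e'0 : 0 < e' by rewrite divr_gt0.
  have [w Ww zw] := Wz _ e'0; have [y [v yv] zy] := Dz _ e'0.
  have a1 := redist_orbit yv t0.
  have a2 := redist_lip (S t z) (S t y).
  rewrite -linearB in a2.
  have a3 := renormS (z - y) t0.
  have a4 := redist_lip y z.
  have a5 := redist_le z Ww.
  have a6 := le_trans (renorm_bound _) (ler_wpM2l (ltW C0) zw).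
  have a7 := le_trans (renorm_bound _) (ler_wpM2l (ltW C0) zy).
  rewrite -opprB renormN in a4.
  have a8 : redist y <= 2 * (C * e') by lra.
  have a9 := ler_wpM2l (ltW ex0) a8.
  have a10 := ler_wpM2l (ltW ex0) a7.
  have : e = expR (om * t) * (2 * (C * e')) + expR (om * t) * (C * e').
    by rewrite /e'; field; rewrite !gt_eqF.
  by move=> ->; lra.
apply/closure_normP => e e0.
have d1 : redist (S t z) < e by apply: le_lt_trans e0.
have d2 : 0 < e - redist (S t z) by rewrite subr_gt0.
have [_ [w Ww <-] lw] := inf_adherent d2 (redist_has_inf (S t z)).
exists w => //; apply: le_trans (le_renorm _) (ltW _).
by apply: lt_le_trans lw _; rewrite addrC subrK.
Qed.

End invariance.

(** * Growth bound of a semigroup *)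

Section uniform_boundedness.
Context {R : realType} {V W : normedModType R}.

(* The space [L2] carries no complete structure; this form of completeness is
   all that the uniform boundedness principle needs. *)
Definition geometric_complete (U : normedModType R) := forall (x : nat -> U) (c : R),
  (forall n, `|x n.+1 - x n| <= c * 3^-1 ^+ n) -> exists l : U, x n @[n --> \oo] --> l.

(* Sokal's argument: the maximum of [F (x + xi)] and [F (x - xi)] in norm is at
   least [F xi], so a Cauchy sequence can be built on which the family blows up. *)
Theorem uniform_boundedness (F : nat -> {linear V -> W}) : geometric_complete V ->
  (forall n, continuous (F n)) -> (forall x, exists M, forall n, `|F n x| <= M) ->
  exists2 C, 0 < C & forall n x, `|F n x| <= C * `|x|.
Proof.
move=> cV cF bF; apply: contrapT => unb.
have far (r k : R) : 0 < r -> 0 < k -> exists n xi, `|xi| <= r /\ k <= `|F n xi|.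
  move=> r0 k0; apply: contrapT => H; apply: unb.
  exists (k / r); first by rewrite divr_gt0.
  move=> n x; have [->|x0] := eqVneq x 0; first by rewrite linear0 !normr0 mulr0.
  have nx : 0 < `|x| by rewrite normr_gt0.
  have [|Fk] := leP k (`|F n ((r / `|x|) *: x)|).
    move=> Fk; exfalso; apply: H; exists n, ((r / `|x|) *: x); split => //.
    by rewrite normrZ normrM normfV normr_id divfK ?gt_eqF// gtr0_norm.
  move: Fk; rewrite linearZ normrZ normrM normfV normr_id (gtr0_norm r0) => /ltW.
  by rewrite mulrAC ler_pdivrMr// mulrC -ler_pdivlMr// mulrAC.
have step (x : V) (r k : R) : 0 < r -> 0 < k -> exists n x' r',
    [/\ 0 < r', r' <= r / 3, `|x' - x| <= r / 2 &
      forall y, `|y - x'| <= r' -> k <= `|F n y|].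
  (* The extra 1 in k + 1 is spent on a ball around x' on which [F n] varies by at most 1. *)
  move=> r0 k0; have [n [xi [xir Fxi]]] := far (r / 2) (k + 1) (ltac:(lra)) (ltac:(lra)).
  have [x' xx' Fx'] : exists2 x', `|x' - x| <= r / 2 & k + 1 <= `|F n x'|.
    have [h|h] := leP (k + 1) `|F n (x + xi)|.
      by exists (x + xi) => //; rewrite addrC addKr.
    exists (x - xi); first by rewrite addrC addKr normrN.
    have := ler_normB (F n (x + xi)) (F n (x - xi)).
    have -> : F n (x + xi) - F n (x - xi) = 2 *: F n xi.
      by rewrite -linearB opprB addrC addrA subrK linearD scaler_nat mulr2n.
    rewrite normrZ ger0_norm// => h2.
    by move: Fxi h h2; move: `|F n xi| `|F n (x + xi)| `|F n (x - xi)| => a b c *; lra.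
  have := cF n x'; move=> /cvgrPdist_le/(_ 1 ltr01)/nbhs_ballP[e /= e0 he].
  exists n, x', (Num.min (e / 2) (r / 3)); split => //.
  - by rewrite lt_min !divr_gt0.
  - by rewrite ge_min lexx orbT.
  move=> y; rewrite le_min => /andP[ye _].
  have : `|F n x' - F n y| <= 1.
    by apply: he; rewrite -ball_normE /ball_/= distrC; apply: le_lt_trans ye _; lra.
  have := ler_normD (F n y) (F n x' - F n y); rewrite addrC subrK.
  by move: `|F n x' - F n y| `|F n x'| `|F n y| Fx' => a b c *; lra.
pose state := (V * {r : R | 0 < r})%type.
pose P (k : nat) (s s' : state) := exists n,
  [/\ sval s'.2 <= sval s.2 / 3, `|s'.1 - s.1| <= sval s.2 / 2 &
      forall y, `|y - s'.1| <= sval s'.2 -> k.+1%:R <= `|F n y|].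
have ex k s : exists s', P k s s'.
  have [n [x' [r' [r'0 h1 h2 h3]]]] := step s.1 (sval s.2) k.+1%:R (svalP s.2) (ltac:(by [])).
  by exists (x', exist _ r' r'0), n.
pose nxt k s := sval (cid (ex k s)).
have nxtP k s : P k s (nxt k s) by exact: (svalP (cid (ex k s))).
pose u := fix u n := if n is m.+1 then nxt m (u m) else ((0 : V), exist (fun r : R => 0 < r) 1 ltr01).
have r_le n : sval (u n).2 <= 3^-1 ^+ n.
  elim: n => [|n IH]; first by rewrite expr0.
  have [m [h _ _]] := nxtP n (u n).
  by rewrite exprS; apply: (le_trans h); rewrite mulrC ler_wpM2l.
have [l xl] : exists l : V, (u n).1 @[n --> \oo] --> l.
  apply: (cV _ (1 / 2)) => n; have [m [_ h _]] := nxtP n (u n).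
  by apply: (le_trans h); have := r_le n; lra.
(* Nested balls: a step moves the center by at most r/2 and shrinks the radius to at most r/3, and
   1/2 + 1/3 <= 1. Hence the limit lies in every ball. *)
have ball_in n j : `|(u (j + n)%N).1 - (u n).1| + sval (u (j + n)%N).2 <= sval (u n).2.
  elim: j => [|j IH]; first by rewrite add0n subrr normr0 add0r.
  have [m [h1 h2 _]] := nxtP (j + n)%N (u (j + n)%N).
  have := ler_normD ((u (j + n).+1).1 - (u (j + n)%N).1) ((u (j + n)%N).1 - (u n).1).
  rewrite addrA subrK addSn; have := svalP (u (j + n)%N).2; move: h1 h2 IH.
  rewrite -[nxt _ _]/(u (j + n).+1).
  by move=> *; lra.
have l_in n : `|l - (u n).1| <= sval (u n).2.
  have c1 : `|(u m).1 - (u n).1| @[m --> \oo] --> `|l - (u n).1|.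
    by apply: cvg_norm; apply: cvgB => //; exact: cvg_cst.
  apply: (ler_cvg_to c1 (cvg_cst (sval (u n).2))).
  exists n => // m /= nm; have := ball_in n (m - n)%N; rewrite subnK//.
  by have := svalP (u m).2; lra.
have [M hM] := bF l.
have [m [_ _ h]] := nxtP (Num.truncn M).+1 (u (Num.truncn M).+1).
have := h l (l_in (Num.truncn M).+2); rewrite leNgt => /negP; apply.
apply: (le_lt_trans (hM m)).
have := truncnS_gt M => /lt_trans; apply; by rewrite ltr_nat.
Qed.

End uniform_boundedness.

Section growth_bound.
Context {R : realType} {V : normedModType R}.

(** If no bound held near 0, there would be times t_n tending to 0 with norms above n + 1, although
    each sequence S(t_n) x is bounded by right continuity at 0; uniform boundedness excludes this.
    Iterating the local bound gives the exponential one. *)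
Theorem semigroup_growth_bound (S : R -> {linear V -> V}) :
  geometric_complete V -> C0_semigroup S ->
  exists C om, [/\ 0 < C, 0 <= om &
    forall t x, 0 <= t -> `|S t x| <= C * expR (om * t) * `|x|].
Proof.
move=> cV [Sc S0 SD Sr].
have [e [C [e0 C1 hC]]] : exists e C : R, [/\ 0 < e, 1 <= C &
    forall t x, 0 <= t -> t <= e -> `|S t x| <= C * `|x|].
  apply: contrapT => H.
  have ex n : exists t, [/\ 0 <= t, t <= n.+1%:R^-1 & exists x, n.+1%:R * `|x| < `|S t x|].
    apply: contrapT => Hn; apply: H; exists n.+1%:R^-1, n.+1%:R; split => //.
      by rewrite ler1n.
    move=> t x t0 tn; rewrite leNgt; apply/negP => lt; apply: Hn.
    by exists t; split => //; exists x.
  pose t n := sval (cid (ex n)).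
  have tP n : [/\ 0 <= t n, t n <= n.+1%:R^-1 & exists x, n.+1%:R * `|x| < `|S (t n) x|].
    exact: (svalP (cid (ex n))).
  have [|x|C C0 hC] := @uniform_boundedness R V V (fun n => S (t n)) cV.
  - by move=> n; apply: Sc; case: (tP n).
  - have := Sr x => /cvgrPdist_le/(_ 1 ltr01)[r /= r0 hr].
    pose n0 := Num.truncn (r^-1).
    exists (\sum_(n < n0.+1) `|S (t n) x| + (`|x| + 1)) => n.
    have [nn0|n0n] := ltnP n n0.+1.
      rewrite (bigD1 (Ordinal nn0))//= -addrA lerDl addr_ge0//.
      by apply: sumr_ge0.
    rewrite ler_wpDl ?sumr_ge0//.
    have [t0 tn _] := tP n.
    have [->|tne] := eqVneq (t n) 0; first by rewrite S0 lerDl.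
    have : `|x - S (t n) x| <= 1.
      apply: hr; last by rewrite lt_neqAle eq_sym tne.
      rewrite /ball_/= sub0r normrN ger0_norm//; apply: (le_lt_trans tn).
      rewrite invf_plt ?posrE//; apply: (lt_trans (truncnS_gt _)).
      by rewrite ltr_nat ltnS.
    have := ler_normB x (x - S (t n) x); rewrite opprB addrC subrK.
    by move=> *; lra.
  have [_ _ [x hx]] := tP (Num.truncn C).
  have := hC (Num.truncn C) x; rewrite leNgt => /negP; apply.
  apply: le_lt_trans hx; rewrite ler_wpM2r//.
  by apply: ltW; exact: truncnS_gt.
have C0 : 0 < C by lra.
(* With t = m e + s, the bound C^(m+1) is C exp(m ln C) and m <= t/e; the choice 1 <= C makes the
   rate ln C / e nonnegative. *)
exists C, (ln C / e); split => //; first by rewrite divr_ge0 ?ln_ge0// ltW.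
have iter m s x : 0 <= s -> s <= e -> `|S (m%:R * e + s) x| <= C ^+ m.+1 * `|x|.
  elim: m s x => [|m IH] s x s0 se; first by rewrite mul0r add0r expr1; exact: hC.
  have me : 0 <= m%:R * e + s by rewrite addr_ge0// mulr_ge0// ltW.
  rewrite -natr1 mulrDl mul1r -addrA addrC -addrA (addrC s) SD//; last exact: ltW.
  apply: (le_trans (hC _ _ (ltW e0) (lexx _))).
  by rewrite exprS -mulrA ler_pM2l// IH.
move=> t x t0.
pose m := Num.truncn (t / e).
have te0 : 0 <= t / e by rewrite divr_ge0// ltW.
have /andP[h1 h2] := truncn_itv te0; rewrite -/m in h1 h2.
rewrite ler_pdivlMr// in h1; rewrite ltr_pdivrMr// -natr1 mulrDl mul1r in h2.
have := iter m (t - m%:R * e) x; rewrite addrCA subrr addr0.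
move=> /(_ (ltac:(by rewrite subr_ge0)) (ltac:(lra))) /le_trans; apply.
rewrite ler_wpM2r// exprS ler_pM2l//.
have -> : C ^+ m = expR (m%:R * ln C) by rewrite expRM_natl lnK ?posrE.
rewrite ler_expR mulrAC -mulrA mulrC ler_wpM2l ?ln_ge0//.
by rewrite ler_pdivlMr.
Qed.

End growth_bound.

(** * The space L2 *)

Section L2_elements.
Context {R : realType} (i : interval R) (V : normedModType R).
Notation mu := (@lebesgue_measure R).
Notation D := ([set` i] : set (measurableTypeR R)).
Implicit Types f g : R -> V.

Definition L2sq f : \bar R := (\int[mu]_(x in D) (`|f x| ^+ 2)%:E)%E.

Definition square_integrable f := strongly_measurable D f /\ (L2sq f < +oo)%E.

Lemma L2norm_funX f : (L2norm_fun i f `^ 2)%E = L2sq f.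
Proof.
have two : 2 != 0 :> R by rewrite gt_eqF.
rewrite /L2norm_fun poweR_Lnorm//.
rewrite /L2sq [RHS]integral_mkcond; apply: eq_integral => x _ /=.
rewrite !patchE; case: ifP => _; last by rewrite normr0 powR0// expr0n.
by rewrite normr_id -powR_mulrn.
Qed.

Lemma L2norm_fun_le f e : 0 <= e -> (L2norm_fun i f <= e%:E)%E <-> (L2sq f <= (e ^+ 2)%:E)%E.
Proof.
move=> e0; rewrite -L2norm_funX.
have : (0 <= L2norm_fun i f)%E by exact: Lnorm_ge0.
case: (L2norm_fun i f) => [r| |]//=; last first.
  by move=> _; rewrite (@gt_eqF _ _ 2)// !leye_eq.
rewrite !lee_fin => r0; rewrite powR_mulrn//.
by rewrite ler_pXn2r.
Qed.

Lemma L2norm_fun_lty f : (L2sq f < +oo)%E -> (L2norm_fun i f < +oo)%E.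
Proof.
rewrite -L2norm_funX; have : (0 <= L2norm_fun i f)%E by exact: Lnorm_ge0.
by case: (L2norm_fun i f) => [r| |]//= _; rewrite ?(@gt_eqF _ _ 2)// ?ltry.
Qed.

Lemma L2sq_lty f : (L2norm_fun i f < +oo)%E -> (L2sq f < +oo)%E.
Proof.
rewrite -L2norm_funX; have : (0 <= L2norm_fun i f)%E by exact: Lnorm_ge0.
by case: (L2norm_fun i f) => [r| |]//= _; rewrite ?(@gt_eqF _ _ 2)// ?ltry.
Qed.

(* The class of [f]; [0] when [f] is not square-integrable. *)
Definition L2of f : L2 i V :=
  if pselect (square_integrable f) is left fP
  then L2pi (MkL2fun fP.1 (L2norm_fun_lty fP.2)) else 0.

Lemma L2ofE f : square_integrable f -> L2repr (L2of f) = f %[ae mu in D].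
Proof. by rewrite /L2of => fP; case: pselect => // ?; exact: L2reprK. Qed.

Lemma square_integrable_repr (F : L2 i V) : square_integrable (L2repr F).
Proof. by split; [exact: L2fun_meas | exact/L2sq_lty/L2fun_fin]. Qed.

Lemma L2ofK (F : L2 i V) : L2of (L2repr F) = F.
Proof. by apply/L2_eq; apply: L2ofE; exact: square_integrable_repr. Qed.

Lemma L2sq_measurable f : strongly_measurable D f ->
  measurable_fun D (fun x => (`|f x| ^+ 2)%:E).
Proof.
move=> mf; apply/measurable_EFinP; apply: measurable_funX.
exact: (strongly_measurable_measurable (@norm_continuous _ _) mf).
Qed.

Lemma L2sq_ae f g : strongly_measurable D f -> strongly_measurable D g ->
  f = g %[ae mu in D] -> L2sq f = L2sq g.
Proof.
move=> mf mg fg; apply: ge0_ae_eq_integral.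
- exact: measurable_itv.
- exact: L2sq_measurable.
- exact: L2sq_measurable.
- by move=> x _; rewrite lee_fin sqr_ge0.
- by move=> x _; rewrite lee_fin sqr_ge0.
- by apply: filterS fg => x h Dx; rewrite h.
Qed.

Lemma L2norm_leP (F : L2 i V) e : 0 <= e ->
  (`|F| <= e) <-> (L2sq (L2repr F) <= (e ^+ 2)%:E)%E.
Proof.
move=> e0; rewrite -L2norm_fun_le//.
have fin : L2norm_fun i (L2repr F) \is a fin_num.
  by rewrite ge0_fin_numE ?L2fun_fin// Lnorm_ge0.
by rewrite -(fineK fin) lee_fin.
Qed.

Lemma square_integrableD f g : square_integrable f -> square_integrable g ->
  square_integrable (fun x => f x + g x).
Proof.
move=> [mf ff] [mg fg]; split; first exact: strongly_measurableD.
apply: L2sq_lty; apply: le_lt_trans (L2norm_funD mf mg) _.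
by rewrite lte_add_pinfty// L2norm_fun_lty.
Qed.

Lemma square_integrableZ a f : square_integrable f ->
  square_integrable (fun x => a *: f x).
Proof.
move=> [mf ff]; split; first exact: strongly_measurableZ.
apply: L2sq_lty; rewrite L2norm_funZ ?L2norm_fun_lty//.
by rewrite lte_mul_pinfty// ?lee_fin// L2norm_fun_lty.
Qed.

Lemma square_integrableB f g : square_integrable f -> square_integrable g ->
  square_integrable (fun x => f x - g x).
Proof.
move=> sf sg; have := square_integrableD sf (square_integrableZ (-1) sg).
by congr square_integrable; apply/funext => x; rewrite scaleN1r.
Qed.

Lemma L2ofD f g : square_integrable f -> square_integrable g ->
  L2of (fun x => f x + g x) = L2of f + L2of g.
Proof.
move=> sf sg; apply/L2_eq; near=> x => Dx.
rewrite (near (L2ofE (square_integrableD sf sg)) x)//.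
rewrite (near (L2addE (L2of f) (L2of g)) x)//.
by rewrite (near (L2ofE sf) x)// (near (L2ofE sg) x).
Unshelve. all: by end_near. Qed.

Lemma L2ofZ a f : square_integrable f -> L2of (fun x => a *: f x) = a *: L2of f.
Proof.
move=> sf; apply/L2_eq; near=> x => Dx.
rewrite (near (L2ofE (square_integrableZ a sf)) x)//.
by rewrite (near (L2scaleE a (L2of f)) x)// (near (L2ofE sf) x).
Unshelve. all: by end_near. Qed.

Lemma L2ofB f g : square_integrable f -> square_integrable g ->
  L2of (fun x => f x - g x) = L2of f - L2of g.
Proof.
move=> sf sg; rewrite -[- L2of g]scaleN1r -L2ofZ// -L2ofD//; last exact: square_integrableZ.
by congr L2of; apply/funext => x; rewrite scaleN1r.
Qed.

Lemma L2of_norm_le f e : 0 <= e -> square_integrable f ->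
  (`|L2of f| <= e) <-> (L2sq f <= (e ^+ 2)%:E)%E.
Proof.
move=> e0 sf; rewrite L2norm_leP//.
rewrite (L2sq_ae (square_integrable_repr (L2of f)).1 sf.1)//.
exact: L2ofE.
Qed.

Lemma L2dist_le (F : L2 i V) f e : 0 <= e -> square_integrable f ->
  (`|F - L2of f| <= e) <-> (L2sq (fun x => L2repr F x - f x)%R <= (e ^+ 2)%:E)%E.
Proof.
move=> e0 sf; have sF := square_integrable_repr F.
by rewrite -{1}(L2ofK F) -L2ofB// L2of_norm_le//; exact: square_integrableB.
Qed.

Hypothesis finD : (mu D < +oo)%E.

Lemma bounded_square_integrable f M : strongly_measurable D f ->
  (forall x, D x -> `|f x| <= M) -> square_integrable f.
Proof.
move=> mf fM; split => //.
apply: (@le_lt_trans _ _ (\int[mu]_(x in D) (M ^+ 2)%:E)%E).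
  apply: ge0_le_integral.
  - exact: measurable_itv.
  - by move=> x _; rewrite lee_fin sqr_ge0.
  - exact: L2sq_measurable.
  - exact: measurable_cst.
  - move=> x Dx; rewrite lee_fin lerXn2r ?nnegrE ?fM//.
    by apply: le_trans (fM x Dx).
rewrite integral_cst; last exact: measurable_itv.
by rewrite lte_mul_pinfty// lee_fin sqr_ge0.
Qed.

Lemma simple_square_integrable (s : seq (set (measurableTypeR R) * V)) :
  (forall p, p \in s -> measurable p.1) -> square_integrable (simple_eval s).
Proof.
move=> ms; apply: (@bounded_square_integrable _ (\sum_(p <- s) `|p.2|)).
  by exists (fun=> s); split=> [k|x _]; [exact: ms|exact: cvg_cst].
move=> x _; apply: le_trans (ler_norm_sum _ _ _) _; apply: ler_sum => p _.
rewrite normrZ indicE; case: (x \in p.1); first by rewrite normr1 mul1r.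
by rewrite normr0 mul0r.
Qed.

(** Kept as a list of pairs, so that the delay term, differentiation and membership in a subspace
    can be treated coefficient by coefficient. *)
Definition tensor (l : seq ((R -> R) * V)) (x : R) : V := \sum_(p <- l) p.1 x *: p.2.

End L2_elements.

(** * Approximation by simple and by continuous functions *)

Section L2_approximation.
Context {R : realType} (i : interval R) (K : hilbertType R).
Notation mu := (@lebesgue_measure R).
Notation D := ([set` i] : set (measurableTypeR R)).
Hypothesis finD : (mu D < +oo)%E.

Let mD : measurable D. Proof. exact: measurable_itv. Qed.

(** Projection onto [W] is linear and 1-Lipschitz and fixes the values of [F] almost everywhere, so
    projecting the vectors of the simple functions brings these no farther from [F]. *)
Lemma simple_approximation (W : set K) (F : L2 i K) (e : R) :
  W 0 -> (forall x y, W x -> W y -> W (x + y)) -> (forall a x, W x -> W (a *: x)) ->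
  closed W -> {ae mu, forall x, D x -> W (L2repr F x)} -> 0 < e ->
  exists s : seq (set (measurableTypeR R) * K),
    (forall p, p \in s -> [/\ measurable p.1, p.1 `<=` D & W p.2]) /\
    `|F - L2of i (simple_eval s)| <= e.
Proof.
move=> W0 WD WZ clW FW e0.
have [mF fF] := square_integrable_repr F.
have [s [ms sF sle]] := dominated_approximation mD mF.
pose pr := orthproj W0 WD WZ clW.
have prl : linear pr by move=> a x y; exact: orthproj_linear.
have prB x y : pr (x - y) = pr x - pr y.
  by rewrite addrC -scaleN1r prl scaleN1r addrC.
pose t k := [seq (p.1, pr p.2) | p <- s k].
have tE k x : simple_eval (t k) x = pr (simple_eval (s k) x).
  rewrite /simple_eval big_map.
  elim: (s k) => [|p l IH].
    by rewrite !big_nil; have := prB 0 0; rewrite !subrr.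
  by rewrite !big_cons IH prl.
have mt k p : p \in t k -> [/\ measurable p.1, p.1 `<=` D & W p.2].
  by move=> /mapP[q /ms[mq qD] ->]; split => //=; have [] := orthprojP W0 WD WZ clW q.2.
have sqt k : square_integrable i (simple_eval (t k)).
  by apply: simple_square_integrable => // p /mt[].
have tle k x : D x -> W (L2repr F x) -> `|L2repr F x - simple_eval (t k) x| <= `|L2repr F x - simple_eval (s k) x|.
  move=> Dx WF; rewrite tE -{1}(orthproj_id W0 WD WZ clW WF) -prB; exact: orthproj_le.
have dc : (\int[mu]_(x in D) (`|L2repr F x - simple_eval (t k) x| ^+ 2)%:E)%E @[k --> \oo] --> 0%E.
  (* 9 = 3^2, from |F - s_k| <= |F| + 2|F|. *)
  have i9 : mu.-integrable D (fun x => (9 * `|L2repr F x| ^+ 2)%:E).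
    have i1 : mu.-integrable D (fun x => (`|L2repr F x| ^+ 2)%:E).
      apply/integrableP; split; first exact: L2sq_measurable.
      by under eq_integral do rewrite gee0_abs ?lee_fin ?sqr_ge0//.
    exact: (integrableZl mD 9 i1).
  have := @dominated_convergence _ _ _ mu D mD
    (fun k x => (`|L2repr F x - simple_eval (t k) x| ^+ 2)%:E) (cst 0%E)
    (fun x => (9 * `|L2repr F x| ^+ 2)%:E).
  case=> //.
  - move=> k; apply: L2sq_measurable.
    by have [] := square_integrableB (square_integrable_repr F) (sqt k).
  - apply: filterS FW => x WF Dx; apply: cvg_EFin; first exact: nearW.
    apply: (@squeeze_cvgr _ _ _ _ (cst 0) (fun k => `|L2repr F x - simple_eval (s k) x| ^+ 2)).
    + apply: nearW => k; rewrite sqr_ge0/= lerXn2r ?nnegrE// tle//; exact: WF.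
    + exact: cvg_cst.
    + have : `|L2repr F x - simple_eval (s k) x| @[k --> \oo] --> `|L2repr F x - L2repr F x|.
        by apply: cvg_norm; apply: cvgB; [exact: cvg_cst | exact: sF].
      rewrite subrr normr0 => h; have h2 := cvgM h h; rewrite mulr0 in h2.
      by under eq_fun do rewrite expr2; exact: h2.
  - apply: filterS FW => x WF k Dx; rewrite lee_fin ger0_norm ?sqr_ge0//.
    have h1 := tle k x Dx (WF Dx).
    have h2 := ler_normB (L2repr F x) (simple_eval (s k) x).
    have h3 := sle k x Dx.
    have -> : 9 * `|L2repr F x| ^+ 2 = (3 * `|L2repr F x|) ^+ 2 by ring.
    rewrite lerXn2r ?nnegrE ?mulr_ge0//.
    by move: h1 h2 h3; move: `|_| `|_| `|_| `|_| => a b c d *; lra.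
  by move=> _ _; rewrite integral0.
move/fine_cvgP : dc => -[fin /cvgr0_norm_le/(_ (e ^+ 2))].
rewrite exprn_gt0// => /(_ isT) small.
have [k [kfin kle]] : exists k, (\int[mu]_(x in D) (`|L2repr F x - simple_eval (t k) x| ^+ 2)%:E)%E \is a fin_num
   /\ `|fine (\int[mu]_(x in D) (`|L2repr F x - simple_eval (t k) x| ^+ 2)%:E)%E| <= e ^+ 2.
  near \oo => k; exists k; split; near: k; [exact: fin | exact: small].
exists (t k); split; first exact: mt.
apply/L2dist_le => //; first exact: ltW.
rewrite -[leLHS](fineK kfin) lee_fin; apply: le_trans kle; exact: ler_norm.
Unshelve. all: by end_near. Qed.

(** Clipping an L1 approximation to [0, 1] does not increase the distance to an indicator and makes
    it at most 1, so its square is bounded by the L1 integrand. *)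
Lemma indic_continuous_approximation (A : set (measurableTypeR R)) (e : R) :
  measurable A -> A `<=` D -> 0 < e ->
  exists2 c : R -> R, continuous c &
    (\int[mu]_(x in D) ((\1_A x - c x) ^+ 2)%:E <= e%:E)%E.
Proof.
move=> mA AD e0.
have iA : mu.-integrable D (EFin \o \1_A).
  apply/integrableP; split.
    by apply/measurable_EFinP; exact: measurable_funTS.
  under eq_integral do rewrite /= ger0_norm//.
  rewrite integral_indic// (setIidl AD); apply: le_lt_trans finD.
  by apply: le_measure => //; rewrite inE.
have [g [cg ig gA]] := approximation_continuous_integrable mD finD iA.
move/fine_cvgP : gA => -[fin /cvgr0_norm_le/(_ e e0)] small.
have [k [kfin kle]] : exists k, (\int[mu]_(x in D) `|(\1_A x - g k x)%:E|)%E \is a fin_num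
   /\ `|fine (\int[mu]_(x in D) `|(\1_A x - g k x)%:E|)%E| <= e.
  near \oo => k; exists k; split; near: k; [exact: fin | exact: small].
pose c x := Num.max 0 (Num.min 1 (g k x)).
have cc : continuous c.
  move=> x; apply: (@continuous_max _ _ (cst 0) (fun x => Num.min 1 (g k x))).
    exact: cst_continuous.
  by apply: (@continuous_min _ _ (cst 1) (g k)); [exact: cst_continuous | exact: cg].
exists c => //.
apply: (@le_trans _ _ (\int[mu]_(x in D) `|(\1_A x - g k x)%:E|)%E); last first.
  by rewrite -[leLHS](fineK kfin) lee_fin; apply: le_trans kle; exact: ler_norm.
have mc : measurable_fun D c by apply: measurable_funTS; exact: continuous_measurable_fun.
have mg : measurable_fun D (g k) by apply: measurable_funTS; exact: continuous_measurable_fun.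
have mI : measurable_fun D (\1_A : measurableTypeR R -> R) by exact: measurable_funTS.
apply: ge0_le_integral => //.
- by move=> x _; rewrite lee_fin sqr_ge0.
- by apply/measurable_EFinP; apply: measurable_funX; exact: measurable_funB.
- by apply/measurable_EFinP; apply: measurableT_comp => //; exact: measurable_funB.
- move=> x Dx /=; rewrite lee_fin /c indicE.
  case: (x \in A); rewrite /= ?mulr1n ?mulr0n.
    case: (leP 1 (g k x)) => h1.
      by rewrite (max_idPr ler01) expr2 subrr mul0r.
    case: (leP 0 (g k x)) => h0; first by rewrite ger0_norm; nra.
    by rewrite subr0 expr1n ger0_norm; lra.
  rewrite !sub0r normrN sqrrN.
  case: (leP 1 (g k x)) => h1.
    by rewrite (max_idPr ler01) expr1n ger0_norm//; lra.
  by case: (leP 0 (g k x)) => h0; [rewrite ger0_norm//; nra | rewrite expr2 mul0r].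
Unshelve. all: by end_near. Qed.

End L2_approximation.

Section geometric_sequences.
Context {R : realType}.

Lemma dist_half (V : normedModType R) (x y z : V) (e : R) :
  `|x - y| <= e / 2 -> `|y - z| <= e / 2 -> `|x - z| <= e.
Proof. by move=> xy yz; rewrite (le_trans (ler_distD y _ _))// [leRHS]splitr lerD. Qed.

Lemma geometric_tail (V : normedModType R) (y : nat -> V) (C q : R) : 0 < q -> q < 1 ->
  (forall n, `|y n.+1 - y n| <= C * q ^+ n) ->
  forall n m, (n <= m)%N -> `|y m - y n| <= C / (1 - q) * q ^+ n.
Proof.
move=> q0 q1 h.
have C0 : 0 <= C by have := h 0%N; rewrite expr0 mulr1; apply: le_trans.
have d0 : 0 < 1 - q by rewrite subr_gt0.
suff H n j : `|y (j + n)%N - y n| <= C / (1 - q) * (q ^+ n - q ^+ (j + n)).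
  move=> n m nm; have := H n (m - n)%N; rewrite subnK// => /le_trans; apply.
  rewrite ler_wpM2l ?divr_ge0// ?ltW//.
  by have := exprn_gt0 m q0; lra.
elim: j => [|j IH]; first by rewrite add0n !subrr normr0 mulr0.
have := ler_normD (y (j + n).+1 - y (j + n)%N) (y (j + n)%N - y n).
rewrite addrA subrK addSn => /le_trans; apply.
apply: le_trans (lerD (h _) IH) _; rewrite exprS.
have -> : C * q ^+ (j + n) = C / (1 - q) * (q ^+ (j + n) - q * q ^+ (j + n)).
  by rewrite -{2}(mul1r (q ^+ (j + n))) -mulrBl mulrA divfK// gt_eqF.
rewrite -mulrDr (_ : q ^+ (j + n) - q * q ^+ (j + n) + (q ^+ n - q ^+ (j + n)) =
  q ^+ n - q * q ^+ (j + n)) //; ring.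
Qed.

Lemma geometric_cvg (K : hilbertType R) (y : nat -> K) (C q : R) : 0 < q -> q < 1 ->
  (forall n, `|y n.+1 - y n| <= C * q ^+ n) -> exists l : K, y n @[n --> \oo] --> l.
Proof.
move=> q0 q1 h; apply: hilbert_cauchy_cvg => e e0.
have q' : `|q| < 1 by rewrite gtr0_norm.
have := @cvg_geometric R (C / (1 - q)) q q'.
move=> /cvgr0_norm_le/(_ e e0); apply: filterS => n /= hn m nm.
rewrite distrC; apply: le_trans (geometric_tail q0 q1 h nm) _.
by apply: le_trans hn; exact: ler_norm.
Qed.

Lemma hilbert_geometric_complete (K : hilbertType R) : geometric_complete K.
Proof. by move=> x c h; apply: (@geometric_cvg K x c 3^-1) => //; lra. Qed.

Lemma prod_geometric_complete (U V : normedModType R) :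
  geometric_complete U -> geometric_complete V -> geometric_complete (U * V)%type.
Proof.
move=> cU cV x c h.
have [u xu] : exists u : U, (x n).1 @[n --> \oo] --> u.
  apply: (cU _ c) => n; apply: le_trans (h n).
  by rewrite [leRHS]prod_normE /= le_max lexx.
have [v xv] : exists v : V, (x n).2 @[n --> \oo] --> v.
  apply: (cV _ c) => n; apply: le_trans (h n).
  by rewrite [leRHS]prod_normE /= le_max lexx orbT.
exists (u, v); rewrite (_ : x = (fun n => ((x n).1, (x n).2))).
  exact: cvg_pair.
by apply/funext => n; case: (x n).
Qed.

End geometric_sequences.

(** * Completeness of L2 for geometric sequences *)

Section L2_complete.
Context {R : realType} (i : interval R) (K : hilbertType R).
Notation mu := (@lebesgue_measure R).
Notation D := ([set` i] : set (measurableTypeR R)).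
Hypothesis finD : (mu D < +oo)%E.

Let mD : measurable D. Proof. exact: measurable_itv. Qed.

Lemma L2of_ae (f g : R -> K) : square_integrable i f -> square_integrable i g ->
  f = g %[ae mu in D] -> L2of i f = L2of i g.
Proof.
move=> sf sg fg; apply/L2_eq; near=> x => Dx.
by rewrite (near (L2ofE sf) x)// (near (L2ofE sg) x)// (near fg x).
Unshelve. all: by end_near. Qed.

Let third : [/\ (0 : R) < 3^-1, (3^-1 : R) < 1, `|3^-1 : R| < 1 & (0 : R) <= 1 - 3^-1].
Proof. by split; rewrite ?ger0_norm; lra. Qed.

Let expr3_le n : (3^-1 : R) ^+ n.+1 <= 3^-1 ^+ n.
Proof. by rewrite exprS; have : 0 < 3^-1 ^+ n :> R; [rewrite exprn_gt0 | lra]. Qed.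

Let half_sum n : \sum_(0 <= k < n) 2^-1 ^+ k <= 2 :> R.
Proof.
have : \sum_(0 <= k < n) 2^-1 ^+ k <= 2 - 2 * 2^-1 ^+ n :> R.
  elim: n => [|n IH]; first by rewrite big_geq// expr0; lra.
  by rewrite big_nat_recr//= exprS; lra.
by have : 0 < 2^-1 ^+ n :> R; [rewrite exprn_gt0|lra].
Qed.

Let half : (0 : R) < 2^-1 /\ (2^-1 : R) < 1.
Proof. by split; lra. Qed.

Let weight_le n : (4 : R) ^+ n * (3^-1 ^+ n) ^+ 2 <= 2^-1 ^+ n.
Proof.
rewrite -exprM mulnC exprM -exprMn lerXn2r ?nnegrE//; lra.
Qed.

Let three_le (p q c a1 a2 a3 : R) : a1 <= q -> a2 <= c * p -> a3 <= p -> q <= p ->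
  a1 + (a2 + a3) <= (c + 2) * p.
Proof. lra. Qed.

Lemma limn_einf_le (u : nat -> \bar R) (M : \bar R) n : (forall m, (n <= m)%N -> (u m <= M)%E) ->
  (limn_einf u <= M)%E.
Proof.
move=> h; rewrite limn_einf_lim; apply: lime_le; first exact: is_cvg_einfs.
exists n => // m /= nm; apply: le_trans (h m nm).
by apply: ereal_inf_lbound; exists m => //=.
Qed.

(* Simple functions approximating a fast Cauchy sequence converge almost
   everywhere; their limit is strongly measurable because, off a null set, it is
   by construction a limit of simple functions. *)
Theorem L2_geometric_complete : geometric_complete (L2 i K).
Proof.
move=> x c hx.
have c0 : 0 <= c by have := hx 0%N; rewrite expr0 mulr1; apply: le_trans.
have t0 n : 0 < 3^-1 ^+ n :> R by rewrite exprn_gt0.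
have ex n : exists s : seq (set (measurableTypeR R) * K),
    (forall p, p \in s -> [/\ measurable p.1, p.1 `<=` D & setT p.2]) /\
    `|x n - L2of i (simple_eval s)| <= 3^-1 ^+ n.
  apply: simple_approximation => //; try exact: closedT.
  by apply: aeW.
pose s n := sval (cid (ex n)).
have [ms xs] : (forall n p, p \in s n -> measurable p.1) /\
    forall n, `|x n - L2of i (simple_eval (s n))| <= 3^-1 ^+ n.
  by split=> n; have [h1 h2] := svalP (cid (ex n)) => // p /h1[].
pose f n := simple_eval (s n).
have sf n : square_integrable i (f n) by apply: simple_square_integrable => //; exact: ms.
pose C := c + 2.
have C0 : 0 <= C by rewrite addr_ge0.
have df n : `|L2of i (f n.+1) - L2of i (f n)| <= C * 3^-1 ^+ n.
  have h1 := hx n; have h2 := xs n; have h3 := xs n.+1.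
  rewrite distrC in h3.
  apply: le_trans (ler_distD (x n.+1) _ _) _.
  apply: le_trans (lerD (lexx _) (ler_distD (x n) _ _)) _.
  exact: three_le h3 h1 h2 (expr3_le n).
pose g n y := `|f n.+1 y - f n y|.
have mg n : measurable_fun D (g n).
  exact: (strongly_measurable_measurable (@norm_continuous _ _) (square_integrableB (sf n.+1) (sf n)).1).
have ig n : (\int[mu]_(y in D) ((4 ^+ n * g n y ^+ 2)%:E) <= (C ^+ 2 * 2^-1 ^+ n)%:E)%E.
  under eq_integral do rewrite EFinM.
  rewrite ge0_integralZl//; last 2 first.
  - by apply/measurable_EFinP; apply: measurable_funX.
  - by move=> y _; rewrite lee_fin sqr_ge0.
  have h : (L2sq i (fun y => f n.+1 y - f n y)%R <= ((C * 3^-1 ^+ n) ^+ 2)%:E)%E.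
    apply/L2of_norm_le; [by rewrite mulr_ge0// ltW | exact: square_integrableB |].
    by rewrite L2ofB.
  have p0 : (0 <= (4 ^+ n)%:E :> \bar R)%E by rewrite lee_fin exprn_ge0.
  apply: le_trans (lee_wpmul2l p0 h) _.
  by rewrite -EFinM lee_fin exprMn mulrCA ler_wpM2l ?sqr_ge0 ?weight_le.
(* The integrals of the squared gaps are at most C^2 9^-n, so with the weight 4^n they remain
   summable. Where [G] is finite, a gap is at most sqrt(G) 2^-n, which gives pointwise
   convergence. *)
pose G y := (\sum_(n <oo) ((4 ^+ n * g n y ^+ 2)%:E))%E.
have term0 n y : (0 <= (4 ^+ n * g n y ^+ 2)%:E :> \bar R)%E.
  by rewrite lee_fin; apply: mulr_ge0; [exact: exprn_ge0 | exact: sqr_ge0].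
have mterm n : measurable_fun D (fun y => (4 ^+ n * g n y ^+ 2)%:E).
  by apply/measurable_EFinP; apply: measurable_funM => //; exact: measurable_funX.
have intG : mu.-integrable D G.
  apply/integrableP; split.
    exact: ge0_emeasurable_sum.
  under eq_integral do rewrite gee0_abs ?nneseries_ge0//.
  rewrite integral_nneseries//.
  apply: (@le_lt_trans _ _ (C ^+ 2 * 2)%:E); last exact: ltry.
  apply: lime_le; first by apply: is_cvg_nneseries => n _ _; apply: integral_ge0 => y _.
  apply: nearW => n.
  apply: (@le_trans _ _ (\sum_(0 <= k < n) (C ^+ 2 * 2^-1 ^+ k)%:E)%E).
    by apply: lee_sum => k _; exact: ig.
  by rewrite sumEFin lee_fin -mulr_sumr ler_wpM2l ?sqr_ge0 ?half_sum.
have [A [mA A0 sA]] := integrable_ae mD intG.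
pose E := D `\` A.
have mE : measurable E by exact: measurableD.
have finG y : E y -> G y \is a fin_num.
  by move=> [Dy nAy]; apply: contrapT => h; apply: nAy; apply: sA => /= /(_ Dy).
(* Cut down to the good set [E], the simple functions converge at every point of [D], as
   [strongly_measurable] demands, and their classes in L2 do not change. *)
pose s' n := [seq (p.1 `&` E, p.2) | p <- s n].
pose f' n := simple_eval (s' n).
have f'E n y : f' n y = \1_E y *: f n y.
  rewrite /f' /f /simple_eval big_map scaler_sumr; apply: eq_bigr => p _ /=.
  by rewrite indicI/= scalerA mulrC.
have ms' n p : p \in s' n -> measurable p.1.
  by move=> /mapP[q /ms mq ->]; exact: measurableI.
have sf' n : square_integrable i (f' n) by apply: simple_square_integrable => //; exact: ms'.
have cf' y : exists l : K, f' n y @[n --> \oo] --> l.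
  have [Ey|nEy] := pselect (E y); last first.
    exists 0; rewrite (_ : (fun n => _) = cst 0); first exact: cvg_cst.
    by apply/funext => n; rewrite f'E indicE memNset// scale0r.
  have GE := fineK (finG y Ey).
  apply: (@geometric_cvg R K _ (Num.sqrt (fine (G y))) 2^-1); [by case: half | by case: half |].
  move=> n; rewrite !f'E indicE mem_set// !scale1r.
  have : ((4 ^+ n * g n y ^+ 2)%:E <= (fine (G y))%:E)%E.
    rewrite GE; apply: le_trans (nneseries_lim_ge n.+1 _) => //.
    by rewrite big_nat_recr//= leeDr// sume_ge0.
  rewrite lee_fin => h.
  have G0 : 0 <= fine (G y).
    by apply: le_trans h; apply: mulr_ge0; [exact: exprn_ge0 | exact: sqr_ge0].
  rewrite -(@ler_pXn2r _ 2) ?nnegrE ?mulr_ge0 ?sqrtr_ge0 ?exprn_ge0//.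
  rewrite exprMn sqr_sqrtr// -exprM mulnC exprM.
  have -> : (2^-1 : R) ^+ 2 = 4^-1 by field.
  rewrite exprVn ler_pdivlMr ?exprn_gt0// mulrC.
  exact: h.
pose F y := lim (f' n y @[n --> \oo]).
have F_ y : f' n y @[n --> \oo] --> F y.
  by have [l fl] := cf' y; rewrite /F (cvg_lim _ fl).
have mF : strongly_measurable D F by exists s'; split=> // y _; exact: F_.
have f'f n : L2of i (f' n) = L2of i (f n).
  apply: L2of_ae => //; exists A; split => // y /= h; apply: contrapT => nAy; apply: h => Dy.
  by rewrite f'E indicE mem_set ?scale1r.
(* Fatou turns the bound on the tails into a bound for the limit; the case n = 0 also yields its
   square integrability. *)
have dist n : (L2sq i (fun y => F y - f' n y)%R <= ((C / (1 - 3^-1) * 3^-1 ^+ n) ^+ 2)%:E)%E.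
  have -> : L2sq i (fun y => F y - f' n y)%R =
      (\int[mu]_(y in D) limn_einf (fun m => (`|f' m y - f' n y| ^+ 2)%:E))%E.
    apply: eq_integral => y _; apply/esym.
    have h : `|f' m y - f' n y| @[m --> \oo] --> `|F y - f' n y|.
      by apply: cvg_norm; apply: cvgB; [exact: F_ | exact: cvg_cst].
    have h2 : (`|f' m y - f' n y| ^+ 2)%:E @[m --> \oo] --> (`|F y - f' n y| ^+ 2)%:E.
      apply: cvg_EFin; first exact: nearW.
      rewrite (_ : _ \o _ = (fun m => `|f' m y - f' n y| * `|f' m y - f' n y|)).
        by rewrite expr2; exact: (cvgM h h).
      by apply/funext => m /=; rewrite expr2.
    by rewrite is_cvg_limn_einfE ?(cvg_lim _ h2)//; apply/cvg_ex; eexists; exact: h2.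
  apply: le_trans (fatou mu mD _ _) _.
  - by move=> m; apply: L2sq_measurable; have [] := square_integrableB (sf' m) (sf' n).
  - by move=> m y _; rewrite lee_fin sqr_ge0.
  apply: (@limn_einf_le _ _ n) => m nm.
  have q0 : 0 <= C / (1 - 3^-1) * 3^-1 ^+ n.
    by rewrite mulr_ge0 ?exprn_ge0// divr_ge0//; case: third.
  apply/(L2of_norm_le q0 (square_integrableB (sf' m) (sf' n))).
  rewrite L2ofB// !f'f.
  by apply: (@geometric_tail R _ (fun n => L2of i (f n)) C 3^-1) => //; case: third.
have sF : square_integrable i F.
  have h : square_integrable i (fun y => F y - f' 0%N y).
    split; last by apply: le_lt_trans (dist 0%N) _; exact: ltry.
    have := strongly_measurableD mF (strongly_measurableZ (-1) (sf' 0%N).1).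
    by congr (strongly_measurable D); apply/funext => y; rewrite scaleN1r.
  have := square_integrableD h (sf' 0%N); congr square_integrable.
  by apply/funext => y; rewrite subrK.
exists (L2of i F); apply/cvgrPdist_le => e e0.
have q' : `|3^-1 : R| < 1 by case: third.
have := @cvg_geometric R (C / (1 - 3^-1) + 1) 3^-1 q'.
move=> /cvgr0_norm_le/(_ e e0); apply: filterS => n /= /(le_trans (ler_norm _)) hn.
have q0 : 0 <= C / (1 - 3^-1) * 3^-1 ^+ n.
  by rewrite mulr_ge0 ?exprn_ge0// divr_ge0//; case: third.
have h1 : `|L2of i F - L2of i (f' n)| <= C / (1 - 3^-1) * 3^-1 ^+ n.
  rewrite -L2ofB//; apply/L2of_norm_le => //; exact: square_integrableB.
have h2 := xs n; rewrite -/(f n) -f'f in h2.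
rewrite distrC in h2.
apply: le_trans (ler_distD (L2of i (f' n)) _ _) _; apply: le_trans hn.
by rewrite mulrDl mul1r lerD.
Qed.

End L2_complete.

(** * Tensors with continuous coefficients *)

Section tensors.
Context {R : realType} (a b : R) (ab : a < b) (K : hilbertType R).
Notation mu := (@lebesgue_measure R).
Notation i := `]a, b[.
Notation D := ([set` i] : set (measurableTypeR R)).

Lemma lebesgue_itv_fin : (mu D < +oo)%E.
Proof. by rewrite lebesgue_measure_itv/= lte_fin ab -EFinD ltry. Qed.

Lemma continuous_bounded_itv (c : R -> R) : continuous c ->
  exists M, forall x, a <= x <= b -> `|c x| <= M.
Proof.
move=> cc; have [|m _ hm] := @EVT_max R (fun x => `|c x|) a b (ltW ab).
  by apply: continuous_subspaceT => x; apply: cvg_norm; exact: cc.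
by exists `|c m| => x xab; apply: hm; rewrite in_itv.
Qed.

Definition continuous_tensor (l : seq ((R -> R) * K)) :=
  forall p, p \in l -> continuous p.1.

Lemma tensor_cons p (l : seq ((R -> R) * K)) x : tensor (p :: l) x = p.1 x *: p.2 + tensor l x.
Proof. by rewrite /tensor big_cons. Qed.

Lemma square_integrable_scale (c : R -> R) (v : K) : continuous c ->
  square_integrable i (fun x => c x *: v).
Proof.
move=> cc; have [M hM] := continuous_bounded_itv cc.
apply: (@bounded_square_integrable _ _ _ lebesgue_itv_fin _ (M * `|v|)).
  apply: strongly_measurable_scale; first exact: measurable_itv.
    by apply: measurable_funTS; exact: continuous_measurable_fun.
  exact: strongly_measurable_cst.
move=> x; rewrite /= in_itv/= => /andP[/ltW ax /ltW xb].
by rewrite normrZ ler_wpM2r// hM// ax.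
Qed.

Lemma square_integrable_tensor l : continuous_tensor l -> square_integrable i (tensor l).
Proof.
elim: l => [|p l IH] cl.
  have -> : tensor [::] = fun x => (cst (0 : R)) x *: (0 : K).
    by apply/funext => x; rewrite /tensor big_nil scaler0.
  by apply: square_integrable_scale; exact: cst_continuous.
have -> : tensor (p :: l) = fun x => p.1 x *: p.2 + tensor l x.
  by apply/funext => x; rewrite tensor_cons.
apply: square_integrableD; first by apply: square_integrable_scale; apply: cl; rewrite mem_head.
by apply: IH => q ql; apply: cl; rewrite in_cons ql orbT.
Qed.

Lemma L2of_tensor_cons p l : continuous_tensor (p :: l) ->
  L2of i (tensor (p :: l)) = L2of i (fun x => p.1 x *: p.2) + L2of i (tensor l).
Proof.
move=> cl; rewrite -L2ofD.
- by congr L2of; apply/funext => x; rewrite tensor_cons.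
- by apply: square_integrable_scale; apply: cl; rewrite mem_head.
- by apply: square_integrable_tensor => q ql; apply: cl; rewrite in_cons ql orbT.
Qed.

Lemma L2sq_scale (c : R -> R) (v : K) : measurable_fun D c ->
  L2sq i (fun x => c x *: v) = ((`|v| ^+ 2)%:E * \int[mu]_(x in D) ((c x) ^+ 2)%:E)%E.
Proof.
move=> mc; rewrite -ge0_integralZl//; last 2 first.
- by apply/measurable_EFinP; exact: measurable_funX.
- by move=> x _; rewrite lee_fin sqr_ge0.
apply: eq_integral => x _; rewrite normrZ exprMn real_normK ?num_real// mulrC.
by rewrite EFinM.
Qed.

(** A simple function with vectors in [W] is smoothed only in its scalar indicators, so the vectors
    stay in [W]. *)
Lemma tensor_dense (W : set K) (F : L2 i K) (e : R) :
  W 0 -> (forall x y, W x -> W y -> W (x + y)) -> (forall a x, W x -> W (a *: x)) ->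
  closed W -> {ae mu, forall x, D x -> W (L2repr F x)} -> 0 < e ->
  exists l, [/\ continuous_tensor l, (forall p, p \in l -> W p.2) &
    `|F - L2of i (tensor l)| <= e].
Proof.
move=> W0 WD WZ clW FW e0.
have e2 : 0 < e / 2 by rewrite divr_gt0.
have [s [ms Fs]] := simple_approximation lebesgue_itv_fin W0 WD WZ clW FW e2.
suff [l [cl lW sl]] : exists l, [/\ continuous_tensor l, (forall p, p \in l -> W p.2) &
    `|L2of i (simple_eval s) - L2of i (tensor l)| <= e / 2].
  exists l; split => //.
  exact: (dist_half Fs sl).
move: (e / 2) e2 => {e e0 Fs} e e0.
elim: s ms e e0 => [|p s IH] ms e e0.
  exists [::]; split => //.
  rewrite [X in `|X - _|](_ : _ = L2of i (tensor [::])); first by rewrite subrr normr0 ltW.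
  by congr L2of; apply/funext => x; rewrite /simple_eval /tensor !big_nil.
have e2 : 0 < e / 2 by rewrite divr_gt0.
have [|l [cl lW sl]] := IH _ (e / 2) e2.
  by move=> q qs; apply: ms; rewrite in_cons qs orbT.
have [mp pD Wp] := ms p (mem_head _ _).
have v0 : 0 < `|p.2| ^+ 2 + 1 by rewrite ltr_wpDl// sqr_ge0.
(* Multiplied by |p.2|^2 this stays below (e/2)^2, also when p.2 = 0. *)
have d0 : 0 < (e / 2) ^+ 2 / (`|p.2| ^+ 2 + 1) by rewrite divr_gt0// exprn_gt0.
have [c cc hc] := indic_continuous_approximation lebesgue_itv_fin mp pD d0.
exists ((c, p.2) :: l); split.
- by move=> q; rewrite in_cons => /orP[/eqP ->|/cl].
- by move=> q; rewrite in_cons => /orP[/eqP ->|/lW].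
have sp : square_integrable i (fun x => (\1_(p.1) x : R) *: p.2).
  have := @simple_square_integrable R i K lebesgue_itv_fin [:: p].
  rewrite (_ : simple_eval [:: p] = fun x => (\1_(p.1) x : R) *: p.2).
    by apply=> q; rewrite inE => /eqP ->.
  by apply/funext => x; rewrite /simple_eval big_seq1.
have ss : square_integrable i (simple_eval s).
  apply: simple_square_integrable; first exact: lebesgue_itv_fin.
  by move=> q qs; case: (ms q); rewrite // in_cons qs orbT.
have sc := @square_integrable_scale c p.2 cc.
rewrite L2of_tensor_cons; last by move=> q; rewrite in_cons => /orP[/eqP ->|/cl].
have -> : L2of i (simple_eval (p :: s)) = L2of i (fun x => (\1_(p.1) x : R) *: p.2) + L2of i (simple_eval s).
  by rewrite -L2ofD//; congr L2of; apply/funext => x; rewrite /simple_eval big_cons.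
rewrite opprD addrACA; apply: le_trans (ler_normD _ _) _.
rewrite -L2ofB//=.
have h : `|L2of i (fun x => (\1_(p.1) x : R) *: p.2 - c x *: p.2)| <= e / 2.
  apply/L2of_norm_le; [exact: ltW | exact: square_integrableB |].
  rewrite (_ : (fun x => _) = (fun x => (\1_(p.1) x - c x) *: p.2)); last first.
    by apply/funext => x; rewrite scalerBl.
  rewrite L2sq_scale; last first.
    apply: measurable_funB; first exact: measurable_funTS.
    by apply: measurable_funTS; exact: continuous_measurable_fun.
  have p0 : (0 <= (`|p.2| ^+ 2)%:E)%E by rewrite lee_fin sqr_ge0.
  apply: le_trans (lee_wpmul2l p0 hc) _; rewrite -EFinM lee_fin.
  rewrite mulrA ler_pdivrMr// mulrC ler_wpM2l ?sqr_ge0//.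
  by rewrite lerDl.
by rewrite [leRHS]splitr lerD.
Qed.

End tensors.

(** * The range of the Gramian *)

Section almost_everywhere.
Context {R : realType}.

(** Otherwise the null set would contain the interval ]t, t + e[. *)
Lemma ae_right_dense (P : R -> Prop) (t e : R) : 0 <= t -> 0 < e ->
  {ae @lebesgue_measure R, forall s, `]0, +oo[%classic s -> P s} ->
  exists s, [/\ t < s, s < t + e & P s].
Proof.
move=> t0 e0 [A [mA A0 sA]]; apply: contrapT => H.
have : (lebesgue_measure [set` `]t, (t + e)%R[%R] <= lebesgue_measure A)%E.
  apply: le_measure; [by rewrite inE; exact: measurable_itv | by rewrite inE |].
  move=> s /=; rewrite in_itv/= => /andP[ts se]; apply: sA => /= Ps.
  apply: H; exists s; split => //; apply: Ps; rewrite /= in_itv/= andbT.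
  exact: le_lt_trans ts.
rewrite A0 lebesgue_measure_itv/= lte_fin ltrDl e0 -EFinD lee_fin; lra.
Qed.

Lemma closed_ae_right (V : topologicalType) (C : set V) (f : R -> V) t :
  closed C -> 0 <= t -> f s @[s --> t^'+] --> f t ->
  {ae @lebesgue_measure R, forall s, `]0, +oo[%classic s -> C (f s)} -> C (f t).
Proof.
move=> clC t0 ft Cf; apply: clC => B /ft /= [e /= e0 eB].
have [s [ts se Cs]] := ae_right_dense t0 e0 Cf.
exists (f s); split => //; apply: eB => //=.
by rewrite ltr_norml; apply/andP; split; lra.
Qed.

End almost_everywhere.

(** * Words in T and N, and orthogonality to them *)

Section words.
Context {R : realType} {K : hilbertType R}.
Variables (T : R -> {linear K -> K}) (N : {linear K -> K}).
Hypotheses (T0 : forall x, T 0 x = x)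
  (TD : forall s t, 0 <= s -> 0 <= t -> forall x, T (s + t) x = T s (T t x))
  (Tr : forall x, T t x @[t --> 0^'+] --> x)
  (Tc : forall t, 0 <= t -> continuous (T t)) (Nc : continuous N).

Lemma semigroup_right_continuous t x : 0 <= t -> T s x @[s --> t^'+] --> T t x.
Proof.
move=> t0; apply/cvgrPdist_lt => e e0; apply/nbhs_right0P.
have : T t (T h x) @[h --> 0^'+] --> T t x.
  by apply: continuous_cvg; [exact: Tc | exact: Tr].
move=> /cvgrPdist_lt/(_ _ e0); apply: filter_app; near=> h.
by rewrite -TD//; near: h; exact: nbhs_right_ge.
Unshelve. all: by end_near. Qed.

(** The Hilbert adjoint of [Pop T N s]; hence the letters act in the opposite order, with the first
    time innermost. *)
Fixpoint word n : lebesgue_space R n -> K -> K :=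
  if n is m.+1 return lebesgue_space R n -> K -> K
  then fun s v => word s.2 (N (T s.1 v)) else fun s v => T s v.

Lemma orthant_measurable n : measurable (@orthant R n).
Proof.
elim: n => [|n IH] /=; first exact: measurable_itv.
by apply: measurableX => //; exact: measurable_itv.
Qed.

Lemma Pop_inner n (s : lebesgue_space R n) x v : orthant s ->
  inner (Pop T N s x) v = inner x (word s v).
Proof.
elim: n s x v => [|n IH] /= s x v.
  rewrite in_itv/= andbT => s0; rewrite innerC -(adjP (Tc (ltW s0))).
  exact: innerC.
move=> []; rewrite /= in_itv/= andbT => s0 s2.
by rewrite innerC -(adjP (Tc (ltW s0))) -(adjP Nc) innerC IH.
Qed.

Lemma word_linear n (s : lebesgue_space R n) a u v :
  word s (a *: u + v) = a *: word s u + word s v.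
Proof.
by elim: n s u v => [|n IH] s u v /=; rewrite !linearP// IH.
Qed.

Lemma word_continuous n (s : lebesgue_space R n) : orthant s -> continuous (word s).
Proof.
elim: n s => [|n IH] s /=.
  by rewrite in_itv/= andbT => s0; apply/Tc/ltW.
move=> [/=]; rewrite in_itv/= andbT => s0 s2 v.
apply: (@continuous_comp _ _ _ (fun v => N (T s.1 v)) (word s.2)); last exact: IH.
by apply: (@continuous_comp _ _ _ (T s.1) N); [apply/Tc/ltW|exact: Nc].
Qed.

Lemma strongly_measurable_orbit v :
  strongly_measurable (`]0, +oo[ : set (measurableTypeR R)) (fun t => N (T t v)).
Proof.
apply: (@strongly_measurable_comp R _ (measurableTypeR R) _ _ id (fun t => N (T t v))) => //.
move=> t /=; rewrite in_itv/= andbT => t0.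
by apply: continuous_cvg; [exact: Nc | exact/semigroup_right_continuous/ltW].
Qed.

(** The vector N T(s.1) v entering the shorter word depends on s.1. Approximating it by simple
    functions, linearity gives finite sums of an indicator in s.1 times a function of s.2 that is
    measurable by induction; therefore the induction runs over all [v]. *)
Lemma measurable_inner_word n x v :
  measurable_fun (@orthant R n) (fun s => inner x (word s v)).
Proof.
have cin : continuous (inner x : K -> R) by move=> y; exact: cvg_innerr.
elim: n v => [|n IH] v /=.
  apply: (@strongly_measurable_measurable _ _ _ _ _ (fun t => T t v) (inner x)) => //.
  apply: (@strongly_measurable_comp R _ (measurableTypeR R) _ _ id (fun t => T t v)) => //.
  by move=> t /=; rewrite in_itv/= andbT => /ltW; exact: semigroup_right_continuous.
have [h [mh hv]] := strongly_measurable_orbit v.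
have mO := @orthant_measurable n.
have mO1 : measurable (`]0, +oo[%classic : set (measurableTypeR R)) by exact: measurable_itv.
have mO' : measurable (`]0, +oo[ `*` @orthant R n : set (measurableTypeR R * lebesgue_space R n)).
  exact: measurableX.
apply: (@measurable_fun_cvg _ _ _ _ (fun k s => inner x (word s.2 (simple_eval (h k) s.1)))).
  move=> k.
  have wE (l : seq (set (measurableTypeR R) * K)) (s : measurableTypeR R * lebesgue_space R n) :
    inner x (word s.2 (simple_eval l s.1)) = \sum_(p <- l) \1_(p.1) s.1 * inner x (word s.2 p.2).
    rewrite /simple_eval; elim: l => [|p l IHl].
      rewrite !big_nil; have := word_linear s.2 1 0 0.
      rewrite scaler0 addr0 scale1r => /(congr1 (fun y => y - word s.2 0)).
      by rewrite subrr addrK => <-; rewrite inner0r.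
    by rewrite !big_cons word_linear innerDr innerZr IHl.
  rewrite (_ : (fun s => _) = (fun s : measurableTypeR R * lebesgue_space R n =>
    \sum_(p <- h k) \1_(p.1) s.1 * inner x (word s.2 p.2))); last first.
    by apply/funext => s; exact: wE.
  have : forall p, p \in h k -> measurable p.1 by exact: mh.
  elim: (h k) => [|p l IHl] ml.
    rewrite (_ : (fun s => _) = cst 0); first exact: measurable_cst.
    by apply/funext => s; rewrite big_nil.
  rewrite (_ : (fun s => _) = (fun s : measurableTypeR R * lebesgue_space R n =>
      \1_(p.1) s.1 * inner x (word s.2 p.2) +
      \sum_(q <- l) \1_(q.1) s.1 * inner x (word s.2 q.2))); last first.
    by apply/funext => s; rewrite big_cons.
  apply: measurable_funD; last first.
    by apply: IHl => q ql; apply: ml; rewrite in_cons ql orbT.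
  apply: measurable_funM.
    apply: (@measurableT_comp _ _ _ _ _ _ (\1_(p.1) : measurableTypeR R -> R)).
      by apply: measurable_indic; apply: ml; rewrite mem_head.
    exact: measurable_funTS.
  move=> _ Y mY; have := IH p.2 mO Y mY.
  move=> /(measurableX mO1); congr (measurable _).
  apply/seteqP; split => -[s1 s2] /=; first by move=> [? []].
  by move=> [[? ?] ?].
move=> [s1 s2] [/= s1p s2p].
apply: cvg_innerr; apply: continuous_cvg; first exact: word_continuous.
exact: hv.
Qed.

(** Orthogonality to the words with n letters N, at all nonnegative times. Each level of the
    recursion quantifies one time, so that null sets can be removed one variable at a time. *)
Fixpoint kills_words (x : K) n v : Prop :=
  if n is m.+1 then forall t, 0 <= t -> kills_words x m (N (T t v))
  else forall t, 0 <= t -> inner x (T t v) = 0.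

Lemma closed_kills_words x n : closed [set v | kills_words x n v].
Proof.
elim: n => [|n IH].
  rewrite (_ : mkset _ = \bigcap_(t in [set t | 0 <= t]) [set v | inner x (T t v) = 0]); last first.
    by apply/seteqP; split.
  apply: closed_bigI => t t0.
  apply: (@closed_comp _ _ (fun v => inner x (T t v)) [set 0]); last exact: closed_eq.
  move=> v _; apply: cvg_innerr; exact: Tc.
rewrite (_ : mkset _ = \bigcap_(t in [set t | 0 <= t]) [set v | kills_words x n (N (T t v))]); last first.
  by apply/seteqP; split.
apply: closed_bigI => t t0.
apply: (@closed_comp _ _ (fun v => N (T t v)) [set v | kills_words x n v]) => //.
move=> v _; apply: (@continuous_comp _ _ _ (T t) N); [exact: Tc | exact: Nc].
Qed.

(** Tonelli isolates the first time: for almost every value of it the inner integral vanishes and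
    the induction hypothesis applies. Since [kills_words x n] is a closed condition and orbits are
    right continuous, the exceptional times, 0 included, disappear. *)
Lemma integral_word0_kills n x v :
  (\int[msp_measure (lebesgue_space R n)]_(s in @orthant R n)
     ((inner x (word s v)) ^+ 2)%:E = 0)%E -> kills_words x n v.
Proof.
have msq n' v' : measurable_fun (@orthant R n') (fun s => ((inner x (word s v')) ^+ 2)%:E).
  by apply/measurable_EFinP; apply: measurable_funX; exact: measurable_inner_word.
elim: n v => [|n IH] v int0 /=.
  have := (ae_eq_integral_abs lebesgue_measure (measurable_itv _) (msq 0%N v)).1.
  under eq_integral do rewrite gee0_abs ?lee_fin ?sqr_ge0//.
  move=> /(_ int0) ae0 t t0.
  apply: (@closed_ae_right R K [set y | inner x y = 0] (fun t => T t v)) => //.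
  - apply: (@closed_comp _ _ (inner x : K -> R) [set 0]); last exact: closed_eq.
    by move=> y _; exact: cvg_innerr.
  - exact: semigroup_right_continuous.
  - apply: filterS ae0 => s + ps => /(_ ps) /= [].
    by move/eqP; rewrite sqrf_eq0 => /eqP.
move=> t t0.
have mO := @orthant_measurable n.
have mO1 : measurable (`]0, +oo[%classic : set (measurableTypeR R)) by exact: measurable_itv.
pose F (s1 : measurableTypeR R) := (\int[msp_measure (lebesgue_space R n)]_(s in @orthant R n)
     ((inner x (word s (N (T s1 v)))) ^+ 2)%:E)%E.
apply: (@closed_ae_right R K [set w | kills_words x n w] (fun t => N (T t v))) => //.
- exact: closed_kills_words.
- by apply: continuous_cvg; [exact: Nc | exact: semigroup_right_continuous].
have mO' : measurable (@orthant R n.+1) := orthant_measurable n.+1.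
pose G : measurableTypeR R * lebesgue_space R n -> \bar R :=
  (fun s : lebesgue_space R n.+1 => ((inner x (word s v)) ^+ 2)%:E) \_ (@orthant R n.+1).
have mG : measurable_fun setT G by apply/(measurable_restrictT _ mO'); exact: msq.
have G0 s : (0 <= G s)%E.
  by rewrite /G patchE; case: ifP => // _; rewrite lee_fin sqr_ge0.
have := @fubini_tonelli1 _ _ _ _ R lebesgue_measure (msp_measure (lebesgue_space R n)) G mG G0.
have -> : (\int[lebesgue_measure \x msp_measure (lebesgue_space R n)]_z G z = 0)%E.
  by rewrite -[RHS]int0 [RHS]integral_mkcond.
move=> /esym F0.
have mF := @measurable_fun_fubini_tonelli_F _ _ _ _ R (msp_measure (lebesgue_space R n)) G mG G0.
have := (ae_eq_integral_abs lebesgue_measure measurableT mF).1.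
under eq_integral do rewrite gee0_abs ?integral_ge0//.
move=> /(_ F0); apply: filterS => s1 /(_ I) /= + s1p; rewrite /fubini_F => Fs1.
apply: IH; rewrite -[RHS]Fs1 [LHS]integral_mkcond; apply: eq_integral => s2 _.
rewrite /G !patchE; congr (if _ then _ else _).
by apply/idP/idP => /set_mem h; apply/mem_set; [split | case: h].
Qed.

(** Linear combinations are left out: orthogonality to a set and to its span coincide, and only
    orthogonality is used below. *)
Inductive wordspace (b : set K) : K -> Prop :=
| wordspace_gen v : b v -> wordspace b v
| wordspaceT t v : 0 <= t -> wordspace b v -> wordspace b (T t v)
| wordspaceN v : wordspace b v -> wordspace b (N v).

Lemma wordspace_word b n (s : lebesgue_space R n) v : orthant s -> b v -> wordspace b (word s v).
Proof.
move=> + bv; have : wordspace b v by exact: wordspace_gen.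
elim: n s v {bv} => [|n IH] s v wv /=.
  by rewrite in_itv/= andbT => /ltW s0; exact: wordspaceT.
move=> [/=]; rewrite in_itv/= andbT => /ltW s0 s2.
by apply: IH => //; apply: wordspaceN; exact: wordspaceT.
Qed.

(** The words tested alternate T and N, whereas [wordspace] allows any order: consecutive T's merge
    by the semigroup law, and T(0) = id supplies the missing letters. *)
Lemma kills_wordspace x (b : set K) : (forall v n, b v -> kills_words x n v) ->
  forall v, wordspace b v -> inner x v = 0.
Proof.
move=> xb v bv; suff H n : kills_words x n v.
  by have := H 0%N 0 (lexx 0); rewrite T0.
elim: bv n => [w bw n|t w t0 _ IH n|w _ IH n]; first exact: xb.
  case: n => [|n] s s0; first by rewrite -TD//; apply: (IH 0%N); exact: addr_ge0.
  by rewrite -TD//; apply: (IH n.+1); exact: addr_ge0.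
by have := IH n.+1 0 (lexx 0); rewrite T0.
Qed.

Section gramian_integral.
Variables (m : nat) (b : 'I_m -> K) (i : nat).

Definition gramian_integral (x y : K) : \bar R :=
  (\int[msp_measure (lebesgue_space R i)]_(s in @orthant R i)
     (inner (Pop T N s x) (inp b (inp_adj b (Pop T N s y))))%:E)%E.

Lemma gramian_integralE x y : gramian_integral x y =
  (\int[msp_measure (lebesgue_space R i)]_(s in @orthant R i)
     (\sum_(j < m) inner x (word s (b j)) * inner y (word s (b j)))%:E)%E.
Proof.
apply: eq_integral => s /set_mem Os; congr EFin.
rewrite innerC inp_adjP; apply: eq_bigr => j _.
by rewrite !mxE !(innerC (b j)) !Pop_inner// mulrC.
Qed.

Let f x y (s : lebesgue_space R i) :=
  \sum_(j < m) inner x (word s (b j)) * inner y (word s (b j)).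

Let mf x y : measurable_fun (@orthant R i) (f x y).
Proof.
apply: measurable_sum => j.
by apply: measurable_funM; exact: measurable_inner_word.
Qed.

Lemma gramian_integral_ge0 x : (0 <= gramian_integral x x)%E.
Proof.
rewrite gramian_integralE; apply: integral_ge0 => s _.
by rewrite lee_fin sumr_ge0// => j _; rewrite -expr2 sqr_ge0.
Qed.

Let intf x y : (gramian_integral x x < +oo)%E -> (gramian_integral y y < +oo)%E ->
  (msp_measure (lebesgue_space R i)).-integrable (@orthant R i) (EFin \o f x y).
Proof.
move=> fx fy.
have int_diag z : (gramian_integral z z < +oo)%E ->
    (msp_measure (lebesgue_space R i)).-integrable (@orthant R i) (EFin \o f z z).
  move=> fz; apply/integrableP; split; first exact/measurable_EFinP.
  rewrite gramian_integralE in fz; apply: le_lt_trans fz; rewrite le_eqVlt.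
  apply/orP; left; apply/eqP; apply: eq_integral => s _ /=; rewrite ger0_norm//.
  by rewrite /f sumr_ge0// => j _; rewrite -expr2 sqr_ge0.
apply: le_integrable (integrableD (orthant_measurable _) (int_diag x fx) (int_diag y fy)).
- exact: orthant_measurable.
- exact/measurable_EFinP.
move=> s Os /=; rewrite lee_fin; apply: le_trans (ler_norm_sum _ _ _) _.
apply: le_trans (ler_norm _); rewrite -big_split/=; apply: ler_sum => j _.
rewrite normrM -[inner x _ * inner x _]expr2 -[inner y _ * inner y _]expr2.
rewrite -(real_normK (num_real (inner x _))) -(real_normK (num_real (inner y _))).
move: `|inner x _| `|inner y _| => p q; nra.
Qed.

(** Finite diagonal values make the mixed integrands integrable, since |p q| <= p^2 + q^2 term by
    term. This is the source of the linearity of [P]. *)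
Lemma gramian_integral_linear x a y z :
  (gramian_integral x x < +oo)%E -> (gramian_integral y y < +oo)%E ->
  (gramian_integral z z < +oo)%E ->
  [/\ gramian_integral x y \is a fin_num, gramian_integral x z \is a fin_num &
  gramian_integral x (a *: y + z) = (a%:E * gramian_integral x y + gramian_integral x z)%E].
Proof.
move=> fx fy fz; rewrite !gramian_integralE.
have iy := intf fx fy; have iz := intf fx fz.
split; [exact: (integrable_fin_num (orthant_measurable _) iy)|exact: (integrable_fin_num (orthant_measurable _) iz)|].
rewrite -(integralZl (orthant_measurable _) iy) -integralD//; last first.
- exact: (integrableZl (orthant_measurable _) a iy).
- exact: orthant_measurable.
apply: eq_integral => s _ /=; rewrite -EFinM -EFinD; congr EFin.
rewrite mulr_sumr -big_split/=; apply: eq_bigr => j _.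
by rewrite innerDl innerZl; ring.
Qed.

Lemma gramian_integral_kills x n j : n = i ->
  gramian_integral x x = 0%E -> kills_words x n (b j).
Proof.
move=> -> int0; apply: integral_word0_kills; apply/eqP.
rewrite eq_le integral_ge0 ?andbT//; last by move=> s _; rewrite lee_fin sqr_ge0.
rewrite -int0 gramian_integralE; apply: ge0_le_integral => //.
- exact: orthant_measurable.
- by move=> s _; rewrite lee_fin sqr_ge0.
- by apply/measurable_EFinP; apply: measurable_funX; exact: measurable_inner_word.
- exact/measurable_EFinP/mf.
move=> s _; rewrite lee_fin (bigD1 j)//= -expr2 lerDl.
by apply: sumr_ge0 => k _; rewrite -expr2 sqr_ge0.
Qed.

Lemma gramian_integral0 x y : (forall s : lebesgue_space R i, orthant s ->
  forall j, inner x (word s (b j)) = 0) -> gramian_integral x y = 0%E.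
Proof.
move=> x0; rewrite gramian_integralE; apply: integral0_eq => s Os.
by rewrite big1// => j _; rewrite x0// mul0r.
Qed.

End gramian_integral.

Section gramian_range.
Variables (n k : nat) (psi : 'I_n -> K) (phi : 'I_k -> K) (P : K -> K).
Hypothesis gramP : bilinear_gramian T N psi phi P.

Let W := closure (range P).
Let b : set K := [set v | (exists j, v = psi j) \/ (exists j, v = phi j)].

Lemma gramian_formE i x y : gramian_form T N psi phi i x y =
  (gramian_integral psi i x y +
  if i is j.+1 then gramian_integral phi j x y else (inner x (inp phi (inp_adj phi y)))%:E)%E.
Proof. by case: i. Qed.

Let tail i x y := if i is j.+1 then gramian_integral phi j x y else (inner x (inp phi (inp_adj phi y)))%:E.

Let tail_ge0 i x : (0 <= tail i x x)%E.
Proof.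
case: i => [|j] /=; last exact: gramian_integral_ge0.
rewrite lee_fin innerC inp_adjP; apply: sumr_ge0 => j _.
by rewrite !mxE -expr2 sqr_ge0.
Qed.

Let diag_fin i x : (gramian_form T N psi phi i x x \is a fin_num)%E ->
  (gramian_integral psi i x x < +oo)%E /\ (tail i x x < +oo)%E.
Proof.
rewrite gramian_formE -/(tail i x x) fin_numD => /andP[].
by rewrite !ge0_fin_numE ?tail_ge0 ?gramian_integral_ge0.
Qed.

Let P_term := projT1 (cid gramP).

Let P_termE i x y : (inner x (P_term i y))%:E = gramian_form T N psi phi i x y.
Proof. by have [] := projT2 (cid gramP). Qed.

Let P_cvg x : \sum_(i < m) P_term i x @[m --> \oo] --> P x.
Proof. by have [_] := projT2 (cid gramP). Qed.

Let form_fin i x : gramian_form T N psi phi i x x \is a fin_num.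
Proof. by rewrite -P_termE. Qed.

Let P_term_linear i a y z : P_term i (a *: y + z) = a *: P_term i y + P_term i z.
Proof.
apply: inner_inj => x; rewrite !(innerC _ x) innerDr innerZr.
apply: EFin_inj; rewrite EFinD EFinM !P_termE !gramian_formE.
rewrite -/(tail i x (a *: y + z)) -/(tail i x y) -/(tail i x z).
have [gx tx] := diag_fin (form_fin i x).
have [gy ty] := diag_fin (form_fin i y).
have [gz tz] := diag_fin (form_fin i z).
have [f1 f2 ->] := gramian_integral_linear a gx gy gz.
have [t1 t2 ->] : [/\ tail i x y \is a fin_num, tail i x z \is a fin_num &
   tail i x (a *: y + z) = (a%:E * tail i x y + tail i x z)%E].
  case: (i) tx ty tz => [|j] tx ty tz /=; last exact: gramian_integral_linear.
  split=> //; rewrite -EFinM -EFinD; congr EFin.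
  rewrite !(innerC x) !inp_adjP mulr_sumr -big_split/=; apply: eq_bigr => l _.
  by rewrite !mxE innerDr innerZr; ring.
move: (gramian_integral _ _ _ _) (gramian_integral _ _ _ _) f1 f2 => p q f1 f2.
by rewrite muleDr ?fin_num_adde_defl// addeACA.
Qed.

Let P_linear a y z : P (a *: y + z) = a *: P y + P z.
Proof.
have h : \sum_(i < m) P_term i (a *: y + z) @[m --> \oo] --> a *: P y + P z.
  have -> : (fun m => \sum_(i < m) P_term i (a *: y + z)) =
     (fun m => a *: \sum_(i < m) P_term i y + \sum_(i < m) P_term i z).
    apply/funext => m; rewrite scaler_sumr -big_split/=.
    by apply: eq_bigr => i _; rewrite P_term_linear.
  by apply: cvgD; [apply: cvgZr; exact: P_cvg | exact: P_cvg].
exact: (cvg_unique _ (@P_cvg _) h).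
Qed.

Lemma range_gramian0 : W 0.
Proof.
apply: subset_closure; exists 0 => //.
by have := P_linear (-1) 0 0; rewrite scaleN1r oppr0 addr0 scaleN1r addNr.
Qed.

Lemma range_gramianD x y : W x -> W y -> W (x + y).
Proof.
move=> /closure_normP Wx /closure_normP Wy; apply/closure_normP => e e0.
have e2 : 0 < e / 2 by rewrite divr_gt0.
have [_ [x' _ <-] xx] := Wx _ e2; have [_ [y' _ <-] yy] := Wy _ e2.
exists (P (1 *: x' + y')); first by exists (1 *: x' + y').
rewrite P_linear scale1r opprD addrACA (le_trans (ler_normD _ _))//; lra.
Qed.

Lemma range_gramianZ a x : W x -> W (a *: x).
Proof.
move=> /closure_normP Wx; apply/closure_normP => e e0.
have a1 : 0 < `|a| + 1 by rewrite ltr_wpDl.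
have [_ [x' _ <-] xx] := Wx _ (divr_gt0 e0 a1).
exists (P (a *: x' + 0)); first by exists (a *: x' + 0).
have P0 : P 0 = 0.
  by have := P_linear (-1) 0 0; rewrite scaleN1r oppr0 addr0 scaleN1r addNr.
rewrite P_linear P0 addr0 -scalerBr normrZ.
move: xx; rewrite ler_pdivlMr//; have := normr_ge0 (x - P x'); nra.
Qed.

Let orth_kills x : (forall w, W w -> inner x w = 0) ->
  forall v, wordspace b v -> inner x v = 0.
Proof.
move=> xW; apply: kills_wordspace.
have sum0 : \sum_(i < m) inner x (P_term i x) @[m --> \oo] --> 0.
  have e : inner x (P x) = 0 by apply: xW; apply: subset_closure; exists x.
  have h : inner x (\sum_(i < m) P_term i x) @[m --> \oo] --> inner x (P x).
    by apply: cvg_innerr; exact: P_cvg.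
  by rewrite e in h; under eq_fun do rewrite -inner_sumr.
have ge0 i : 0 <= inner x (P_term i x).
  by rewrite -lee_fin P_termE gramian_formE adde_ge0 ?gramian_integral_ge0// -/(tail i x x).
have z i : inner x (P_term i x) = 0.
  apply/eqP; rewrite eq_le ge0 andbT.
  apply: (ler_cvg_to (cvg_cst (inner x (P_term i x))) sum0).
  exists i.+1 => // m /= im; rewrite (bigD1 (Ordinal im))//= lerDl.
  by apply: sumr_ge0 => l _; exact: ge0.
have zz i : gramian_integral psi i x x = 0%E /\ tail i x x = 0%E.
  have : (gramian_integral psi i x x + tail i x x)%E = 0%E.
    by rewrite -gramian_formE -P_termE z.
  move/eqP; rewrite padde_eq0 ?gramian_integral_ge0//.
  by move=> /andP[/eqP -> /eqP ->].
(* Words with l letters N come from term l for [psi] but from term l + 1 for [phi], whose part of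
   each Gramian term has one time variable fewer. *)
move=> v l [[j ->]|[j ->]].
  by apply: (@gramian_integral_kills _ psi l) => //; case: (zz l).
by apply: (@gramian_integral_kills _ phi l) => //; case: (zz l.+1).
Qed.

(** The double orthogonal complement of the words, that is, their closed span. *)
Let wordspace_closure := [set v | forall x, (forall w, wordspace b w -> inner x w = 0) ->
  inner x v = 0].

Let range_gramianE : W = wordspace_closure.
Proof.
apply/seteqP; split => v.
  move=> Wv x xw.
  have clx : closed [set v | inner x v = 0].
    apply: (@closed_comp _ _ (inner x : K -> R) [set 0]); last exact: closed_eq.
    by move=> y _; exact: cvg_innerr.
  suff H : range P `<=` [set v | inner x v = 0].
    by have := closure_subset H Wv; rewrite closure_id in clx; rewrite -clx.
  move=> _ [y _ <-] /=.
  have T0' i : inner x (P_term i y) = 0.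
    apply: EFin_inj; rewrite P_termE gramian_formE.
    rewrite gramian_integral0 ?add0e; last first.
      by move=> s Os j; apply: xw; apply: wordspace_word => //; left; exists j.
    case: i => [|i].
      rewrite innerC inp_adjP big1// => j _; rewrite !mxE (innerC _ x) (xw (phi j)) ?mulr0//.
      by apply: wordspace_gen; right; exists j.
    apply: gramian_integral0 => s Os j.
    by apply: xw; apply: wordspace_word => //; right; exists j.
  have : inner x (\sum_(i < m) P_term i y) @[m --> \oo] --> inner x (P y).
    by apply: cvg_innerr; exact: P_cvg.
  have -> : (fun m => inner x (\sum_(i < m) P_term i y)) = (fun=> 0).
    by apply/funext => m; rewrite inner_sumr big1.
  by move=> h; apply/esym; apply: (cvg_unique _ (cvg_cst 0) h).
move=> Vv; apply: (@closed_subspace_bipolar R K W).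
- exact: range_gramian0.
- exact: range_gramianD.
- exact: range_gramianZ.
- exact: closed_closure.
by move=> z zW; apply: Vv; exact: orth_kills.
Qed.

(** The orthogonal complement of the words is invariant under [adj (T t)], because T(t) applied to a
    word is again a word. *)
Lemma range_gramianT t x : 0 <= t -> W x -> W (T t x).
Proof.
move=> t0; rewrite range_gramianE => Wx y yw.
rewrite innerC (adjP (Tc t0)) innerC; apply: Wx => w ww.
by rewrite innerC -(adjP (Tc t0)) innerC; apply: yw; exact: wordspaceT.
Qed.

Lemma range_gramianN x : W x -> W (N x).
Proof.
rewrite range_gramianE => Wx y yw.
rewrite innerC (adjP Nc) innerC; apply: Wx => w ww.
by rewrite innerC -(adjP Nc) innerC; apply: yw; exact: wordspaceN.
Qed.

Lemma range_gramian_psi j : W (psi j).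
Proof.
by rewrite range_gramianE => y; apply; apply: wordspace_gen; left; exists j.
Qed.

End gramian_range.

End words.

(** * Scalar calculus and the resolvent of the generator *)

Section calculus.
Context {R : realType}.
Notation mu := (@lebesgue_measure R).
Implicit Types c C : R -> R.

Lemma continuous_integrable_itv c (a b : R) b0 b1 : continuous c ->
  mu.-integrable [set` Interval (BSide b0 a) (BSide b1 b)] (EFin \o c).
Proof.
move=> cc; apply: (@integrableS _ _ _ mu `[a, b]%classic).
- exact: measurable_itv.
- exact: measurable_itv.
- move=> x /=; rewrite !itv_boundlr => /andP[h1 h2]; apply/andP; split.
    by apply: le_trans h1; rewrite bnd_simp; case: b0 {h2}; rewrite bnd_simp ?ltW.
  by apply: le_trans h2 _; rewrite bnd_simp; case: b1 {h1}; rewrite bnd_simp ?ltW.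
apply: continuous_compact_integrable; first exact: segment_compact.
exact: continuous_subspaceT.
Qed.

(** An integral from the base point -N can be differentiated only to the right of it, so the base
    moves with x; subtracting the value at 0 removes the dependence on N, and near x one fixed N may
    be used. *)
Lemma antiderivative c : continuous c -> exists C, forall x : R, is_derive x 1 C (c x).
Proof.
move=> cc.
pose F (N x : R) := \int[mu]_(t in `[- N, x]) c t.
have chasles (N N' x : R) : - N' < - N -> - N < x ->
    F N' x - F N' (- N) = F N x.
  move=> h1 h2; rewrite /F.
  have -> : \int[mu]_(t in `[- N, x]) c t = \int[mu]_(t in `]- N, x]) c t.
    by rewrite Rintegral_itv_obnd_cbnd//; exact: continuous_integrable_itv.
  apply: Rintegral_itvB.
  - exact: continuous_integrable_itv.
  - by rewrite bnd_simp ltW.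
  - by rewrite bnd_simp ltW.
pose C x := F (`|x| + 1) x - F (`|x| + 1) 0.
have CE N x : `|x| + 1 < N -> C x = F N x - F N 0.
  move=> h.
  have h1 : - N < - (`|x| + 1) by rewrite ltrN2.
  have h2 : - (`|x| + 1) < x by have := ler_norm (- x); rewrite normrN; lra.
  have h3 : - (`|x| + 1) < 0 by have := normr_ge0 x; lra.
  by rewrite /C -(chasles _ _ _ h1 h2) -(chasles _ _ _ h1 h3); lra.
exists C => x.
pose N := `|x| + 3.
have : is_derive x 1 (fun y => F N y - F N 0) (c x).
  have x1 : x < x + 1 by lra.
  have Nx : - N < x by have := ler_norm (- x); rewrite normrN /N; lra.
  have [d1 d2] := @continuous_FTC1_closed R c (- N) x (x + 1) x1
    (@continuous_integrable_itv c _ _ true false cc) Nx (cc x).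
  have H : is_derive x 1 (F N) (c x).
    exact: DeriveDef d1 (etrans (esym (derive1E _ _)) d2).
  have := is_deriveB H (is_derive_cst (F N 0) x 1).
  by rewrite subr0.
apply: near_eq_is_derive; near=> y; apply/esym/CE.
have : `|x - y| < 1 by near: y; apply: cvgr_dist_lt => //; exact: cvg_id.
have := ler_normB x (x - y); rewrite opprB addrC subrK /N.
by move=> *; lra.
Unshelve. all: by end_near. Qed.

Lemma FTC c C (a b : R) : continuous c -> (forall x : R, is_derive x 1 C (c x)) -> a <= b ->
  \int[mu]_(x in `]a, b[) c x = C b - C a.
Proof.
move=> cc dC; rewrite le_eqVlt => /predU1P[->|ab].
  by rewrite set_itv_ge ?bnd_simp// Rintegral_set0 subrr.
rewrite Rintegral_itv_bndo_bndc; last exact: continuous_integrable_itv.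
rewrite Rintegral_itv_obnd_cbnd; last exact: continuous_integrable_itv.
have cC : continuous C.
  by move=> x; apply: differentiable_continuous; apply/derivable1_diffP; exact: (@ex_derive _ _ _ _ _ _ _ (dC x)).
rewrite /Rintegral (@continuous_FTC2 R c C a b ab).
- by rewrite -EFinB.
- exact: continuous_subspaceT.
- split=> [x _||].
  + exact: (@ex_derive _ _ _ _ _ _ _ (dC x)).
  + by apply: cvg_at_right_filter; exact: cC.
  + by apply: cvg_at_left_filter; exact: cC.
- by move=> x _; rewrite derive1E; exact: (@derive_val _ _ _ _ _ _ _ (dC x)).
Qed.

Definition C1 c c' := (forall x : R, is_derive x 1 c (c' x)) /\ continuous c'.

Lemma C1_continuous c c' : C1 c c' -> continuous c.
Proof.
move=> [dC _] x; apply: differentiable_continuous; apply/derivable1_diffP.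
exact: (@ex_derive _ _ _ _ _ _ _ (dC x)).
Qed.

Lemma C1_expR (l : R) : C1 (fun s => expR (l * s)) (fun s => l * expR (l * s)).
Proof.
have ce : continuous (fun s : R => expR (l * s)).
  move=> s; apply: continuous_comp; last exact: continuous_expR.
  exact: mulrl_continuous.
split=> [x|x]; last by apply: cvgMr; exact: ce.
have h : is_derive x 1 (fun s : R => l * s) l.
  have := is_deriveZ l (is_derive_id x (1 : R)).
  by rewrite /GRing.scale/= mulr1.
rewrite mulrC; exact: (is_derive1_comp (is_derive_expR (l * x)) h).
Qed.

Lemma C1M c c' d d' : C1 c c' -> C1 d d' -> C1 (fun s => c s * d s) (fun s => c s * d' s + d s * c' s).
Proof.
move=> hc hd; split=> [x|x].
  exact: is_deriveM (hc.1 x) (hd.1 x).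
by apply: cvgD; apply: cvgM; [exact: (C1_continuous hc)|exact: hd.2|exact: (C1_continuous hd)|exact: hc.2].
Qed.

Lemma C1Z (l : R) c c' : C1 c c' -> C1 (fun s => l * c s) (fun s => l * c' s).
Proof.
move=> hc; split=> [x|x]; last by apply: cvgMr; exact: hc.2.
by have := is_deriveZ l (hc.1 x); rewrite /GRing.scale/=.
Qed.

Lemma C1D c c' d d' : C1 c c' -> C1 d d' -> C1 (fun s => c s + d s) (fun s => c' s + d' s).
Proof.
move=> hc hd; split=> [x|x]; first exact: is_deriveD (hc.1 x) (hd.1 x).
by apply: cvgD; [exact: hc.2 | exact: hd.2].
Qed.

Lemma C1_shift (a : R) c c' : C1 c c' -> C1 (fun s => c (s + a)) (fun s => c' (s + a)).
Proof.
move=> hc; split=> [x|x].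
  have h : is_derive x 1 (fun s : R => s + a) 1.
    by have := is_deriveD (is_derive_id x (1 : R)) (is_derive_cst a x 1); rewrite addr0.
  by have := @is_derive1_comp R c (fun s : R => s + a) x _ _ (hc.1 (x + a)) h; rewrite mulr1.
apply: (@continuous_comp _ _ _ (fun s => s + a) c'); last exact: hc.2.
by apply: cvgD; [exact: cvg_id | exact: cvg_cst].
Qed.

Lemma C1_cst (a : R) : C1 (fun=> a) (fun=> 0).
Proof. by split=> [x|x]; [exact: is_derive_cst | exact: cvg_cst]. Qed.

(* Variation of constants for [d - h d' = c], [d 0 = 0]. *)
Lemma resolvent_derivative c (h : R) : continuous c -> 0 < h ->
  exists d d', [/\ C1 d d', d 0 = 0 & forall s, d s - h * d' s = c s].
Proof.
move=> cc h0.
have ce : continuous (fun s => expR (- h^-1 * s) * c s).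
  by move=> s; apply: cvgM; [exact: (C1_continuous (C1_expR _)) | exact: cc].
have [C dC] := antiderivative ce.
have C1C : C1 (fun s => - h^-1 * (C s - C 0)) (fun s => - h^-1 * (expR (- h^-1 * s) * c s)).
  apply: C1Z; have := C1D (conj dC ce) (C1_cst (- C 0)).
  by under [X in C1 _ X]eq_fun do rewrite addr0.
exists (fun s => expR (h^-1 * s) * (- h^-1 * (C s - C 0))); eexists; split.
- exact: C1M (C1_expR h^-1) C1C.
- by rewrite subrr !mulr0.
move=> s /=.
have e1 : expR (h^-1 * s) * expR (- h^-1 * s) = 1 by rewrite -expRD mulNr subrr expR0.
have e2 : h * h^-1 = 1 by rewrite divff// gt_eqF.
transitivity ((h * h^-1) * (expR (h^-1 * s) * expR (- h^-1 * s)) * c s +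
   (1 - h * h^-1) * (expR (h^-1 * s) * (- h^-1 * (C s - C 0)))); first by ring.
by rewrite e1 e2 subrr mul0r addr0 !mul1r.
Qed.

End calculus.

(** * Bochner integrals of continuous functions *)

Section bochner_continuous.
Context {R : realType} {K : hilbertType R}.
Notation mu := (@lebesgue_measure R).
Variables (F : R -> K) (cF : continuous F) (a b : R) (ab : a < b).

Lemma bochner_continuous_inner x :
  inner x (bochner mu `]a, b[ F) = \int[mu]_(s in `]a, b[) inner x (F s).
Proof.
have finD := lebesgue_itv_fin ab.
have mD : measurable (`]a, b[ : set (measurableTypeR R)) by exact: measurable_itv.
have mF : strongly_measurable (`]a, b[ : set (measurableTypeR R)) F.
  apply: (@strongly_measurable_comp R _ (measurableTypeR R) _ _ id F) => //.
  by move=> s _; apply: cvg_at_right_filter; exact: cF.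
have iF : mu.-integrable `]a, b[ (EFin \o (fun s => `|F s|)).
  by apply: continuous_integrable_itv => s; apply: cvg_norm; exact: cF.
by have [_ ->] := bochner_inner mD finD x mF iF.
Qed.

Lemma continuous_inner_comp x : continuous (fun s => inner x (F s)).
Proof. by move=> s; apply: cvg_innerr; exact: cF. Qed.

Lemma bochner_continuous_subspace (W : set K) :
  W 0 -> (forall x y, W x -> W y -> W (x + y)) -> (forall c x, W x -> W (c *: x)) ->
  closed W -> (forall s, a < s < b -> W (F s)) -> W (bochner mu `]a, b[ F).
Proof.
move=> W0 WD WZ clW WF; apply: closed_subspace_bipolar => // z zW.
rewrite bochner_continuous_inner (@eq_Rintegral _ _ _ mu _ (fun=> 0)); last first.
  by move=> s; rewrite inE/= in_itv/= => sab; apply: zW; exact: WF.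
by rewrite Rintegral_cst ?mul0r//; exact: measurable_itv.
Qed.

Lemma bochner_continuous_average e : 0 <= e -> (forall s, a < s < b -> `|F s - F a| <= e) ->
  `|(b - a)^-1 *: bochner mu `]a, b[ F - F a| <= e.
Proof.
move=> e0 Fe; have ba : 0 < b - a by rewrite subr_gt0.
have mD : measurable (`]a, b[ : set (measurableTypeR R)) by exact: measurable_itv.
have muD : fine (mu `]a, b[%classic) = b - a.
  by rewrite lebesgue_measure_itv/= lte_fin ab.
apply: inner_norm_le => // y; rewrite innerC innerBr innerZr bochner_continuous_inner.
have -> : inner y (F a) = (b - a)^-1 * \int[mu]_(s in `]a, b[) inner y (F a).
  by rewrite Rintegral_cst// muD mulrC mulfK// gt_eqF.
rewrite -mulrBr -RintegralB//; last 2 first.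
- by apply: continuous_integrable_itv; exact: continuous_inner_comp.
- by apply: continuous_integrable_itv; exact: cst_continuous.
rewrite ler_pdivrMl//.
have -> : (b - a) * (e * `|y|) = \int[mu]_(s in `]a, b[) (e * `|y|).
  by rewrite Rintegral_cst// muD mulrC.
apply: le_Rintegral => //.
- apply: continuous_integrable_itv => s.
  by apply: cvgB; [exact: continuous_inner_comp | exact: cvg_cst].
- by apply: continuous_integrable_itv; exact: cst_continuous.
move=> s; rewrite /= in_itv/= => sab; rewrite -innerBr.
apply: le_trans (ler_norm _) _; apply: le_trans (inner_le _ _) _.
by rewrite mulrC ler_wpM2r// Fe.
Qed.

End bochner_continuous.

(** * Truncated Laplace integrals of orbits *)

Section orbit_integrals.
Context {R : realType} {K : hilbertType R}.
Notation mu := (@lebesgue_measure R).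
Variables (T : R -> {linear K -> K}) (M : R).
Hypotheses (T0 : forall x, T 0 x = x)
  (TD : forall s t, 0 <= s -> 0 <= t -> forall x, T (s + t) x = T s (T t x))
  (Tr : forall x, T t x @[t --> 0^'+] --> x)
  (Tc : forall t, 0 <= t -> continuous (T t))
  (M0 : 0 < M) (TM : forall t x, 0 <= t -> `|T t x| <= M * `|x|).

Let orbit_dist s t y : 0 <= s -> 0 <= t -> `|T s y - T t y| <= M * `|T `|s - t| y - y|.
Proof.
wlog st : s t / s <= t => [H s0 t0|s0 t0].
  have [st|ts] := leP s t; first exact: H.
  by rewrite distrC (distrC s); apply: H => //; exact: ltW.
rewrite ler0_norm ?subr_le0// opprB distrC.
have -> : T t y = T s (T (t - s) y) by rewrite -TD ?subr_ge0// addrC subrK.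
by rewrite -linearB; exact: TM.
Qed.

Lemma orbit_continuous y : continuous (fun s : R => T `|s| y).
Proof.
move=> s; apply/cvgrPdist_le => e e0.
have := @Tr y => /cvgrPdist_le/(_ _ (divr_gt0 e0 M0))[d /= d0 hd].
near=> t; apply: le_trans (orbit_dist _ _ _) _ => //.
rewrite mulrC -ler_pdivlMr// distrC.
have [->|ne] := eqVneq `|(`|s| - `|t|)| 0; first by rewrite T0 subrr normr0 divr_ge0// ltW.
apply: hd; last by rewrite lt_neqAle eq_sym ne /=.
rewrite /ball_/= sub0r normrN normr_id; apply: le_lt_trans (ler_dist_dist _ _) _.
by near: t; apply: cvgr_dist_lt => //; exact: cvg_id.
Unshelve. all: by end_near. Qed.

Variables (y : K) (l : R).

(** The even extension of the orbit in time is continuous on the whole line, so that global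
    antiderivatives apply; the integrals below only see s >= 0. *)
Definition damped_orbit (s : R) : K := expR (- l * s) *: T `|s| y.

Lemma damped_orbit_continuous : continuous damped_orbit.
Proof.
move=> s; apply: cvgZ; last exact: orbit_continuous.
exact: (C1_continuous (C1_expR _)).
Qed.

Let cf := damped_orbit_continuous.

Definition orbit_integral (L : R) : K := bochner mu `]0, L[ damped_orbit.

(** T(h) turns the integrand at s into exp(l h) times the integrand at s + h. Tested against a
    vector, all the integrals are differences of values of one antiderivative, and the identity is
    algebra. *)
Lemma orbit_integral_shift L h : 0 < L -> 0 < h ->
  T h (orbit_integral L) - orbit_integral L =
  (expR (l * h) - 1) *: orbit_integral L +
  expR (l * h) *: (bochner mu `]L, L + h[ damped_orbit - bochner mu `]0, h[ damped_orbit).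
Proof.
move=> L0 h0; apply: inner_inj => v; rewrite !(innerC _ v).
have [C dC] := antiderivative (@continuous_inner_comp _ _ _ cf v).
have cv := @continuous_inner_comp _ _ _ cf v.
rewrite innerBr [RHS]innerDr !innerZr innerBr.
have E1 : inner v (orbit_integral L) = C L - C 0.
  by rewrite bochner_continuous_inner// (FTC cv dC)// ltW.
have E2 : inner v (bochner mu `]L, L + h[ damped_orbit) = C (L + h) - C L.
  by rewrite bochner_continuous_inner ?ltrDl// (FTC cv dC)// lerDl ltW.
have E3 : inner v (bochner mu `]0, h[ damped_orbit) = C h - C 0.
  by rewrite bochner_continuous_inner// (FTC cv dC)// ltW.
have E4 : inner v (T h (orbit_integral L)) = expR (l * h) * (C (L + h) - C h).
  rewrite innerC (adjP (Tc (ltW h0))) innerC bochner_continuous_inner//.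
  have D := C1Z (expR (l * h)) (C1_shift h (conj dC cv)).
  rewrite (@eq_Rintegral _ _ _ mu _ (fun s => expR (l * h) * inner v (damped_orbit (s + h)))); last first.
    move=> s; rewrite inE/= in_itv/= => /andP[s0 _].
    rewrite innerC -(adjP (Tc (ltW h0))) innerC /damped_orbit.
    rewrite linearZ/= !innerZr mulrA -expRD !gtr0_norm ?addr_gt0//.
    rewrite -TD ?ltW// (addrC h).
    by have -> : l * h + - l * (s + h) = - l * s by ring.
  by rewrite (FTC D.2 D.1 (ltW L0)) add0r mulrBr.
have ident (p q p1 p2 e c0 c1 c2 c3 : R) : p = c1 - c0 -> p1 = c2 - c1 -> p2 = c3 - c0 ->
    q = e * (c2 - c3) -> q - p = (e - 1) * p + e * (p1 - p2).
  by move=> -> -> -> ->; ring.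
exact: ident E1 E2 E3 E4.
Qed.

Lemma orbit_integral_average a : 0 <= a ->
  h^-1 *: bochner mu `]a, a + h[ damped_orbit @[h --> 0^'+] --> damped_orbit a.
Proof.
move=> a0; apply/cvgrPdist_le => e e0.
have /cvgrPdist_le/(_ e e0)/nbhs_ballP[d /= d0 hd] := @cf a.
near=> h; have h0 : 0 < h by near: h; exact: nbhs_right_gt.
have ah : a < a + h by rewrite ltrDl.
have hd' : h < d by near: h; exact: nbhs_right_lt.
rewrite distrC.
have := @bochner_continuous_average R K _ cf _ _ ah e (ltW e0).
rewrite (addrC a) addrK; apply=> s /andP[s1 s2]; rewrite distrC; apply: hd.
rewrite -ball_normE /ball_/= ltr_norml; apply/andP; split; lra.
Unshelve. all: by end_near. Qed.

(** The shift identity divided by h. Equivalently, l - A maps the integral to y - exp(-l L) T(L) y: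
    for l > 0, truncating the Laplace transform at L costs only an exponentially small term. *)
Lemma orbit_integral_generator L : 0 < L -> 0 <= l ->
  generator T (orbit_integral L, l *: orbit_integral L + (expR (- l * L) *: T L y - y)).
Proof.
move=> L0 l0; rewrite /generator/=.
have -> : expR (- l * L) *: T L y - y = 1 *: (damped_orbit L - damped_orbit 0).
  by rewrite scale1r /damped_orbit gtr0_norm// normr0 mulr0 expR0 scale1r T0.
have X1 : expR (l * h) @[h --> 0^'+] --> (1 : R).
  have := @C1_continuous _ _ _ (C1_expR l) 0; rewrite /continuous_at mulr0 expR0.
  exact: cvg_at_right_filter.
have X2 : h^-1 * (expR (l * h) - 1) @[h --> 0^'+] --> l.
  apply: (@squeeze_cvgr _ _ _ _ (cst l) (fun h => l * expR (l * h))).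
  - near=> h; have h0 : 0 < h by near: h; exact: nbhs_right_gt.
    apply/andP; split.
      by rewrite ler_pdivlMl//; have := expR_ge1Dx (l * h); rewrite /cst; lra.
    rewrite ler_pdivrMl//.
    have := ler_wpM2r (expR_ge0 (l * h)) (expR_ge1Dx (- (l * h))).
    by rewrite -expRD addNr expR0; lra.
  - exact: cvg_cst.
  - by rewrite -[X in _ --> X]mulr1; apply: cvgMr.
have X3 : h^-1 *: bochner mu `]L, L + h[ damped_orbit @[h --> 0^'+] --> damped_orbit L.
  exact/orbit_integral_average/ltW.
have X4 : h^-1 *: bochner mu `]0, h[ damped_orbit @[h --> 0^'+] --> damped_orbit 0.
  have E : (fun h => h^-1 *: bochner mu `]0, 0 + h[ damped_orbit) =
      (fun h => h^-1 *: bochner mu `]0, h[ damped_orbit).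
    by apply/funext => h; rewrite add0r.
  by rewrite -E; exact: orbit_integral_average (lexx 0).
have X5 : (h^-1 * (expR (l * h) - 1)) *: orbit_integral L + expR (l * h) *:
    (h^-1 *: bochner mu `]L, L + h[ damped_orbit - h^-1 *: bochner mu `]0, h[ damped_orbit)
    @[h --> 0^'+] --> l *: orbit_integral L + 1 *: (damped_orbit L - damped_orbit 0).
  apply: cvgD; first exact: (cvgZ X2 (cvg_cst _)).
  exact: (cvgZ X1 (cvgB X3 X4)).
apply: cvg_trans X5; apply: near_eq_cvg; near=> h.
have h0 : 0 < h by near: h; exact: nbhs_right_gt.
apply: etrans (congr1 (fun z => h^-1 *: z) (esym (orbit_integral_shift L0 h0))).
have ident (p u1 u2 : K) (q c : R) : (q * (c - 1)) *: p + c *: (q *: u1 - q *: u2) =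
    q *: ((c - 1) *: p + c *: (u1 - u2)).
  by rewrite -scalerBr [RHS]scalerDr !scalerA (mulrC c).
exact: ident.
Unshelve. all: by end_near. Qed.

(** The integral of l exp(-l s) over ]0, L[ is at most 1. *)
Lemma orbit_integral_le L : 0 < L -> 0 <= l -> l * `|orbit_integral L| <= M * `|y|.
Proof.
move=> L0 l0.
have MY : 0 <= M * `|y| by rewrite mulr_ge0// ltW.
rewrite -(ger0_norm l0) -normrZ; apply: inner_norm_le => // v.
rewrite innerC innerZr bochner_continuous_inner//.
have ce := C1Z (- (M * `|y| * `|v|)) (C1_expR (- l)).
have cI := @continuous_inner_comp _ _ _ cf v.
rewrite -RintegralZl; [|exact: measurable_itv|exact: continuous_integrable_itv].
apply: (@le_trans _ _ (\int[mu]_(s in `]0, L[) (- (M * `|y| * `|v|) * (- l * expR (- l * s))))).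
  apply: le_Rintegral; [exact: measurable_itv| | |].
  - apply: continuous_integrable_itv => s; apply: cvgMr; exact: cI.
  - exact: continuous_integrable_itv ce.2.
  move=> s; rewrite /= in_itv/= => /andP[s0 _].
  have -> : - (M * `|y| * `|v|) * (- l * expR (- l * s)) = l * ((M * `|y| * `|v|) * expR (- l * s)) by ring.
  rewrite ler_wpM2l// /damped_orbit innerZr mulrC ler_wpM2r ?expR_ge0//.
  apply: le_trans (ler_norm _) _; apply: le_trans (inner_le _ _) _.
  by rewrite mulrC ler_wpM2r// gtr0_norm// TM// ltW.
rewrite (FTC ce.2 ce.1 (ltW L0)) mulr0 expR0.
have := mulr_ge0 (mulr_ge0 MY (normr_ge0 v)) (expR_ge0 (- l * L)).
lra.
Qed.

End orbit_integrals.

(** * Approximate resolvent of the generator inside a subspace *)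

Section approximate_resolvent.
Context {R : realType} {K : hilbertType R}.
Notation mu := (@lebesgue_measure R).
Variables (T : R -> {linear K -> K}) (M : R) (W : set K).
Hypotheses (T0 : forall x, T 0 x = x)
  (TD : forall s t, 0 <= s -> 0 <= t -> forall x, T (s + t) x = T s (T t x))
  (Tr : forall x, T t x @[t --> 0^'+] --> x)
  (Tc : forall t, 0 <= t -> continuous (T t))
  (M0 : 0 < M) (TM : forall t x, 0 <= t -> `|T t x| <= M * `|x|)
  (W0 : W 0) (WD : forall x y, W x -> W y -> W (x + y))
  (WZ : forall a x, W x -> W (a *: x)) (clW : closed W)
  (WT : forall t x, 0 <= t -> W x -> W (T t x)).

Lemma orbit_integral_subspace y l L : 0 < L -> W y -> W (orbit_integral T y l L).
Proof.
move=> L0 Wy; apply: bochner_continuous_subspace => //.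
  exact: (@damped_orbit_continuous _ _ T M).
by move=> s _; apply: WZ; exact: WT.
Qed.

(** The witness is h^-1 times the Laplace integral with l = h^-1, truncated at [L]. Its bound M |y|
    does not depend on h, which is what lets a perturbation of size h be absorbed. *)
Lemma approximate_resolvent y h e : W y -> 0 < h -> 0 < e -> exists x Ax,
  [/\ W x, W Ax, generator T (x, Ax), `|x - h *: Ax - y| <= e & `|x| <= M * `|y| ].
Proof.
move=> Wy h0 e0; have l0 : 0 < h^-1 by rewrite invr_gt0.
have My : 0 <= M * `|y| by rewrite mulr_ge0// ltW.
(* Since 1 + x <= exp(x), exp(L/h) is at least M |y| / e, so the truncation error exp(-L/h) M |y| is
   at most e. *)
pose L := h * (M * `|y| / e + 1).
have L0 : 0 < L by rewrite mulr_gt0// ltr_wpDl// divr_ge0// ltW.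
have small : expR (- h^-1 * L) * (M * `|y|) <= e.
  have -> : - h^-1 * L = - (M * `|y| / e + 1) by rewrite /L mulNr mulrA mulVf ?mul1r// gt_eqF.
  have := expR_ge1Dx (M * `|y| / e + 1); rewrite expRN => h1.
  have ep : 0 < expR (M * `|y| / e + 1) by exact: expR_gt0.
  rewrite ler_pdivrMl// -ler_pdivrMr//; lra.
pose X := orbit_integral T y h^-1 L.
pose AX := h^-1 *: X + (expR (- h^-1 * L) *: T L y - y).
have gX : generator T (X, AX).
  by apply: (@orbit_integral_generator _ _ T M) => //; exact: ltW.
have WX : W X by exact: orbit_integral_subspace.
have WAX : W AX.
  apply: WD; first exact: WZ.
  apply: WD; first by apply: WZ; apply: WT => //; exact: ltW.
  by rewrite -scaleN1r; exact: WZ.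
exists (h^-1 *: X), (h^-1 *: AX); split; [exact: WZ | exact: WZ | | |].
- exact: generatorZ.
- rewrite scalerA mulfV ?gt_eqF// scale1r /AX opprD addrA subrr add0r opprB addrAC subrr add0r.
  rewrite normrN normrZ ger0_norm ?expR_ge0//; apply: le_trans small.
  by rewrite ler_wpM2l ?expR_ge0// TM// ltW.
- rewrite normrZ gtr0_norm//.
  by apply: (@orbit_integral_le _ _ T M) => //; exact: ltW.
Qed.

(** With l = 0 the integral divided by its length h lies in the domain and averages the orbit near
    time 0. *)
Lemma domain_dense y e : 0 < e -> exists x Ax, generator T (x, Ax) /\ `|y - x| <= e.
Proof.
move=> e0.
have : h^-1 *: bochner mu `]0, 0 + h[ (damped_orbit T y 0) @[h --> 0^'+] --> damped_orbit T y 0 0.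
  exact: (@orbit_integral_average _ _ T M).
move=> /cvgrPdist_le/(_ e e0) H.
near (0 : R)^'+ => h; have h0 : 0 < h by near: h; exact: nbhs_right_gt.
have gX : generator T (orbit_integral T y 0 h,
    0 *: orbit_integral T y 0 h + (expR (- 0 * h) *: T h y - y)).
  exact: (@orbit_integral_generator _ _ T M).
exists (h^-1 *: orbit_integral T y 0 h),
  (h^-1 *: (0 *: orbit_integral T y 0 h + (expR (- 0 * h) *: T h y - y))).
split; first exact: generatorZ.
have : `|damped_orbit T y 0 0 - h^-1 *: bochner mu `]0, 0 + h[ (damped_orbit T y 0)| <= e.
  by near: h; exact: H.
by rewrite add0r {1}/damped_orbit normr0 T0 mulr0 expR0 scale1r.
Unshelve. all: by end_near. Qed.

End approximate_resolvent.

(** * The generator of the delay semigroup *)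

Section bochner_interval.
Context {R : realType} {K : hilbertType R}.
Notation mu := (@lebesgue_measure R).
Variables (a b : R) (ab : a < b).
Notation D := (`]a, b[%classic : set (measurableTypeR R)).

Let mD : measurable D. Proof. exact: measurable_itv. Qed.
Let finD : (mu D < +oo)%E. Proof. exact: lebesgue_itv_fin. Qed.

Definition bochner_integrable (f : R -> K) :=
  strongly_measurable D f /\ mu.-integrable D (EFin \o (fun s => `|f s|)).

Lemma bochner_innerE f x : bochner_integrable f ->
  mu.-integrable D (EFin \o (fun s => inner x (f s))) /\
  inner x (bochner mu `]a, b[ f) = \int[mu]_(s in D) inner x (f s).
Proof. by move=> [mf intf]; exact: bochner_inner. Qed.

Lemma bochner_integrableD f1 f2 : bochner_integrable f1 -> bochner_integrable f2 ->
  bochner_integrable (fun s => f1 s + f2 s).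
Proof.
move=> [m1 i1] [m2 i2]; have m := strongly_measurableD m1 m2; split=> //.
apply: le_integrable (integrableD mD i1 i2) => //.
  apply/measurable_EFinP; exact: (strongly_measurable_measurable (@norm_continuous _ _) m).
move=> s _ /=; rewrite lee_fin normr_id; apply: le_trans (ler_normD _ _) _.
exact: ler_norm.
Qed.

Lemma bochnerD f1 f2 : bochner_integrable f1 -> bochner_integrable f2 ->
  bochner mu `]a, b[ (fun s => f1 s + f2 s) = bochner mu `]a, b[ f1 + bochner mu `]a, b[ f2.
Proof.
move=> h1 h2; apply: inner_inj => x; rewrite !(innerC _ x) innerDr.
have [i1 e1] := bochner_innerE x h1; have [i2 e2] := bochner_innerE x h2.
apply: etrans (bochner_innerE x (bochner_integrableD h1 h2)).2 _.
apply: etrans (esym (congr2 +%R e1 e2)).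
by under eq_Rintegral do rewrite innerDr; rewrite RintegralD.
Qed.

Lemma bochner_integrable_scale (c : R -> R) (v : K) : mu.-integrable D (EFin \o c) ->
  bochner_integrable (fun s => c s *: v).
Proof.
move=> ic; have mc : measurable_fun D c by apply/measurable_EFinP; exact: measurable_int ic.
have m : strongly_measurable D (fun s => c s *: v).
  by apply: strongly_measurable_scale => //; exact: strongly_measurable_cst.
split=> //; apply: le_integrable (integrableZl mD `|v| ic) => //.
  apply/measurable_EFinP; exact: (strongly_measurable_measurable (@norm_continuous _ _) m).
by move=> s _ /=; rewrite lee_fin normr_id normrZ normrM normr_id mulrC.
Qed.

Lemma bochner_scale (c : R -> R) (v : K) : mu.-integrable D (EFin \o c) ->
  bochner mu `]a, b[ (fun s => c s *: v) = (\int[mu]_(s in D) c s) *: v.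
Proof.
move=> ic; apply: inner_inj => x; rewrite !(innerC _ x).
rewrite (bochner_innerE x (bochner_integrable_scale v ic)).2 innerZr.
under eq_Rintegral do rewrite innerZr mulrC.
by rewrite RintegralZl// mulrC.
Qed.

Lemma bochner_integrable0 : bochner_integrable (fun=> 0).
Proof.
split; first exact: strongly_measurable0.
rewrite (_ : _ \o _ = fun=> 0%E); first exact: integrable0.
by apply/funext => s /=; rewrite normr0.
Qed.

Lemma bochner0 : bochner mu `]a, b[ (fun=> 0 : K) = 0.
Proof.
apply: inner_inj => x; rewrite !(innerC _ x) (bochner_innerE x bochner_integrable0).2 inner0r.
by rewrite /Rintegral integral0.
Qed.

Lemma integrable_continuous_mul (g c : R -> R) : mu.-integrable D (EFin \o g) ->
  continuous c -> mu.-integrable D (EFin \o (fun s => g s * c s)).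
Proof.
move=> ig cc; have [M hM] := continuous_bounded_itv ab cc.
have mg : measurable_fun D g by apply/measurable_EFinP; exact: measurable_int ig.
apply: le_integrable (integrableZl mD M ig) => //.
  apply/measurable_EFinP; apply: measurable_funM => //.
  by apply: measurable_funTS; exact: continuous_measurable_fun.
move=> s; rewrite /= in_itv/= => /andP[/ltW s1 /ltW s2].
rewrite lee_fin !normrM mulrC ler_wpM2r//.
by apply: le_trans (hM s _) (ler_norm _); rewrite s1.
Qed.

Lemma L2repr_bochner_integrable (c : R -> R) (G : L2 `]a, b[ K) : continuous c ->
  bochner_integrable (fun s => c s *: L2repr G s).
Proof.
move=> cc; have [M hM] := continuous_bounded_itv ab cc.
have [mG fG] := square_integrable_repr G.
have m : strongly_measurable D (fun s => c s *: L2repr G s).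
  apply: strongly_measurable_scale => //.
  by apply: measurable_funTS; exact: continuous_measurable_fun.
split=> //.
have i2 : mu.-integrable D (fun s => (`|L2repr G s| ^+ 2)%:E).
  apply/integrableP; split; first exact: L2sq_measurable.
  by under eq_integral do rewrite gee0_abs ?lee_fin ?sqr_ge0//.
have i1 : mu.-integrable D (EFin \o (fun=> 1 : R)).
  by apply: continuous_integrable_itv; exact: cst_continuous.
apply: le_integrable (integrableZl mD M (integrableD mD i1 i2)) => //.
  apply/measurable_EFinP; exact: (strongly_measurable_measurable (@norm_continuous _ _) m).
move=> s; rewrite /= in_itv/= => /andP[/ltW s1 /ltW s2].
have hs : `|c s| <= M by apply: hM; rewrite s1.
rewrite lee_fin normr_id normrZ.
apply: le_trans (ler_norm _).
apply: le_trans (ler_wpM2r (normr_ge0 _) hs) _; apply: ler_wpM2l.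
  by apply: le_trans hs.
by have := sqr_ge0 (`|L2repr G s| - 1); move: `|L2repr G s| => p; nra.
Qed.

Lemma continuous_tensor_continuous (l : seq ((R -> R) * K)) : continuous_tensor l ->
  continuous (tensor l).
Proof.
elim: l => [|p l IH] cl x.
  rewrite (_ : tensor [::] = fun=> 0); first exact: cst_continuous.
  by apply/funext => y; rewrite /tensor big_nil.
rewrite (_ : tensor (p :: l) = fun x => p.1 x *: p.2 + tensor l x); last first.
  by apply/funext => y; rewrite tensor_cons.
apply: cvgD.
  by apply: cvgZ; [apply: cl; rewrite mem_head | exact: cvg_cst].
by apply: IH => q ql; apply: cl; rewrite in_cons ql orbT.
Qed.

Lemma test_function_C1 (eta : R -> R) : test_function a b eta ->
  [/\ C1 eta (derive1 eta), eta a = 0 & eta b = 0].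
Proof.
move=> [de [c [d [ac db eta0]]]]; split.
- split=> [x|x]; last first.
    by apply: differentiable_continuous; apply/derivable1_diffP; exact: (de 1%N).
  by rewrite derive1E; apply: DeriveDef => //; exact: (de 0%N).
- by apply: eta0; rewrite in_itv/= leNgt ac.
- by apply: eta0; rewrite in_itv/= [b <= d]leNgt db andbF.
Qed.

(* Tested against a fixed vector, the identity is integration by parts for
   scalar functions. *)
Lemma weak_derivative_L2of (F F' : R -> K) :
  square_integrable `]a, b[ F -> square_integrable `]a, b[ F' ->
  (forall z, C1 (fun s => inner z (F s)) (fun s => inner z (F' s))) ->
  weak_derivative (L2of `]a, b[ F) (L2of `]a, b[ F').
Proof.
move=> sF sF' dF eta /test_function_C1[c1e ea eb].
have ce := C1_continuous c1e.
apply: inner_inj => z; rewrite !(innerC _ z) innerNr.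
have e1 (c : R -> R) (G : R -> K) : continuous c -> square_integrable `]a, b[ G ->
    continuous (fun s => inner z (G s)) ->
    inner z (bochner mu `]a, b[ (fun s => c s *: L2repr (L2of `]a, b[ G) s)) =
    \int[mu]_(s in D) (c s * inner z (G s)).
  move=> cc sG cG.
  have [i1 ->] := bochner_innerE z (L2repr_bochner_integrable (L2of `]a, b[ G) cc).
  congr fine; apply: ae_eq_integral => //.
  - exact: measurable_int i1.
  - apply/measurable_EFinP; apply: measurable_funTS; apply: continuous_measurable_fun => s.
    by apply: cvgM; [exact: cc | exact: cG].
  - by apply: filterS (L2ofE sG) => s h Ds; rewrite h// innerZr.
have cF := C1_continuous (dF z).
have E1 := e1 (derive1 eta) F c1e.2 sF cF.
have E2 := e1 eta F' ce sF' (dF z).2.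
have E3 := congr1 -%R (esym E2).
apply: etrans E1 _; apply: (fun h => etrans h E3).
have C := C1M c1e (dF z).
apply/eqP; rewrite -addr_eq0 -RintegralD//; last 2 first.
- by apply: continuous_integrable_itv => s; apply: cvgM; [exact: c1e.2 | exact: (C1_continuous (dF z))].
- by apply: continuous_integrable_itv => s; apply: cvgM; [exact: ce | exact: (dF z).2].
under eq_Rintegral do rewrite addrC (mulrC (derive1 eta _)).
by rewrite (FTC C.2 C.1 (ltW ab)) ea eb !mul0r subrr.
Qed.

End bochner_interval.

(** * The delay term on tensors *)

Section delay_functionals.
Context {R : realType} {K : hilbertType R}.
Notation mu := (@lebesgue_measure R).
Variables (N : {linear K -> K}) (r tau : R) (g : R -> R) (Phi : (R -> K) -> K).
Hypotheses (tau0 : 0 < tau) (taur : tau < r)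
  (ig : mu.-integrable `]- r, 0[ (EFin \o g))
  (g1 : (\int[mu]_(s in `](- r)%R, 0%R[) `|g s|%:E <= 1)%E)
  (hPhi : Phi = point_delay N tau \/ Phi = distributed_delay N r g).

(** One scalar functional covers both delays: evaluation at -tau, or integration against [g]. By
    linearity of N it acts on the coefficients alone. *)
Lemma delay_functional : exists m : (R -> R) -> R,
  (forall l, continuous_tensor l -> Phi (tensor l) = \sum_(p <- l) m p.1 *: N p.2) /\
  forall h, 0 < h -> `|m (fun s => expR (h^-1 * s))| <= 1.
Proof.
have r0 : - r < 0 by rewrite oppr_lt0 (lt_trans tau0).
have mD : measurable (`]- r, 0[%classic : set (measurableTypeR R)) by exact: measurable_itv.
have eneg h s : 0 < h -> s <= 0 -> expR (h^-1 * s) <= 1.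
  move=> h0 s0; rewrite -expR0 ler_expR.
  by rewrite mulr_ge0_le0// invr_ge0 ltW.
case: hPhi => ->.
  exists (fun c => c (- tau)); split=> [l _|h h0].
    rewrite /point_delay /tensor linear_sum; apply: eq_bigr => p _.
    by rewrite linearZ_LR.
  rewrite ger0_norm ?expR_ge0//; apply: eneg => //.
  by rewrite oppr_le0 ltW.
exists (fun c => \int[mu]_(s in `]- r, 0[) (g s * c s)); split=> [l cl|h h0].
  rewrite /distributed_delay.
  (* Integrability is carried through the induction, since additivity of the Bochner integral
     requires it. *)
  suff [//] : bochner mu `]- r, 0[ (fun s => g s *: N (tensor l s)) =
      \sum_(p <- l) (\int[mu]_(s in `]- r, 0[) (g s * p.1 s)) *: N p.2 /\
      bochner_integrable (- r) 0 (fun s => g s *: N (tensor l s)).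
  elim: l cl => [|p l IH] cl.
    rewrite (_ : (fun s => _) = fun=> 0); last first.
      by apply/funext => s; rewrite /tensor big_nil linear0 scaler0.
    by rewrite bochner0// big_nil; split => //; exact: bochner_integrable0.
  have [|E I] := IH; first by move=> q ql; apply: cl; rewrite in_cons ql orbT.
  have igc : mu.-integrable `]- r, 0[ (EFin \o (fun s => g s * p.1 s)).
    by apply: integrable_continuous_mul => //; apply: cl; rewrite mem_head.
  rewrite (_ : (fun s => _) = fun s => (g s * p.1 s) *: N p.2 + g s *: N (tensor l s)); last first.
    apply/funext => s; rewrite tensor_cons linearD scalerDr; congr (_ + _).
    by rewrite linearZ_LR scalerA.
  have I2 := bochner_integrable_scale (N p.2) igc.
  by rewrite bochnerD// bochner_scale// E big_cons; split => //; exact: bochner_integrableD.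
have ce : continuous (fun s => expR (h^-1 * s)) := C1_continuous (C1_expR h^-1).
have ige := integrable_continuous_mul r0 ig ce.
have igabs : mu.-integrable `]- r, 0[ (EFin \o (fun s => `|g s|)) := integrable_norm ig.
apply: le_trans (le_normr_Rintegral mD ige) _.
apply: (@le_trans _ _ (\int[mu]_(s in `]- r, 0[) `|g s|)).
  apply: le_Rintegral => //; first exact: (integrable_norm ige).
  move=> s; rewrite /= in_itv/= => /andP[_ s0].
  by rewrite normrM (ger0_norm (expR_ge0 _)) ler_piMr// eneg// ltW.
by rewrite -lee_fin /Rintegral fineK// integrable_fin_num.
Qed.

End delay_functionals.

(** * Tensors with continuously differentiable coefficients *)

Section C1_tensors.
Context {R : realType} (a b : R) (ab : a < b) (K : hilbertType R).
Notation mu := (@lebesgue_measure R).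
Notation i := `]a, b[.
Notation D := ([set` i] : set (measurableTypeR R)).
Implicit Types L : seq (((R -> R) * (R -> R)) * K).

Lemma L2of_bounded_le (f : R -> K) e : 0 <= e -> square_integrable i f ->
  (forall x, a < x < b -> `|f x| <= e / (b - a + 1)) -> `|L2of i f| <= e.
Proof.
move=> e0 sf fe; apply/L2of_norm_le => //.
have ba : 0 < b - a by rewrite subr_gt0.
have muD : mu D = (b - a)%:E by rewrite lebesgue_measure_itv/= lte_fin ab -EFinD.
apply: (@le_trans _ _ (\int[mu]_(x in D) ((e / (b - a + 1)) ^+ 2)%:E)%E).
  apply: ge0_le_integral => //.
  - exact: L2sq_measurable sf.1.
  - move=> x; rewrite /= in_itv/= => xab; rewrite lee_fin lerXn2r ?nnegrE//.
      by rewrite divr_ge0// addr_ge0// ltW.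
    exact: fe.
rewrite integral_cst//= muD -EFinM lee_fin exprMn -mulrA ler_piMr ?sqr_ge0//.
have p2 : 0 < (b - a + 1) ^+ 2 by rewrite exprn_gt0// addr_gt0.
rewrite exprVn mulrC (ler_pdivrMr _ _ p2) mul1r sqrrD1.
have := sqr_ge0 (b - a); move: (b - a) ba => t t0 t2; lra.
Qed.

Definition tensor_values L : seq ((R -> R) * K) := [seq (p.1.1, p.2) | p <- L].
Definition tensor_derivs L : seq ((R -> R) * K) := [seq (p.1.2, p.2) | p <- L].
Definition C1_tensor L := forall p, p \in L -> C1 p.1.1 p.1.2.

Lemma C1_tensor_values L : C1_tensor L -> continuous_tensor (tensor_values L).
Proof. by move=> hL q /mapP[p /hL h ->]; exact: C1_continuous h. Qed.

Lemma C1_tensor_derivs L : C1_tensor L -> continuous_tensor (tensor_derivs L).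
Proof. by move=> hL q /mapP[p /hL h ->]; exact: h.2. Qed.

Lemma C1_tensor_inner L z : C1_tensor L ->
  C1 (fun s => inner z (tensor (tensor_values L) s))
     (fun s => inner z (tensor (tensor_derivs L) s)).
Proof.
elim: L => [|p L IH] hL.
  rewrite (_ : (fun s => _) = fun=> 0); last first.
    by apply/funext => s; rewrite /tensor big_nil inner0r.
  exact: C1_cst.
have h1 := C1Z (inner z p.2) (hL p (mem_head _ _)).
have h2 : C1_tensor L by move=> q qL; apply: hL; rewrite in_cons qL orbT.
have := C1D h1 (IH h2); congr C1; apply/funext => s;
  by rewrite /= tensor_cons innerDr innerZr mulrC.
Qed.

(** The approximants are difference quotients of an antiderivative, that is, averages of [c] over
    [x, x + h]. By the mean value theorem they are values of [c] near x, and compactness makes the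
    choice of h uniform. *)
Lemma C1_uniform_approximation (c : R -> R) e : continuous c -> 0 < e ->
  exists d d', C1 d d' /\ forall x, a <= x <= b -> `|c x - d x| <= e.
Proof.
move=> cc e0; have [C dC] := antiderivative cc.
have hC : C1 C c by [].
have cC := C1_continuous hC.
have step : \forall h \near 0^'+,
    `[a, b]%classic `<=` [set x : R | `|c x - h^-1 * (C (x + h) + -1 * C x)| <= e].
  have := @segment_compact R a b => /compact_near_coveringP.
  apply=> x _; have e2 : 0 < e / 2 by rewrite divr_gt0.
  have /cvgrPdist_le/(_ _ e2)/nbhs_ballP[d /= d0 hd] := cc x.
  have d2 : 0 < d / 2 by rewrite divr_gt0.
  exists (ball x (d / 2), [set h | 0 < h < d / 2]) => /=.
    split; first exact: nbhsx_ballx.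
    near=> h; apply/andP; split; [near: h; exact: nbhs_right_gt|].
    by near: h; exact: nbhs_right_lt.
  move=> [y h] /= [yx /andP[h0 hd2]].
  have yh : y < y + h by rewrite ltrDl.
  have [xi] : exists2 xi, xi \in `]y, (y + h)[ & C (y + h) - C y = c xi * (y + h - y).
    by apply: MVT => //; exact: continuous_subspaceT.
  rewrite in_itv/= => /andP[yxi xiy] E.
  rewrite mulN1r E [y + h - y]addrC addKr mulrC mulfK ?gt_eqF//.
  have xd : `|c x - c xi| <= e / 2.
    apply: hd; rewrite /ball/=; move: yx; rewrite /ball/= !ltr_norml => /andP[? ?].
    by apply/andP; split; lra.
  have yd : `|c y - c x| <= e / 2.
    rewrite distrC; apply: hd; rewrite /ball/=; apply: lt_trans yx _; lra.
  exact: dist_half yd xd.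
have [h h0 hh] : exists2 h : R, 0 < h & `[a, b]%classic `<=`
    [set x : R | `|c x - h^-1 * (C (x + h) + -1 * C x)| <= e].
  near (0 : R)^'+ => h; exists h; first by near: h; exact: nbhs_right_gt.
  by near: h; exact: step.
exists (fun s => h^-1 * (C (s + h) + -1 * C s)).
exists (fun s => h^-1 * (c (s + h) + -1 * c s)); split.
  exact: C1Z (C1D (C1_shift h hC) (C1Z (-1) hC)).
by move=> x xab; apply: hh; rewrite /= in_itv.
Unshelve. all: by end_near. Qed.

Lemma C1_tensor_dense l e : continuous_tensor l -> 0 < e ->
  exists2 L, C1_tensor L & `|L2of i (tensor l) - L2of i (tensor (tensor_values L))| <= e.
Proof.
elim: l e => [|p l IH] e cl e0.
  by exists [::] => //; rewrite subrr normr0 ltW.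
have e2 : 0 < e / 2 by rewrite divr_gt0.
have [|L hL lL] := IH (e / 2) _ e2; first by move=> q ql; apply: cl; rewrite in_cons ql orbT.
have ba : 0 < b - a + 1 by rewrite addr_gt0// subr_gt0.
have v0 : 0 < `|p.2| + 1 by rewrite ltr_wpDl.
(* Multiplied by |p.2|, this stays below the uniform bound that [L2of_bounded_le] converts into
   e/2. *)
have eta0 : 0 < e / 2 / (b - a + 1) / (`|p.2| + 1) by rewrite !divr_gt0.
have cp : continuous p.1 by apply: cl; rewrite mem_head.
have [d [d' [hd cd]]] := C1_uniform_approximation cp eta0.
have hL' : C1_tensor (((d, d'), p.2) :: L).
  by move=> q; rewrite in_cons => /orP[/eqP ->|/hL].
exists (((d, d'), p.2) :: L) => //.
have sp := @square_integrable_scale _ _ _ ab _ p.1 p.2 cp.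
have sd := @square_integrable_scale _ _ _ ab _ d p.2 (C1_continuous hd).
rewrite (L2of_tensor_cons ab cl) (L2of_tensor_cons ab (C1_tensor_values hL')).
rewrite opprD addrACA [X in _ <= X]splitr; apply: le_trans (ler_normD _ _) _.
apply: lerD; last exact: lL.
rewrite -L2ofB//=; apply: L2of_bounded_le; first exact: ltW.
  exact: square_integrableB.
move=> x /andP[/ltW ax /ltW xb]; rewrite -scalerBl normrZ.
have h : `|p.1 x - d x| <= e / 2 / (b - a + 1) / (`|p.2| + 1) by apply: cd; rewrite ax.
apply: le_trans (ler_wpM2r (normr_ge0 _) h) _.
rewrite -[_ * `|p.2|]mulrA ler_piMr//; first by rewrite !divr_ge0// ltW.
by rewrite mulrC ler_pdivrMr// mul1r lerDl.
Qed.

End C1_tensors.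

(** * Elements of the domain of the delay operator *)

Section delay_generator.
Context {R : realType} {K : hilbertType R}.
Notation mu := (@lebesgue_measure R).
Variables (A : set (K * K)) (r : R) (r0 : 0 < r) (Phi : (R -> K) -> K).
Notation i := `]- r, 0[.

Let r0' : - r < 0. Proof. by rewrite oppr_lt0. Qed.

(** A tensor with continuous coefficients is its own continuous version, so the point values in the
    boundary condition and in [Phi] are those of the tensor itself. *)
Lemma delay_operator_tensor L (x Ax : K) : C1_tensor L -> A (x, Ax) ->
  tensor (tensor_values L) 0 = x ->
  @delay_operator R K A r Phi ((x, L2of i (tensor (tensor_values L))),
    (Ax + Phi (tensor (tensor_values L)), L2of i (tensor (tensor_derivs L)))).
Proof.
move=> hL Axx Lx; exists Ax, (tensor (tensor_values L)).
have sv := square_integrable_tensor r0' (C1_tensor_values hL).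
have sd := square_integrable_tensor r0' (C1_tensor_derivs hL).
split=> //=.
  by apply: weak_derivative_L2of => // z; exact: C1_tensor_inner.
split.
  apply: continuous_subspaceT; apply: continuous_tensor_continuous.
  exact: C1_tensor_values.
by apply: filterS (L2ofE sv) => s h si; exact: h.
Qed.

(** A boundary layer: value [v] at 0, small in L2. Its squared norm is at most |v|^2/q, and the
    chosen q makes this at most e^2. *)
Lemma exp_tensor_small (v : K) e : 0 < e -> exists2 l : R, 0 < l &
  `|L2of i (fun s => expR (l * s) *: v)| <= e.
Proof.
move=> e0; pose q := `|v| ^+ 2 / e ^+ 2 + 1.
have q0 : 0 < q by rewrite ltr_wpDl// divr_ge0// sqr_ge0.
exists q => //; have ce := C1_continuous (C1_expR q).
apply/L2of_norm_le; [exact: ltW | exact: square_integrable_scale |].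
rewrite L2sq_scale; last by apply: measurable_funTS; exact: continuous_measurable_fun.
have q2 : q * 2 != 0 by rewrite mulf_neq0// gt_eqF.
have E : (\int[mu]_(x in `](- r)%R, 0%R[) (expR (q * x) ^+ 2)%:E)%E =
    ((q * 2)^-1 * (1 - expR (- (q * 2) * r)))%:E.
  have h : C1 (fun s => (q * 2)^-1 * expR (q * 2 * s)) (fun s => expR (q * 2 * s)).
    have := C1Z (q * 2)^-1 (C1_expR (q * 2)); congr C1; apply/funext => s.
    by rewrite mulKf.
  have := FTC h.2 h.1 (ltW r0'); rewrite mulr0 expR0 -mulrBr mulrN -mulNr => <-.
  rewrite /Rintegral fineK; last first.
    by apply: integrable_fin_num => //; apply: continuous_integrable_itv; exact: h.2.
  by apply: eq_integral => x _; rewrite expr2 -expRD; congr (expR _)%:E; ring.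
rewrite E -EFinM lee_fin.
have e2 : 0 < e ^+ 2 by rewrite exprn_gt0.
have h1 : (q * 2)^-1 * (1 - expR (- (q * 2) * r)) <= q^-1.
  rewrite invfM -mulrA ler_piMr ?invr_ge0 ?(ltW q0)//.
  have := expR_gt0 (- (q * 2) * r); move: (expR _) => p p0; lra.
apply: le_trans (ler_wpM2l (sqr_ge0 _) h1) _.
rewrite ler_pdivrMr// /q mulrDr mulr1 mulrCA divff ?gt_eqF// mulr1 lerDl; exact: ltW.
Qed.

End delay_generator.

(** * Invariance under the delay semigroup *)

Section delay_invariance.
Context {R : realType} {K : hilbertType R}.
Notation mu := (@lebesgue_measure R).
Variables (T : R -> {linear K -> K}) (M : R) (N : {linear K -> K}) (W : set K).
Hypotheses (T0 : forall x, T 0 x = x)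
  (TD : forall s t, 0 <= s -> 0 <= t -> forall x, T (s + t) x = T s (T t x))
  (Tr : forall x, T t x @[t --> 0^'+] --> x)
  (Tc : forall t, 0 <= t -> continuous (T t))
  (M0 : 0 < M) (TM : forall t x, 0 <= t -> `|T t x| <= M * `|x|)
  (cN : continuous N)
  (W0 : W 0) (WD : forall x y, W x -> W y -> W (x + y))
  (WZ : forall a x, W x -> W (a *: x)) (clW : closed W)
  (WT : forall t x, 0 <= t -> W x -> W (T t x)) (WN : forall x, W x -> W (N x)).
Variables (r tau : R) (g : R -> R) (Phi : (R -> K) -> K).
Hypotheses (tau0 : 0 < tau) (taur : tau < r)
  (ig : mu.-integrable `]- r, 0[ (EFin \o g))
  (g1 : (\int[mu]_(s in `](- r)%R, 0%R[) `|g s|%:E <= 1)%E)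
  (hPhi : Phi = point_delay N tau \/ Phi = distributed_delay N r g).
Variable TT : R -> {linear delay_space r K -> delay_space r K}.
Hypothesis genTT : generates (@delay_operator R K (generator T) r Phi) TT.
Notation i := `]- r, 0[.

Let r0 : 0 < r. Proof. exact: lt_trans taur. Qed.
Let r0' : - r < 0. Proof. by rewrite oppr_lt0. Qed.

Let WB x y : W x -> W y -> W (x - y).
Proof. by move=> Wx Wy; apply: WD => //; rewrite -scaleN1r; exact: WZ. Qed.

(* The perturbation [kappa *: N] is absorbed by iterating the resolvent of [T]
   on the residual, which halves at each step. *)
Lemma perturbed_resolvent C kappa y h e : 0 < C -> (forall x, `|N x| <= C * `|x|) ->
  `|kappa| <= 1 -> 0 < h -> h * C * M <= 4^-1 -> W y -> 0 < e ->
  exists x Ax, [/\ W x, generator T (x, Ax) &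
    `|x - h *: (Ax + kappa *: N x) - y| <= e].
Proof.
move=> C0 NC k1 h0 hC Wy e0.
have y0 : 0 < `|y| + 1 by rewrite ltr_wpDl.
suff step n : exists x Ax, [/\ W x, W Ax, generator T (x, Ax) &
    `|x - h *: (Ax + kappa *: N x) - y| <= (`|y| + 1) * 2^-1 ^+ n].
  have := @cvg_geometric R (`|y| + 1) 2^-1.
  have lt1 : `|2^-1 : R| < 1 by rewrite gtr0_norm//; lra.
  move=> /(_ lt1)/cvgr0Pnorm_le/(_ _ e0)[n _ /(_ n (leqnn n))] hn.
  have [x [Ax [Wx _ gx hx]]] := step n; exists x, Ax; split => //.
  apply: le_trans hx _; apply: le_trans hn; exact: ler_norm.
elim: n => [|n [x [Ax [Wx WAx gx hx]]]].
  exists 0, 0; split => //.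
    rewrite /generator/= (_ : (fun h => _) = fun=> 0); first exact: cvg_cst.
    by apply/funext => t; rewrite linear0 subr0 scaler0.
  by rewrite linear0 scaler0 addr0 scaler0 subr0 sub0r normrN expr0 mulr1 lerDl.
set rho := (`|y| + 1) * 2^-1 ^+ n in hx *.
have rho0 : 0 < rho by rewrite mulr_gt0// exprn_gt0//; lra.
pose res := y - (x - h *: (Ax + kappa *: N x)).
have resle : `|res| <= rho by rewrite /res distrC.
have Wres : W res by apply: WB => //; apply: WB => //; apply: WZ; apply: WD => //; apply: WZ; exact: WN.
(* The new residual is allotted rho/4 for the inexact resolvent and rho/4 for h kappa N xi, where
   |xi| <= M rho and h C M <= 1/4. *)
have rho4 : 0 < rho / 4 by rewrite divr_gt0.
have [xi [Axi [Wxi WAxi gxi hxi xile]]] :=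
  approximate_resolvent T0 TD Tr Tc M0 TM W0 WD WZ clW WT Wres h0 rho4.
exists (x + xi), (Ax + Axi); split; [exact: WD | exact: WD | |].
  have gN : generator T (-1 *: xi, -1 *: Axi) := generatorZ gxi.
  have gB : generator T (x - -1 *: xi, Ax - -1 *: Axi) := generatorB gx gN.
  by move: gB; rewrite !scaleN1r !opprK.
have E : x + xi - h *: (Ax + Axi + kappa *: N (x + xi)) - y =
    (xi - h *: Axi - res) - (h * kappa) *: N xi.
  rewrite /res (linearD N); move: (N x) (N xi) => u v; apply: inner_inj => z.
  by rewrite !(innerDl, innerNl, innerZl); ring.
rewrite E; apply: le_trans (ler_normB _ _) _.
have h2 : `|(h * kappa) *: N xi| <= rho / 4.
  rewrite normrZ normrM (gtr0_norm h0).
  apply: (@le_trans _ _ (h * 1 * (C * (M * rho)))).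
    apply: ler_pM => //; first by rewrite mulr_ge0// ltW.
      by rewrite ler_wpM2l// ltW.
    apply: le_trans (NC _) _; rewrite ler_wpM2l ?(ltW C0)//; apply: le_trans xile _.
    by rewrite ler_wpM2l// ltW.
  rewrite mulr1 (_ : h * _ = rho * (h * C * M)); last by ring.
  by rewrite ler_wpM2l// ltW.
move: hxi h2; move: `|_ *: N xi| `|_ - res| => p q hq hp.
have -> : (`|y| + 1) * 2^-1 ^+ n.+1 = rho / 2 by rewrite /rho exprSr mulrA.
apply: le_trans (lerD hq hp) _; lra.
Qed.

(** Its closure contains every pair with values in [W] ([tensor_dense]), while continuity of the
    coefficients lets the second component of the resolvent equation be solved exactly. *)
Definition tensor_set : set (delay_space r K) := [set w | W w.1 /\
  exists l, [/\ continuous_tensor l, (forall p, p \in l -> W p.2) & w.2 = L2of i (tensor l)]].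

(** The normalization at 0 leaves the boundary value of the second component to the exponential term
    added later. *)
Lemma tensor_resolvent l h : continuous_tensor l -> (forall p, p \in l -> W p.2) -> 0 < h ->
  exists L, [/\ C1_tensor L, (forall p, p \in L -> W p.2), tensor (tensor_values L) 0 = 0 &
    forall s, tensor (tensor_values L) s - h *: tensor (tensor_derivs L) s = tensor l s].
Proof.
move=> cl lW h0; elim: l cl lW => [|p l IH] cl lW.
  exists [::]; split => //; first by rewrite /tensor big_nil.
  by move=> s; rewrite /tensor !big_nil scaler0 subr0.
have [q ql|q ql|L [hL LW L0 Ll]] := IH.
- by apply: cl; rewrite in_cons ql orbT.
- by apply: lW; rewrite in_cons ql orbT.
have [d [d' [hd d0 dd]]] := resolvent_derivative (cl p (mem_head _ _)) h0.
exists (((d, d'), p.2) :: L); split.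
- by move=> q; rewrite in_cons => /orP[/eqP ->|/hL].
- by move=> q; rewrite in_cons => /orP[/eqP ->|/LW//]; apply: lW; rewrite mem_head.
- by rewrite tensor_cons L0/= d0 scale0r addr0.
- move=> s; rewrite !tensor_cons/= scalerDr opprD addrACA Ll -dd scalerA.
  by rewrite -scalerBl.
Qed.

Lemma delay_range : exists2 h0 : R, 0 < h0 & forall h e w, 0 < h -> h < h0 -> 0 < e ->
  tensor_set w -> exists z v, [/\ tensor_set z, generator TT (z, v) & `|z - h *: v - w| <= e].
Proof.
have [C C0 NC] := linear_bounded cN.
have [m [Phim m1]] := delay_functional tau0 taur ig g1 hPhi.
have CM : 0 < C * M * 4 by rewrite !mulr_gt0.
(* This threshold gives h C M <= 1/4, as [perturbed_resolvent] requires. *)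
exists (C * M * 4)^-1; first by rewrite invr_gt0.
move=> h e [y G] hpos hh e0 [/= Wy [l [cl lW /= ->]]].
have [L [hL LW L0 Ll]] := tensor_resolvent cl lW hpos.
pose ex s : R := expR (h^-1 * s); pose ex' s : R := h^-1 * expR (h^-1 * s).
(* The delay term of the part vanishing at 0 is a known vector of [W], independent of x; moved to
   the right-hand side, it leaves x - h (A x + kappa N x) = y + h k0 with kappa = [m ex]. *)
pose k0 := \sum_(p <- tensor_values L) m p.1 *: N p.2.
have Wk0 : W k0.
  rewrite /k0 big_seq; elim/big_ind: _ => // p /mapP[q qL ->] /=.
  by apply: WZ; apply: WN; exact: LW.
have hC : h * C * M <= 4^-1.
  have : h * (C * M * 4) < 1 by rewrite -ltr_pdivlMr// div1r.
  rewrite !mulrA; move: (h * C * M) => t; lra.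
have Wy' : W (y + h *: k0) by apply: WD => //; exact: WZ.
have [x [Ax [Wx gx hx]]] := perturbed_resolvent C0 NC (m1 h hpos) hpos hC Wy' e0.
pose Lx := ((ex, ex'), x) :: L.
have hLx : C1_tensor Lx.
  by move=> q; rewrite in_cons => /orP[/eqP ->|/hL//]; exact: C1_expR.
have Lx0 : tensor (tensor_values Lx) 0 = x.
  by rewrite tensor_cons/= L0 addr0 /ex mulr0 expR0 scale1r.
have cLx := C1_tensor_values hLx.
have gen := delay_operator_tensor r0 Phi hLx gx Lx0.
have Phix : Phi (tensor (tensor_values Lx)) = m ex *: N x + k0.
  by rewrite Phim// big_cons.
exists (x, L2of i (tensor (tensor_values Lx))).
exists (Ax + Phi (tensor (tensor_values Lx)), L2of i (tensor (tensor_derivs Lx))); split.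
- split => //=; exists (tensor_values Lx); split => // p /mapP[q + ->] /=.
  by rewrite in_cons => /orP[/eqP ->|/LW].
- by rewrite -genTT.2.
- have sv := square_integrable_tensor r0' cLx.
  have sd := square_integrable_tensor r0' (C1_tensor_derivs hLx).
  have E2 : L2of i (tensor (tensor_values Lx)) - h *: L2of i (tensor (tensor_derivs Lx)) -
      L2of i (tensor l) = 0.
    rewrite -L2ofZ// -L2ofB//; last exact: square_integrableZ.
    apply/eqP; rewrite subr_eq0; apply/eqP; congr (L2of _); apply/funext => s.
    rewrite !tensor_cons/= scalerDr opprD addrACA Ll scalerA /ex' mulVKf ?gt_eqF//.
    by rewrite subrr add0r.
  have E1 : x - h *: (Ax + Phi (tensor (tensor_values Lx))) - y =
      x - h *: (Ax + m ex *: N x) - (y + h *: k0).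
    by rewrite Phix addrA (scalerDr h _ k0) !opprD !addrA (addrAC _ _ (- y)).
  rewrite prod_normE/= ge_max; apply/andP; split; first by rewrite E1.
  by rewrite E2 normr0 ltW.
Qed.

(** A C1 tensor close to the second component need not match, at 0, the domain vector x
    approximating the first; the boundary layer of [exp_tensor_small] corrects the mismatch. *)
Lemma delay_domain_dense z : closure [set w | exists v, generator TT (w, v)] z.
Proof.
apply/closure_normP => e e0; case: z => y F.
have e2 : 0 < e / 2 by rewrite divr_gt0.
have e4 : 0 < e / 2 / 2 by rewrite !divr_gt0.
have FT : {ae mu, forall s, `]- r, 0[%classic s -> [set: K] (L2repr F s)} by exact: nearW.
have [l [cl _ lF]] := tensor_dense r0' (W := setT) I (fun _ _ _ _ => I) (fun _ _ _ => I)
  closedT FT e2.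
have [L hL LF] := C1_tensor_dense r0' cl e4.
have [x [Ax [gx xy]]] := domain_dense T0 TD Tr Tc M0 TM y e0.
have [q q0 hq] := exp_tensor_small r0 (x - tensor (tensor_values L) 0) e4.
pose Lx := ((fun s : R => expR (q * s), fun s : R => q * expR (q * s)), x - tensor (tensor_values L) 0) :: L.
have hLx : C1_tensor Lx.
  by move=> p; rewrite in_cons => /orP[/eqP ->|/hL//]; exact: C1_expR.
have Lx0 : tensor (tensor_values Lx) 0 = x.
  by rewrite tensor_cons/= mulr0 expR0 scale1r subrK.
have gen := delay_operator_tensor r0 Phi hLx gx Lx0.
exists (x, L2of i (tensor (tensor_values Lx))).
  by exists (Ax + Phi (tensor (tensor_values Lx)), L2of i (tensor (tensor_derivs Lx))); rewrite -genTT.2.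
rewrite prod_normE/= ge_max xy/=; apply: dist_half lF _.
have E := L2of_tensor_cons r0' (C1_tensor_values hLx).
rewrite E opprD addrCA; apply: le_trans (ler_normD _ _) _.
rewrite normrN [X in _ <= X]splitr; exact: (lerD hq LF).
Qed.

Lemma delay_invariance (y : K) (F : L2 i K) t : W y ->
  {ae mu, forall s, s \in i -> W (L2repr F s)} -> 0 <= t -> W (TT t (y, F)).1.
Proof.
move=> Wy WF t0.
have cV : geometric_complete (delay_space r K).
  apply: prod_geometric_complete; first exact: hilbert_geometric_complete.
  by apply: L2_geometric_complete; exact: lebesgue_itv_fin.
have [[TTc TT0 TTD TTr] _] := genTT.
have [C [om [C0 om0 growth]]] := semigroup_growth_bound cV genTT.1.
have [h0 h0pos range] := delay_range.
have ne : tensor_set !=set0.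
  by exists (0, L2of i (tensor [::])); split => //=; exists [::]; split.
have cl : closure tensor_set (y, F).
  apply/closure_normP => e e0.
  have [l [cl lW lF]] := tensor_dense r0' W0 WD WZ clW WF e0.
  exists (y, L2of i (tensor l)); first by split => //=; exists l.
  by rewrite prod_normE/= ge_max subrr normr0 ltW.
have := closed_invariance TT0 TTD TTr C0 om0 growth ne h0pos range TTc cl (@delay_domain_dense (y, F)) t0.
(* Taking first components does not increase distances, so closeness to [tensor_set] gives closeness
   to [W], which is closed. *)
move=> /closure_normP h; apply: clW; apply/closure_normP => e /h[w [Ww _] wle].
exists w.1 => //; apply: le_trans wle; rewrite prod_normE/= le_max lexx//.
Qed.

End delay_invariance.

Lemma opnorm_le (R : realType) (V W : normedModType R) (f : {linear V -> W}) c x :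
  continuous f -> opnorm f <= c -> `|f x| <= c * `|x|.
Proof.
move=> cf fc; have [C C0 hC] := linear_bounded cf.
have [->|x0] := eqVneq x 0; first by rewrite linear0 !normr0 mulr0.
have nx : 0 < `|x| by rewrite normr_gt0.
rewrite -ler_pdivrMr//; apply: le_trans fc; apply: ub_le_sup.
  exists C => _ [y /= y1 <-]; apply: le_trans (hC y) _.
  by rewrite -[leRHS]mulr1 ler_wpM2l// ltW.
exists (`|x|^-1 *: x) => /=.
  by rewrite normrZ normfV normr_id mulVf// gt_eqF.
by rewrite linearZ_LR normrZ normfV normr_id mulrC.
Qed.

(** If no integral exists, [bochner] is 0 and lies in [W]; otherwise the functionals [inner z w.1]
    with z orthogonal to [W] vanish on the integrand and hence on the integral. *)
Lemma bochner_fst_subspace (R : realType) d (T : measurableType d)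
    (mu : {measure set T -> \bar R}) (D : set T) (K : hilbertType R) (V : normedModType R)
    (W : set K) (f : T -> (K * V)%type) : measurable D -> W 0 ->
  (forall x y, W x -> W y -> W (x + y)) -> (forall a x, W x -> W (a *: x)) -> closed W ->
  (forall s, D s -> W (f s).1) -> W (bochner mu D f).1.
Proof.
move=> mD W0 WD WZ clW Wf; rewrite /bochner; case: xgetP => // v _ fv.
apply: closed_subspace_bipolar => // z zW.
have [||_ ->] := @is_bochner_functional _ _ _ _ mu D f v (fun w => inner z w.1) `|z| mD fv.
- by move=> a x y; rewrite innerDr innerZr.
- move=> x; apply: le_trans (inner_le _ _) _; rewrite ler_wpM2l//.
  by rewrite prod_normE/= le_max lexx.
rewrite (@eq_Rintegral _ _ _ mu _ (fun=> 0)); first by rewrite /Rintegral integral0.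
by move=> s; rewrite inE => Ds; exact/zW/Wf.
Qed.
Theorem proposition4p7 (R : realType) (K : hilbertType R)
    (sepK : separable K)
    (A : set (K * K)) (T : R -> {linear K -> K}) (genT : generates A T)
    (M omega : R) (M_gt0 : 0 < M) (omega_gt0 : 0 < omega)
    (T_decay : forall t, 0 <= t -> opnorm (T t) <= M * expR (- omega * t))
    (N : {linear K -> K}) (contN : continuous N)
    (N_small : M * opnorm N / Num.sqrt (2 * omega) < 1)
    (n k : nat) (psi : 'I_n -> K)
    (phi : 'I_k -> K) (phi_orthonormal : orthonormal_system phi)
    (P : K -> K) (gramP : bilinear_gramian T N psi phi P)
    (r tau : R) (tau_gt0 : 0 < tau) (tau_lt_r : tau < r)
    (g : R -> R)
    (g_int : (@lebesgue_measure R).-integrable `]- r, 0[ (EFin \o g))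
    (g_le1 : (\int[@lebesgue_measure R]_(s in `](- r)%R, 0%R[) `|g s|%:E <= 1)%E)
    (Phi : (R -> K) -> K)
    (hPhi : Phi = point_delay N tau \/ Phi = distributed_delay N r g)
    (TT : R -> {linear delay_space r K -> delay_space r K})
    (genTT : generates (delay_operator A Phi) TT)
    (phi0 : K) (phi0_ran : closure (range P) phi0)
    (f : L2 `]- r, 0[ K)
    (f_ran : {ae @lebesgue_measure R,
       forall s, s \in `]- r, 0[ -> closure (range P) (L2repr f s)})
    (u : R -> 'rV[R]_n) (hu : L2_control u) (t : R) (t_gt0 : 0 < t) :
  closure (range P) (mild_solution TT phi0 f (fun s => inp psi (u s)) t).
Proof.
have [[Tc T0 TD Tr] AE] := genT; subst A.
have TM s x : 0 <= s -> `|T s x| <= M * `|x|.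
  move=> s0; apply: opnorm_le; first exact: Tc.
  apply: le_trans (T_decay s s0) _; rewrite ler_piMr ?(ltW M_gt0)//.
  by rewrite -expR0 ler_expR mulNr oppr_le0 mulr_ge0// ltW.
have W0 := range_gramian0 TD Tr Tc contN gramP.
have WD x y := @range_gramianD _ _ _ _ TD Tr Tc contN _ _ _ _ _ gramP x y.
have WZ a x := @range_gramianZ _ _ _ _ TD Tr Tc contN _ _ _ _ _ gramP a x.
have clW : closed (closure (range P)) by exact: closed_closure.
have WT s x := @range_gramianT _ _ _ _ T0 TD Tr Tc contN _ _ _ _ _ gramP s x.
have WN x := @range_gramianN _ _ _ _ T0 TD Tr Tc contN _ _ _ _ _ gramP x.
have inv y F s Wy WF s0 := @delay_invariance _ _ _ _ _ _ T0 TD Tr Tc M_gt0 TM contN W0 WD WZ clW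
  WT WN _ _ _ _ tau_gt0 tau_lt_r g_int g_le1 hPhi _ genTT y F s Wy WF s0.
rewrite /mild_solution; apply: (WD).
  by apply: inv => //; exact: ltW.
apply: (@bochner_fst_subspace R _ (measurableTypeR R) lebesgue_measure _ K _ _ _ (measurable_itv _)
  W0 WD WZ clW) => s; rewrite /= in_itv/= => /andP[_ st].
(* For 0 < s < t the pair (B u(s), 0) is admissible initial data: B u(s) is a combination of the
   [psi j], and the zero class vanishes almost everywhere. *)
apply: inv; last by rewrite subr_ge0 ltW.
  rewrite /inp; elim/big_ind: _ => // j _; apply: WZ.
  exact: (range_gramian_psi T0 TD Tr Tc contN gramP).
by apply: filterS (L2zeroE `]- r, 0[ K) => x h xi; rewrite (h xi).
Qed.
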